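(* Let $t_0<t_1$ be real numbers and let $X$ be a Banach space. If $\alpha\in[1,\infty)$, then $J_{t_0,t}^\alpha:L^1(t_0,t_1;X)\rightarrow W^{\alpha,1}_{RL}(t_0,t_1;X)$ is a bounded linear operator.
   Context: $L^p(t_0,t_1;X)$ is the Bochner–Lebesgue space. For $k\in\{1,2,\dots\}$ and $p\ge1$, $W^{k,p}(t_0,t_1;X)$ is the space of $f\in L^p(t_0,t_1;X)$ having weak derivatives up to order $k$ in $L^p(t_0,t_1;X)$, with norm $\sum_{j=0}^k\|f^{(j)}\|_{L^p(t_0,t_1;X)}$; $W^{0,p}:=L^p$. Riemann–Liouville fractional integral of order $\alpha>0$: $J_{t_0,t}^\alpha f(t)=\frac{1}{\Gamma(\alpha)}\int_{t_0}^t(t-s)^{\alpha-1}f(s)\,ds$; $J_{t_0,t}^0f:=f$. Riemann–Liouville fractional derivative of order $\alpha>0$: $D_{t_0,t}^\alpha f(t):=\frac{d^{[\alpha]}}{dt^{[\alpha]}}\big[J_{t_0,t}^{[\alpha]-\alpha}f(t)\big]$, the derivative being taken in the weak sense, where $[\alpha]$ denotes the least integer greater than or equal to $\alpha$. For $\alpha>0$ and $p\geq1$, $W^{\alpha,p}_{RL}(t_0,t_1;X)$ is the set of $f\in W^{[\alpha]-1,p}(t_0,t_1;X)$ such that $D_{t_0,t}^\alpha f\in L^p(t_0,t_1;X)$, with norm $$\|f\|_{W^{\alpha,p}_{RL}(t_0,t_1;X)}:=\|f\|_{W^{[\alpha]-1,p}(t_0,t_1;X)}+\|D_{t_0,t}^\alpha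 f\|_{L^p(t_0,t_1;X)}.$$ *)

(* Defs.v *)
From HB Require Import structures.
From mathcomp Require Import all_boot all_order all_algebra.
From mathcomp Require Import all_classical all_reals all_analysis.

Set Implicit Arguments.
Unset Strict Implicit.
Unset Printing Implicit Defensive.

Import Order.TTheory GRing.Theory Num.Theory.
Import numFieldNormedType.Exports.

Local Open Scope classical_set_scope.
Local Open Scope ring_scope.

Section bochner.
Context {d : measure_display} {T : measurableType d} {R : realType}.
Context {X : completeNormedModType R}.
Variables (mu : {measure set T -> \bar R}) (D : set T).

(* Finite range is carried by the type. *)
Definition simple_fun (s : {fimfun T >-> X}) : Prop :=
  forall x : X, measurable (D `&` s @^-1` [set x]) /\
    (x != 0 -> (mu (D `&` s @^-1` [set x]) < +oo)%E).

Definition simple_integral (s : {fimfun T >-> X}) : X :=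
  \sum_(x \in [set: X]) fine (mu (D `&` s @^-1` [set x])) *: x.

Definition strongly_measurable (f : T -> X) : Prop :=
  exists s : nat -> {fimfun T >-> X},
    (forall n, simple_fun (s n)) /\
    (\forall t \ae mu, D t -> s n t @[n --> \oo] --> f t).

Definition is_bochner_integral (f : T -> X) (I : X) : Prop :=
  exists s : nat -> {fimfun T >-> X},
    [/\ forall n, simple_fun (s n),
        \forall t \ae mu, D t -> s n t @[n --> \oo] --> f t,
        (\int[mu]_(t in D) (`|f t - s n t|)%:E)%E @[n --> \oo] --> 0%E
      & simple_integral (s n) @[n --> \oo] --> I].

Definition bochner_integrable (f : T -> X) : Prop :=
  exists I, is_bochner_integral f I.

(* The value does not depend on the approximating sequence; it is 0 when
   [f] is not Bochner integrable. *)
Definition bochner_integral (f : T -> X) : X := xget 0 (is_bochner_integral f).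

Definition Lp_norm (p : R) (f : T -> X) : \bar R :=
  ('N[mu]_(p%:E)[(fun t => (`|f t|)%:E) \_ D])%E.

(* As usual elements of L^p are represented by functions, which are to be
   identified when they agree almost everywhere on [D]. *)
Definition Lp_space (p : R) : set (T -> X) :=
  [set f | strongly_measurable f /\ (Lp_norm p f < +oo)%E].

End bochner.

Section sobolev.
Context {R : realType} {X : completeNormedModType R}.
Variables t0 t1 : R.
Local Notation mu := (@lebesgue_measure R).
Local Notation D := (`]t0, t1[%classic : set R).

Definition test_function (phi : R -> R) : Prop :=
  (forall n t, derivable (derive1n n phi) t 1) /\
  exists a b : R, [/\ t0 < a, b < t1 & forall t, t \notin `[a, b] -> phi t = 0].

Definition locally_integrable (u : R -> X) : Prop :=
  forall a b : R, t0 < a -> b < t1 -> bochner_integrable mu `[a, b] u.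

Definition is_weak_derivative (k : nat) (u v : R -> X) : Prop :=
  [/\ locally_integrable u, locally_integrable v
    & forall phi, test_function phi ->
        bochner_integral mu D (fun t => derive1n k phi t *: u t) =
        (- 1) ^+ k *: bochner_integral mu D (fun t => phi t *: v t)].

Definition weakly_derivable (k : nat) (u : R -> X) : Prop :=
  exists v, is_weak_derivative k u v.

(* A representative of the weak derivative of order [k], which is unique up to
   equality almost everywhere on the interval. *)
Definition weak_derivative (k : nat) (u : R -> X) : R -> X :=
  if k is 0%N then u else xget (fun=> 0) (is_weak_derivative k u).

Definition sobolev_space (k : nat) (p : R) : set (R -> X) :=
  [set f | Lp_space mu D p f /\
    forall j, (0 < j <= k)%N ->
      weakly_derivable j f /\ Lp_space mu D p (weak_derivative j f)].

Definition sobolev_norm (k : nat) (p : R) (f : R -> X) : \bar R :=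
  (\sum_(0 <= j < k.+1) Lp_norm mu D p (weak_derivative j f))%E.

End sobolev.

Section riemann_liouville.
Context {R : realType}.
Local Notation mu := (@lebesgue_measure R).

Definition Gamma (a : R) : R :=
  \int[mu]_(x in `]0, +oo[) (x `^ (a - 1) * expR (- x)).

(* Meant for nonnegative arguments only. *)
Definition natceil (a : R) : nat := `|Num.ceil a|%N.

Context {X : completeNormedModType R}.
Variables t0 t1 : R.
Local Notation D := (`]t0, t1[%classic : set R).

Definition RL_kernel (alpha : R) (f : R -> X) (t : R) : R -> X :=
  fun s => (t - s) `^ (alpha - 1) *: f s.

Definition RL_integral (alpha : R) (f : R -> X) : R -> X :=
  if alpha == 0 then f else
  fun t => (Gamma alpha)^-1 *:
    bochner_integral mu `]t0, t[ (RL_kernel alpha f t).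

Definition RL_derivative (alpha : R) (f : R -> X) : R -> X :=
  let n := natceil alpha in
  weak_derivative t0 t1 n (RL_integral (n%:R - alpha) f).

Definition RL_space (alpha p : R) : set (R -> X) :=
  let n := natceil alpha in
  [set f | [/\ sobolev_space t0 t1 n.-1 p f,
               weakly_derivable t0 t1 n (RL_integral (n%:R - alpha) f)
             & Lp_space mu D p (RL_derivative alpha f)]].

Definition RL_norm (alpha p : R) (f : R -> X) : \bar R :=
  (sobolev_norm t0 t1 (natceil alpha).-1 p f +
   Lp_norm mu D p (RL_derivative alpha f))%E.

(* [V] and [W] are spaces of functions on the interval modulo equality almost
   everywhere, with norms [normV] and [normW]; the second clause says that [A]
   acts on classes. *)
Definition bounded_linear_operator (V W : set (R -> X))
    (normV normW : (R -> X) -> \bar R) (A : (R -> X) -> (R -> X)) : Prop :=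
  [/\ forall f, V f -> W (A f),
      forall f g, V f -> V g -> ae_eq mu D f g -> ae_eq mu D (A f) (A g),
      forall (a : R) f g, V f -> V g ->
        ae_eq mu D (A (fun t => a *: f t + g t)) (fun t => a *: A f t + A g t)
    & exists C : R, forall f, V f -> (normW (A f) <= C%:E * normV f)%E].

End riemann_liouville.

(* Main.v *)
Require Import Defs.
From HB Require Import structures.
From mathcomp Require Import all_boot all_order all_algebra.
From mathcomp Require Import all_classical all_reals all_analysis.
From mathcomp Require Import measurable_realfun ring lra.

(* On L^1, J^a is, up to the factor 1 / Gamma a, the operator with the truncated
   power kernel (t - s)^(a-1).  By Tonelli and the substitution
   s = r + (t - r) u, composing the power kernels of exponents a and b gives a
   positive multiple of the one of exponent a + b; the value of the constant (a
   Beta integral) never matters, because it is absorbed in the operator norm.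
   Hence for j < a the function J^a f is a multiple of j iterated primitives of
   J^(a-j) f, and J^(n-a) J^a f is a multiple of n iterated primitives of f.
   Integrating against phi' undoes one primitive up to sign (Fubini and the
   fundamental theorem of calculus for phi), so iterated primitives have the
   expected weak derivatives, which are bounded operators of f.

   Fubini for vector-valued functions is avoided: an identity between bounded
   operators on L^1 has to be checked only on the functions 1_E x, where it is
   a statement about nonnegative real integrals.

   A weak derivative is chosen by [xget], so its uniqueness is needed: smooth
   bumps increase to the indicator of an open interval, and a function of L^1
   whose integrals over all intervals vanish is 0, by Dynkin's theorem. *)

Set Implicit Arguments.
Unset Strict Implicit.
Unset Printing Implicit Defensive.

Import Order.TTheory GRing.Theory Num.Theory.
Import numFieldNormedType.Exports.

Local Open Scope classical_set_scope.
Local Open Scope ring_scope.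

(** * The Bochner integral *)

(** All integrals of the proof run over the whole space: a function on D is extended by 0, and the
    notions relative to D are translated once and for all. No completeness of the measure is
    assumed, so the norm of an a.e. limit of simple functions need not be measurable; such norms are
    integrated as lower integrals, which respect equality a.e., and are traded for measurable
    versions whenever additivity or dominated convergence is needed. The delicate point about a
    kernel operator is less its norm than the strong measurability of its values, for its pointwise
    definition supplies no approximating simple functions. It is clear on 1_E x, where the value is
    a real function times x, and it survives limits that are controlled by measurable majorants. For
    non-integer alpha the kernel of J^(n-alpha) is singular on the diagonal, so its integrals exist
    only for almost every t and the operators are linear only almost everywhere; for integer alpha
    this factor is the identity and not a kernel operator. *)

Section simple_integral.
Context d (T : measurableType d) (R : realType).
Variable mu : {measure set T -> \bar R}.

(** A finite range makes the preimage of every set measurable, so no sigma-algebra on [V] is needed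
    and the notion is stable under pairing and arbitrary composition. *)
Definition finmeas (V : Type) (h : T -> V) :=
  finite_set (range h) /\ forall v, measurable (h @^-1` [set v]).

Lemma finmeas_preimage (V : choiceType) (h : T -> V) (A : set V) :
  finmeas h -> measurable (h @^-1` A).
Proof.
move=> [fh mh].
have -> : h @^-1` A = \bigcup_(v in range h `&` A) h @^-1` [set v].
  apply/seteqP; split => [t At|t [v [_ Av]] /= ->//].
  by exists (h t) => //; split => //; exists t.
by apply: fin_bigcup_measurable => //; exact: finite_setIl.
Qed.

Lemma finmeas_comp (V W : choiceType) (h : T -> V) (F : V -> W) :
  finmeas h -> finmeas (F \o h).
Proof.
move=> fmh; split; last by move=> w; rewrite comp_preimage; exact: finmeas_preimage.
by rewrite -(image_comp h F); apply: finite_image; case: fmh.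
Qed.

Lemma finmeas_pair (V W : choiceType) (h : T -> V) (k : T -> W) :
  finmeas h -> finmeas k -> finmeas (fun t => (h t, k t)).
Proof.
move=> [fh mh] [fk mk]; split.
  apply: sub_finite_set (finite_setX fh fk) => _ [t _ <-] /=.
  by split; exists t.
move=> [v w].
have -> : (fun t => (h t, k t)) @^-1` [set (v, w)] =
    h @^-1` [set v] `&` k @^-1` [set w].
  by apply/seteqP; split => t /= [-> ->].
exact: measurableI.
Qed.

Lemma finmeas_indic (A : set T) : measurable A -> finmeas (\1_A : T -> R).
Proof.
move=> mA; split.
  apply: (@sub_finite_set _ _ [set 0; 1]); last exact: finite_set2.
  by move=> _ [t _ <-]; rewrite /= indicE; case: (t \in A); [right|left].
by move=> v; rewrite -[X in measurable X]setTI; exact: measurable_indic.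
Qed.

Lemma finmeas_cst (V : choiceType) (v : V) : finmeas (fun _ : T => v).
Proof.
split; first exact: (@finite_image_cst T V v).
by move=> w; rewrite preimage_cst; case: ifP.
Qed.

Definition simple (V : zmodType) (h : T -> V) :=
  finmeas h /\ (mu (h @^-1` [set~ 0%R]) < +oo)%E.

Lemma simple_fiber (V : zmodType) (h : T -> V) v :
  simple h -> v != 0 -> (mu (h @^-1` [set v]) < +oo)%E.
Proof.
move=> [fh hoo] v0; apply: le_lt_trans hoo; apply: le_measure; rewrite ?inE.
- exact: finmeas_preimage.
- exact: finmeas_preimage.
- by move=> t /= ->; exact/eqP.
Qed.

Lemma simple_sub (V W : zmodType) (h : T -> V) (k : T -> W) :
  simple h -> finmeas k -> (forall t, h t = 0 -> k t = 0) -> simple k.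
Proof.
move=> [fh hoo] fk hk; split => //; apply: le_lt_trans hoo.
apply: le_measure; rewrite ?inE; [exact: finmeas_preimage..|].
by move=> t /= kt ht; apply: kt; exact: hk.
Qed.

Lemma simple_pair (V W : zmodType) (h : T -> V) (k : T -> W) :
  simple h -> simple k -> simple (fun t => (h t, k t)).
Proof.
move=> [fh hoo] [fk koo]; have fhk := finmeas_pair fh fk.
split => //; apply: le_lt_trans (_ : _ < +oo)%E; last first.
  by apply: lte_add_pinfty hoo koo.
apply: le_trans (measureU2 _ _ _); [|exact: finmeas_preimage..].
apply: le_measure; rewrite ?inE.
- exact: finmeas_preimage.
- by apply: measurableU; exact: finmeas_preimage.
- move=> t /= hk; apply: contrapT => /not_orP[/contrapT h0 /contrapT k0].
  by apply: hk; rewrite h0 k0.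
Qed.

Lemma simple_comp (V W : zmodType) (h : T -> V) (F : V -> W) :
  simple h -> F 0 = 0 -> simple (F \o h).
Proof.
move=> sh F0; apply: (simple_sub sh); first by apply: finmeas_comp; case: sh.
by move=> t /= ->.
Qed.

Lemma simpleD (V : zmodType) (h k : T -> V) :
  simple h -> simple k -> simple (fun t => h t + k t).
Proof.
move=> sh sk.
apply: (@simple_comp _ _ (fun t => (h t, k t)) (fun p => p.1 + p.2)) => /=.
  exact: simple_pair.
by rewrite addr0.
Qed.

Lemma simpleM (V : lmodType R) (g : T -> R) (h : T -> V) :
  finmeas g -> simple h -> simple (fun t => g t *: h t).
Proof.
move=> fg sh; apply: (simple_sub sh) => [|t ->]; last by rewrite scaler0.
apply: (@finmeas_comp _ _ (fun t => (g t, h t)) (fun p => p.1 *: p.2)).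
by apply: finmeas_pair => //; case: sh.
Qed.

Lemma simpleZ (V : lmodType R) (a : R) (h : T -> V) :
  simple h -> simple (fun t => a *: h t).
Proof. by apply: simpleM; exact: finmeas_cst. Qed.

(** The fibre of 0 may have infinite measure; [fine] gives it a real coefficient, which then
    multiplies 0. *)
Definition sint (V : lmodType R) (h : T -> V) : V :=
  \sum_(x \in [set: V]) fine (mu (h @^-1` [set x])) *: x.

Lemma fine_measure_bigcup (I : choiceType) (r : seq I) (P : pred I)
    (F : I -> set T) :
  uniq r -> (forall i, measurable (F i)) ->
  (forall i, P i -> mu (F i) < +oo)%E -> trivIset setT F ->
  fine (mu (\bigcup_(i in [set i | i \in r /\ P i]) F i)) =
  \sum_(i <- r | P i) fine (mu (F i)).
Proof.
move=> ur mF Foo tF.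
have -> : \bigcup_(i in [set i | i \in r /\ P i]) F i =
    \big[setU/set0]_(i <- [seq i <- r | P i]) F i.
  rewrite -bigcup_seq; congr (\bigcup_(i in _) F i); apply/seteqP; split => i /=.
    by move=> [ir Pi]; rewrite mem_filter ir Pi.
  by rewrite mem_filter => /andP[].
rewrite -[in RHS]big_filter.
have : uniq [seq i <- r | P i] by rewrite filter_uniq.
have : all P [seq i <- r | P i] by exact: filter_all.
elim: [seq i <- r | P i] => [_ _|i s IH /= /andP[Pi Ps] /andP[nis us]].
  by rewrite !big_nil measure0.
rewrite !big_cons measureU//; last 2 first.
- by apply: bigsetU_measurable.
- rewrite -bigcup_seq; apply/seteqP; split => // t [Fit [j js Fjt]].
  have ij : i = j by apply: tF => //; exists t.
  by move: nis; rewrite ij (_ : j \in s).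
rewrite fineD ?IH//.
  by rewrite ge0_fin_numE ?Foo.
rewrite ge0_fin_numE//; elim: s Ps {IH nis us} => [|j s IH /= /andP[Pj Ps]].
  by rewrite big_nil measure0.
rewrite big_cons; apply: le_lt_trans (measureU2 _ _ _) _ => //.
  by apply: bigsetU_measurable.
by apply: lte_add_pinfty; [exact: Foo|exact: IH].
Qed.

(** The integral may be computed on any partition finer than the fibres: terms with the same value
    of [F] are grouped by additivity of the measure. Fibres of infinite measure are harmless, since
    [F] vanishes there. Applied to a pair of functions, this provides the common refinement behind
    additivity. *)
Lemma sint_comp (I : choiceType) (V : lmodType R) (h : T -> I) (F : I -> V)
    (r : seq I) :
  finmeas h -> simple (F \o h) -> uniq r -> (forall t, h t \in r) ->
  sint (F \o h) = \sum_(i <- r) fine (mu (h @^-1` [set i])) *: F i.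
Proof.
move=> fh sFh ur hr; pose q := undup [seq F i | i <- r].
have fiber y : fine (mu ((F \o h) @^-1` [set y])) *: y =
    \sum_(i <- r | F i == y) fine (mu (h @^-1` [set i])) *: F i.
  have [->|y0] := eqVneq y 0.
    by rewrite scaler0 big1// => i /eqP ->; rewrite scaler0.
  under eq_bigr => i /eqP -> do [].
  rewrite -scaler_suml; congr (_ *: _).
  rewrite -fine_measure_bigcup//.
  - congr (fine (mu _)); apply/seteqP; split => [t /= Fht|t /= [i [_ /eqP] <- /= ->]//].
    by exists (h t) => //=; rewrite hr Fht.
  - by case: fh.
  - move=> i /eqP Fiy; apply: le_lt_trans (simple_fiber sFh y0).
    apply: le_measure; rewrite ?inE; [exact: finmeas_preimage|by case: sFh => -[]|].
    by move=> t /= ->.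
  - by move=> i j _ _ [t [/= <- <-]].
rewrite /sint -(fsbig_widen [set` q]) //; last first.
  move=> y [_ /= yq]; rewrite (_ : _ @^-1` _ = set0) ?measure0 ?scale0r//.
  apply/seteqP; split => // t /= ty; apply: yq; rewrite -ty.
  by rewrite mem_undup map_f.
rewrite -fsbig_seq ?undup_uniq//.
under eq_bigr do rewrite fiber.
rewrite (exchange_big_dep predT)//=.
rewrite big_seq [RHS]big_seq; apply: eq_bigr => i ir.
rewrite (eq_bigl (pred1 (F i))); last by move=> y; rewrite /= eq_sym.
rewrite -big_filter filter_pred1_uniq ?undup_uniq ?mem_undup ?map_f//.
by rewrite big_seq1.
Qed.

Lemma finmeas_enum (I : choiceType) (h : T -> I) : finmeas h ->
  exists r : seq I, uniq r /\ forall t, h t \in r.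
Proof.
move=> [/finite_seqP[r hr] _]; exists (undup r); split; first exact: undup_uniq.
move=> t; rewrite mem_undup; have : range h (h t) by exists t.
by rewrite hr.
Qed.

Lemma sintD (V : lmodType R) (h k : T -> V) : simple h -> simple k ->
  sint (fun t => h t + k t) = sint h + sint k.
Proof.
move=> sh sk; pose p t := (h t, k t); have [fp _] := simple_pair sh sk.
have [r [ur pr]] := finmeas_enum fp.
rewrite (sint_comp (h := p) (F := fun q : V * V => q.1 + q.2) (r := r))//;
  last exact: simpleD.
rewrite (sint_comp (h := p) (F := fun q : V * V => q.1) (r := r))//.
rewrite (sint_comp (h := p) (F := fun q : V * V => q.2) (r := r))//.
by rewrite -big_split; apply: eq_bigr => i _ /=; rewrite scalerDr.
Qed.

Lemma sintZ (V : lmodType R) (a : R) (h : T -> V) : simple h ->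
  sint (fun t => a *: h t) = a *: sint h.
Proof.
move=> sh; have [r [ur hr]] := finmeas_enum sh.1.
rewrite -[in LHS]/((fun v => a *: v) \o h) (sint_comp (r := r))//; last 2 first.
- by case: sh.
- exact: simpleZ.
rewrite (sint_comp (F := id) (r := r))//; last by case: sh.
by rewrite scaler_sumr; apply: eq_bigr => i _; rewrite !scalerA mulrC.
Qed.

Lemma simpleB (V : lmodType R) (h k : T -> V) :
  simple h -> simple k -> simple (fun t => h t - k t).
Proof.
move=> sh /(simpleZ (-1)) sk; have := simpleD sh sk.
by under eq_fun do rewrite scaleN1r.
Qed.

Lemma sintB (V : lmodType R) (h k : T -> V) : simple h -> simple k ->
  sint (fun t => h t - k t) = sint h - sint k.
Proof.
move=> sh sk; under eq_fun do rewrite -scaleN1r.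
by rewrite sintD ?sintZ ?scaleN1r//; exact: simpleZ.
Qed.

Lemma finmeas_measurable (V : choiceType) (h : T -> V) (F : V -> R) :
  finmeas h -> measurable_fun setT (F \o h).
Proof.
by move=> fh _ A mA; rewrite setTI comp_preimage; exact: finmeas_preimage.
Qed.

Lemma integral_norm_simple (X : normedModType R) (h : T -> X) (r : seq X) :
  finmeas h -> uniq r -> (forall t, h t \in r) ->
  (\int[mu]_t (`|h t|)%:E = \sum_(i <- r) (`|i|)%:E * mu (h @^-1` [set i]))%E.
Proof.
move=> fh ur hr.
have hE t : (`|h t|)%:E =
    (\sum_(i <- r) (`|i|)%:E * (\1_(h @^-1` [set i]) t)%:E)%E.
  rewrite (bigD1_seq (h t))//= big1 ?adde0.
    by rewrite indicE mem_set// mule1.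
  by move=> i ih; rewrite indicE memNset ?mule0// => /= /esym/eqP; exact/negP.
have mi i : measurable (h @^-1` [set i]) by exact: finmeas_preimage.
under eq_integral do rewrite hE.
rewrite ge0_integral_sum//; last first.
  move=> i; apply: emeasurable_funM => //.
  by apply/measurable_EFinP; exact: measurable_indic.
apply: eq_bigr => i _; rewrite ge0_integralZl//.
  by rewrite integral_indic// setIT.
by apply/measurable_EFinP; exact: measurable_indic.
Qed.

Lemma integral_norm_simple_lty (X : normedModType R) (h : T -> X) :
  simple h -> (\int[mu]_t (`|h t|)%:E < +oo)%E.
Proof.
move=> sh; have [r [ur hr]] := finmeas_enum sh.1.
rewrite (integral_norm_simple sh.1 ur hr); apply: lte_sum_pinfty => i _.
have [->|i0] := eqVneq i 0; first by rewrite normr0 mul0e.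
by rewrite lte_mul_pinfty// ?lee_fin//; exact: simple_fiber sh i0.
Qed.

Lemma sint_norm (X : normedModType R) (h : T -> X) : simple h ->
  ((`|sint h|)%:E <= \int[mu]_t (`|h t|)%:E)%E.
Proof.
move=> sh; have [r [ur hr]] := finmeas_enum sh.1.
rewrite -[X in sint X]/(id \o h) (sint_comp (r := r))//; last by case: sh.
rewrite (integral_norm_simple sh.1 ur hr).
apply: (@le_trans _ _ (\sum_(i <- r) (`|fine (mu (h @^-1` [set i])) *: i|)%:E)%E).
  by rewrite sumEFin lee_fin ler_norm_sum.
apply: lee_sum => i _; rewrite normrZ EFinM muleC.
have [->|i0] := eqVneq i 0; first by rewrite normr0 !mul0e.
rewrite ger0_norm ?fine_ge0// fineK// ge0_fin_numE//; exact: simple_fiber sh i0.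
Qed.

End simple_integral.

(** * Integrals of nonnegative functions that may fail to be measurable *)

Section lower_integral.
Context d (T : measurableType d) (R : realType).
Variable mu : {measure set T -> \bar R}.
Local Open Scope ereal_scope.
Import HBNNSimple.

(* The integral of a nonnegative function is a supremum over simple functions,
   so no measurability is needed. *)
Lemma ae_le_lower_integral (f g : T -> \bar R) :
  (forall t, 0 <= f t) -> (forall t, 0 <= g t) ->
  (\forall t \ae mu, f t <= g t) -> \int[mu]_t f t <= \int[mu]_t g t.
Proof.
move=> f0 g0 [N [mN N0 fgN]]; rewrite !ge0_integralTE//.
apply: ge_ereal_sup => _ [h /= hf <-].
pose k := mul_nnsfun h (indic_nnsfun R (measurableC mN)).
have kE t : k t = (h t * \1_(~` N) t)%R by [].
apply: (@le_trans _ _ (sintegral mu k)); last first.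
  apply: ereal_sup_ubound; exists k => // t; rewrite kE indicE.
  case: (boolP (t \in ~` N)) => [|_]; last by rewrite mulr0.
  rewrite inE => Nt; rewrite mulr1; apply: le_trans (hf t) _.
  by apply: contrapT => fgt; apply: Nt; exact: fgN.
rewrite -!integralT_nnsfun le_eqVlt; apply/orP; left; apply/eqP.
apply: ge0_ae_eq_integral => //.
- exact/measurable_EFinP/measurable_funTS.
- exact/measurable_EFinP/measurable_funTS.
- by move=> t _; rewrite lee_fin.
- by move=> t _; rewrite lee_fin.
exists N; split => // t hk; apply: contrapT => Nt; apply: hk => _.
by rewrite kE indicE mem_set// mulr1.
Qed.

Lemma ae_eq_lower_integral (f g : T -> \bar R) :
  (forall t, 0 <= f t) -> (forall t, 0 <= g t) ->
  (\forall t \ae mu, f t = g t) -> \int[mu]_t f t = \int[mu]_t g t.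
Proof.
move=> f0 g0 fg; apply/eqP; rewrite eq_le !ae_le_lower_integral//.
- by apply: filterS fg => t ->.
- by apply: filterS fg => t ->.
Qed.

End lower_integral.

(** * Strong measurability, the space L^1 and existence of the integral *)

Section bochner_space.
Context d (T : measurableType d) (R : realType).
Variable mu : {measure set T -> \bar R}.

(* A limit almost everywhere of simple functions need not have a measurable
   norm; [e] is a measurable substitute for it. *)
Definition ae_version (X : normedModType R) (f : T -> X) (e : T -> R) :=
  [/\ measurable_fun setT e, forall t, 0 <= e t & \forall t \ae mu, `|f t| = e t].

Definition smeas (X : normedModType R) (f : T -> X) :=
  exists s : nat -> T -> X, (forall n, simple mu (s n)) /\
    \forall t \ae mu, s n t @[n --> \oo] --> f t.

Section smeas.
Import HBSimple.
Context {X : normedModType R}.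
Implicit Types f g : T -> X.

Lemma simple_smeas f : simple mu f -> smeas f.
Proof. by move=> sf; exists (fun=> f); split => //; apply: aeW => t; exact: cvg_cst. Qed.

Lemma ae_eq_smeas f g : (\forall t \ae mu, f t = g t) -> smeas f -> smeas g.
Proof.
move=> fg [s [ss sf]]; exists s; split => //.
by apply: filterS2 fg sf => t <-.
Qed.

Lemma smeasD f g : smeas f -> smeas g -> smeas (fun t => f t + g t).
Proof.
move=> [s [ss sf]] [u [su ug]]; exists (fun n t => s n t + u n t); split.
  by move=> n; exact: simpleD.
by apply: filterS2 sf ug => t; exact: cvgD.
Qed.

Lemma smeasM (k : T -> R) f : measurable_fun setT k -> smeas f ->
  smeas (fun t => k t *: f t).
Proof.
move=> mk [s [ss sf]].
have /(approximation_sfun measurableT)[q qk] : measurable_fun setT (EFin \o k).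
  exact/measurable_EFinP.
exists (fun n t => q n t *: s n t); split.
  by move=> n; apply: simpleM => //; split.
apply: filterS sf => t; apply: cvgZ.
by have /fine_cvgP[] := qk t I.
Qed.

Lemma smeasZ (a : R) f : smeas f -> smeas (fun t => a *: f t).
Proof. by apply: smeasM; exact: measurable_cst. Qed.

Lemma smeasB f g : smeas f -> smeas g -> smeas (fun t => f t - g t).
Proof.
move=> mf /(smeasZ (-1)) mg; have := smeasD mf mg.
by under eq_fun do rewrite scaleN1r.
Qed.

Lemma smeas_version f : smeas f -> exists e, ae_version f e.
Proof.
move=> [s [ss sf]].
(* A limsup of measurable functions is measurable without any convergence, and equals the norm of
   [f] wherever [s n] converges. The outer [fine] and absolute value make it real and nonnegative at
   the remaining points. *)
exists (fun t => `|fine (limn_esup (fun n => (`|s n t|)%:E))|); split => //.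
  apply: measurableT_comp => //; apply: measurableT_comp.
    exact: fine_measurable.
  apply: measurable_fun_limn_esup => n; apply/measurable_EFinP.
  by apply: (@finmeas_measurable _ _ _ _ (s n) (fun x : X => `|x|)); case: (ss n).
apply: filterS sf => t st.
have : (`|s n t|)%:E @[n --> \oo] --> (`|f t|)%:E.
  by apply: cvg_EFin; [exact: nearW|exact: cvg_norm].
move=> h; have c : cvgn (fun n => (`|s n t|)%:E) by apply/cvg_ex; eexists; exact: h.
by rewrite is_cvg_limn_esupE// (cvg_lim _ h)//= normr_id.
Qed.

End smeas.

Local Notation N f := (\int[mu]_t (`|f t|)%:E)%E.

Section norm.
Context {X : normedModType R}.
Implicit Types f g : T -> X.

Lemma version_norm f e : ae_version f e -> N f = (\int[mu]_t (e t)%:E)%E.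
Proof.
move=> [me e0 fe]; apply: ae_eq_lower_integral => //.
by apply: filterS fe => t ->.
Qed.

Lemma norm_ge0 f : (0 <= N f)%E.
Proof. by apply: integral_ge0 => t _; rewrite lee_fin. Qed.

Lemma ae_eq_norm f g : (\forall t \ae mu, f t = g t) -> N f = N g.
Proof.
by move=> fg; apply: ae_eq_lower_integral => //; apply: filterS fg => t ->.
Qed.

Lemma le_norm f (e : T -> \bar R) : (forall t, 0 <= e t)%E ->
  (\forall t \ae mu, ((`|f t|)%:E <= e t)%E) -> (N f <= \int[mu]_t e t)%E.
Proof. by move=> e0 fe; exact: ae_le_lower_integral. Qed.

Lemma normD f g : smeas f -> smeas g -> (N (fun t => (f t + g t)%R) <= N f + N g)%E.
Proof.
move=> /smeas_version[e fe] /smeas_version[u gu].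
rewrite (version_norm fe) (version_norm gu).
have [me e0 {}fe] := fe; have [mu' u0 {}gu] := gu.
rewrite -ge0_integralD//; last 4 first.
- by move=> t _; rewrite lee_fin.
- exact/measurable_EFinP.
- by move=> t _; rewrite lee_fin.
- exact/measurable_EFinP.
apply: le_norm => [t|]; first by rewrite -EFinD lee_fin addr_ge0.
by apply: filterS2 fe gu => t <- <-; rewrite -EFinD lee_fin ler_normD.
Qed.

Lemma normZ (a : R) f : smeas f -> N (fun t => (a *: f t)%R) = ((`|a|)%:E * N f)%E.
Proof.
move=> /smeas_version[e fe]; rewrite (version_norm fe).
have [me e0 {}fe] := fe; rewrite -ge0_integralZl//; last 2 first.
- exact/measurable_EFinP.
- by move=> t _; rewrite lee_fin.
apply: ae_eq_lower_integral => // [t|].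
  by rewrite -EFinM lee_fin mulr_ge0.
by apply: filterS fe => t <-; rewrite normrZ EFinM.
Qed.

Lemma normBC f g : N (fun t => (f t - g t)%R) = N (fun t => (g t - f t)%R).
Proof. by apply: eq_integral => t _; rewrite distrC. Qed.

Lemma normB_trans f g h : smeas f -> smeas g -> smeas h ->
  (N (fun t => (f t - h t)%R) <=
   N (fun t => (f t - g t)%R) + N (fun t => (g t - h t)%R))%E.
Proof.
move=> mf mg mh.
rewrite [leLHS](_ : _ = N (fun t => (f t - g t) + (g t - h t))%R).
  by apply: normD; exact: smeasB.
by apply: eq_integral => t _; rewrite subrKA.
Qed.

Lemma norm_eq0 f : smeas f -> N f = 0%E -> \forall t \ae mu, f t = 0.
Proof.
move=> /smeas_version[e fe]; rewrite (version_norm fe).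
have [me e0 {}fe] := fe.
under eq_integral => t _ do rewrite -(ger0_norm (e0 t)) -abse_EFin.
have me' : measurable_fun setT (EFin \o e) by exact/measurable_EFinP.
move/(ae_eq_integral_abs mu measurableT me').
apply: filterS2 fe => t fe /(_ I)[] /=.
by rewrite -fe => /eqP; rewrite normr_eq0 => /eqP.
Qed.

End norm.

Definition L1 (X : normedModType R) (f : T -> X) := smeas f /\ (N f < +oo)%E.

Definition approximates (X : normedModType R) (s : nat -> T -> X) (f : T -> X) :=
  [/\ forall n, simple mu (s n),
      \forall t \ae mu, s n t @[n --> \oo] --> f t
    & (N (fun t => f t - s n t)%R @[n --> \oo] --> 0)%E].

Definition isint (X : normedModType R) (f : T -> X) (I : X) :=
  exists2 s, approximates s f & sint mu (s n) @[n --> \oo] --> I.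

Lemma cvge0_lt (u : nat -> \bar R) (e : R) : 0 < e ->
  u n @[n --> \oo] --> 0%E -> \forall n \near \oo, (u n < e%:E)%E.
Proof.
move=> e0 /fine_cvgP[fu cu].
have {}cu := cvgr_lt (0 : R) cu e e0.
by apply: filterS2 fu (cu _) => n fu; rewrite -lte_fin fineK.
Qed.

Section space.
Context {X : normedModType R}.
Implicit Types f g : T -> X.

Lemma simple_L1 f : simple mu f -> L1 f.
Proof.
by move=> sf; split; [exact: simple_smeas|exact: integral_norm_simple_lty].
Qed.

Lemma ae_eq_L1 f g : (\forall t \ae mu, f t = g t) -> L1 f -> L1 g.
Proof.
by move=> fg [mf ?]; split; [exact: ae_eq_smeas fg mf|rewrite -(ae_eq_norm fg)].
Qed.

Lemma L1D f g : L1 f -> L1 g -> L1 (fun t => f t + g t).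
Proof.
move=> [mf fo] [mg go]; split; first exact: smeasD.
by apply: le_lt_trans (normD mf mg) _; exact: lte_add_pinfty.
Qed.

Lemma L1Z (a : R) f : L1 f -> L1 (fun t => a *: f t).
Proof.
move=> [mf fo]; split; first exact: smeasZ.
by rewrite normZ// lte_mul_pinfty// lee_fin.
Qed.

Lemma L1B f g : L1 f -> L1 g -> L1 (fun t => f t - g t).
Proof.
move=> Lf /(L1Z (-1)) Lg; have := L1D Lf Lg.
by under eq_fun do rewrite scaleN1r.
Qed.

Lemma L1_le (f : T -> X) (e : T -> \bar R) : smeas f -> (forall t, 0 <= e t)%E ->
  (\forall t \ae mu, ((`|f t|)%:E <= e t)%E) -> (\int[mu]_t e t < +oo)%E -> L1 f.
Proof. by move=> mf e0 fe eo; split => //; exact: le_lt_trans (le_norm e0 fe) eo. Qed.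

Lemma approximates_L1 s f : approximates s f -> L1 f.
Proof.
move=> [ss sf sN]; have mf : smeas f by exists s.
split => //.
have [n] : exists n, (N (fun t => f t - s n t)%R < 1%:E)%E.
  by have [n _ /(_ n (leqnn n))] := cvge0_lt ltr01 sN; exists n.
move=> fs; have [ms so] := simple_L1 (ss n).
have := normD (smeasB mf ms) ms; under eq_integral do rewrite subrK.
by move=> /le_lt_trans; apply; apply: lte_add_pinfty => //; exact: lt_trans fs (ltry _).
Qed.

(** Pointwise approximants are truncated so as to be dominated by a multiple of the norm of [f];
    dominated convergence then upgrades a.e. convergence to convergence in norm. *)
Lemma L1_approximates f : L1 f -> exists s, approximates s f.
Proof.
move=> [mf fo]; have [e fe] := smeas_version mf.
move: fo; rewrite (version_norm fe) => eo.
have [me e0 {}fe] := fe; have [s [ss sf]] := mf.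
(* Off [A n], where [s n] is replaced by 0, the norm of [s n] exceeds twice that of [f], so the new
   error, the norm of [f], is at most the old one. Hence a.e. convergence survives, even where [f]
   vanishes. *)
pose A n := [set t | `|s n t| <= 2 * e t].
have mA n : measurable (A n).
  rewrite -[A n]setTI; apply: measurable_fun_le => //.
    by apply: (@finmeas_measurable _ _ _ _ (s n) (fun x : X => `|x|)); case: (ss n).
  exact: measurable_funM.
pose u n t : X := (\1_(A n) t : R) *: s n t.
have su n : simple mu (u n) by apply: simpleM => //; exact: finmeas_indic.
have ue n t : `|u n t| <= 2 * e t.
  rewrite /u indicE; case: (boolP (t \in A n)) => [/set_mem At|_].
    by rewrite scale1r.
  by rewrite scale0r normr0 mulr_ge0.
have uf : \forall t \ae mu, u n t @[n --> \oo] --> f t.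
  apply: filterS2 sf fe => t sft fet.
  apply/cvgrPdist_le => eps eps0.
  have /cvgrPdist_le/(_ _ eps0) := sft; apply: filterS => n; apply: le_trans.
  rewrite /u indicE; case: (boolP (t \in A n)) => [/set_mem At|].
    by rewrite scale1r.
  rewrite notin_setE /A/= => /negP; rewrite -ltNge -fet => fs.
  rewrite scale0r subr0 distrC; apply: le_trans (lerB_dist _ _).
  by rewrite lerBrDr -mulr2n -mulr_natl ltW.
exists u; split => //.
(* Dominated convergence needs measurable functions, hence the versions [v n] of the errors; they
   are bounded by e + 2e = 3e. *)
have /choice[v vP] : forall n, exists v, ae_version (fun t => f t - u n t) v.
  by move=> n; apply/smeas_version/smeasB => //; exact: simple_smeas.
rewrite [X in X @ _ --> _](_ : _ =
    fun n => (\int[mu]_t `|(v n t)%:E - (cst 0 t : \bar R)|)%E); last first.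
  apply/funext => n; rewrite (version_norm (vP n)); apply: eq_integral => t _.
  by rewrite sube0 gee0_abs// lee_fin; have [_ ->] := vP n.
have [] // := @dominated_convergence _ _ _ mu _ measurableT
  (fun n t => (v n t)%:E) (cst 0%E) (fun t => ((3 * e t)%:E)).
- by move=> n; apply/measurable_EFinP; have [] := vP n.
- have /ae_foralln vf : forall n, \forall t \ae mu, `|f t - u n t| = v n t.
    by move=> n; have [] := vP n.
  apply: filterS2 uf vf => t uft vft _; apply: cvg_EFin; first exact: nearW.
  rewrite [X in X @ _ --> _](_ : _ = fun n => `|f t - u n t|).
    have h : f t - u n t @[n --> \oo] --> f t - f t.
      by apply: cvgB => //; exact: cvg_cst.
    by rewrite -[X in _ --> X](normr0 X) -(subrr (f t)); exact: cvg_norm h.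
  by apply/funext => n /=.
- apply/integrableP; split; first by apply/measurable_EFinP; exact: measurable_funM.
  under eq_integral => t _ do rewrite abse_EFin (ger0_norm (mulr_ge0 _ (e0 t)))// EFinM.
  rewrite ge0_integralZl//; last 2 first.
  - exact/measurable_EFinP.
  - by move=> t _; rewrite lee_fin.
  by rewrite lte_mul_pinfty.
- have /ae_foralln vf : forall n, \forall t \ae mu, `|f t - u n t| = v n t.
    by move=> n; have [] := vP n.
  apply: filterS2 fe vf => t fet vft n _.
  rewrite abse_EFin lee_fin -vft normr_id (le_trans (ler_normB _ _))//.
  by rewrite fet (_ : 3 = 1 + 2)// mulrDl mul1r lerD2l.
Qed.

End space.

Section integral.
Context {X : completeNormedModType R}.
Implicit Types f g : T -> X.

Lemma isint_L1 f I : isint f I -> L1 f.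
Proof. by move=> [s /approximates_L1]. Qed.

(** Limit of the triangle inequality through [s n], [f], [g] and [u n], the two outer distances
    tending to 0. It yields uniqueness of the integral when [f] is [g], and the norm bound when [g]
    is 0. *)
Lemma isint_dist f g I J : isint f I -> isint g J ->
  ((`|I - J|)%:E <= N (fun t => f t - g t)%R)%E.
Proof.
move=> [s sf sI] [u ug uJ].
have [mf _] := approximates_L1 sf; have [mg _] := approximates_L1 ug.
move: sf ug => [ss sf sN] [su ug uN].
have h : (N (fun t => f t - s n t)%R + N (fun t => f t - g t)%R
    + N (fun t => g t - u n t)%R @[n --> \oo] --> 0 + N (fun t => f t - g t)%R + 0)%E.
  have fg0 := norm_ge0 (fun t => f t - g t).
  apply: cvgeD => //; first by rewrite add0e ge0_adde_def// inE.
  by apply: cvgeD => //; exact: cvg_cst.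
rewrite -[leRHS]add0e -[leRHS]adde0.
have h' : (`|sint mu (s n) - sint mu (u n)|)%:E @[n --> \oo] --> (`|I - J|)%:E.
  by apply: cvg_EFin; [exact: nearW|apply: cvg_norm; exact: cvgB].
rewrite -(cvg_lim _ h')// -(cvg_lim _ h)//; apply: lee_lim.
- by apply/cvg_ex; eexists; exact: h'.
- by apply/cvg_ex; eexists; exact: h.
apply: nearW => n; rewrite -sintB//.
apply: le_trans (sint_norm (simpleB (ss n) (su n))) _.
have ms := simple_smeas (ss n); have mu' := simple_smeas (su n).
apply: le_trans (normB_trans ms mg mu') _.
apply: leeD => //; rewrite (normBC f (s n)).
exact: normB_trans.
Qed.

Lemma isint_unique f I J : isint f I -> isint f J -> I = J.
Proof.
move=> fI fJ; apply/eqP; rewrite -subr_eq0 -normr_le0 -lee_fin.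
apply: le_trans (isint_dist fI fJ) _.
under eq_integral do rewrite subrr normr0.
by rewrite integral0.
Qed.

Lemma simple_isint f : simple mu f -> isint f (sint mu f).
Proof.
move=> sf; exists (fun=> f); last exact: cvg_cst.
split=> //; first by apply: aeW => t; exact: cvg_cst.
under eq_fun do under eq_integral do rewrite subrr normr0.
by rewrite integral0; exact: cvg_cst.
Qed.

Lemma isintZD (a : R) f g I J : isint f I -> isint g J ->
  isint (fun t => a *: f t + g t) (a *: I + J).
Proof.
move=> [s sf sI] [u ug uJ].
have [mf _] := approximates_L1 sf; have [mg _] := approximates_L1 ug.
move: sf ug => [ss sf sN] [su ug uN].
exists (fun n t => a *: s n t + u n t).
  split=> [n||]; first by apply: simpleD => //; exact: simpleZ.
    by apply: filterS2 sf ug => t h1 h2; apply: cvgD => //; exact: cvgZr.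
  have h : ((`|a|)%:E * N (fun t => f t - s n t)%R + N (fun t => g t - u n t)%R
      @[n --> \oo] --> (`|a|)%:E * 0 + 0)%E.
    by apply: cvgeD => //; exact: cvgeZl.
  rewrite mule0 adde0 in h.
  apply: (squeeze_cvge _ (cvg_cst _) h); apply: nearW => n; rewrite norm_ge0/=.
  have mfs : smeas (fun t => f t - s n t) by apply: smeasB => //; exact: simple_smeas.
  have mgu : smeas (fun t => g t - u n t) by apply: smeasB => //; exact: simple_smeas.
  rewrite -normZ//; apply: le_trans (normD (smeasZ a mfs) mgu).
  rewrite le_eqVlt; apply/orP; left; apply/eqP; apply: eq_integral => t _.
  by rewrite scalerBr opprD addrACA.
under eq_fun => n do rewrite (sintD (simpleZ a (ss n)) (su n)) (sintZ a (ss n)).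
by apply: cvgD => //; exact: cvgZr.
Qed.

Lemma ae_eq_isint f g I : (\forall t \ae mu, f t = g t) -> isint f I -> isint g I.
Proof.
move=> fg [s [ss sf sN] sI]; exists s => //; split => //.
  by apply: filterS2 fg sf => t <-.
rewrite (_ : (fun n => _) = fun n => N (fun t => f t - s n t)%R)//.
apply/funext => n; apply: ae_eq_norm.
by apply: filterS fg => t <-.
Qed.

Lemma approximates_sint s f : approximates s f ->
  exists I : X, sint mu (s n) @[n --> \oo] --> I.
Proof.
move=> sa; have [mf _] := approximates_L1 sa; have [ss sf sN] := sa.
have /cvg_ex[I sI] : cvgn (fun n => sint mu (s n)); last by exists I.
apply/cauchy_cvgP/cauchy_exP => e e0.
have e20 : 0 < e / 2 by rewrite divr_gt0.
have sNe := cvge0_lt e20 sN.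
have [m _ /(_ m (leqnn m)) sme] := sNe; exists (sint mu (s m)).
apply: filterS sNe => n sne; rewrite -ball_normE /ball_/= -lte_fin -sintB//.
apply: le_lt_trans (sint_norm (simpleB (ss m) (ss n))) _.
have msm := simple_smeas (ss m); have msn := simple_smeas (ss n).
apply: le_lt_trans (normB_trans msm mf msn) _.
by rewrite [e]splitr EFinD lteD// normBC.
Qed.

Lemma L1_isint f : L1 f -> exists I, isint f I.
Proof.
by move=> /L1_approximates[s sf]; have [I sI] := approximates_sint sf; exists I, s.
Qed.

End integral.

End bochner_space.

(** * Reduction to indicators, and integrals of a real function times a vector *)

Section density.
Import HBNNSimple.
Context d (T : measurableType d) (R : realType).
Variable mu : {measure set T -> \bar R}.
Local Notation N f := (\int[mu]_t (`|f t|)%:E)%E.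
Context {X : normedModType R}.
Implicit Types f g : T -> X.

Lemma simple_indic (A : set T) : measurable A -> (mu A < +oo)%E ->
  simple mu (\1_A : T -> R).
Proof.
move=> mA Aoo; split; first exact: finmeas_indic.
apply: le_lt_trans Aoo; apply: le_measure; rewrite ?inE//.
  by apply: finmeas_preimage; exact: finmeas_indic.
by move=> t /= h; apply: contrapT => At; apply: h; rewrite indicE memNset.
Qed.

Lemma simple_indicZ (A : set T) (x : X) : measurable A -> (mu A < +oo)%E ->
  simple mu (fun t => (\1_A t : R) *: x).
Proof.
move=> mA Aoo.
apply: (simple_comp (F := fun a : R => a *: x) (simple_indic mA Aoo)).
by rewrite scale0r.
Qed.

Lemma simple_ind (P : (T -> X) -> Prop) :
  P (fun=> 0) ->
  (forall A x, measurable A -> (mu A < +oo)%E -> P (fun t => (\1_A t : R) *: x)) ->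
  (forall f g, simple mu f -> simple mu g -> P f -> P g -> P (fun t => f t + g t)) ->
  forall f, simple mu f -> P f.
Proof.
move=> P0 PA PD f sf; have [r [ur hr]] := finmeas_enum sf.1.
(* The value 0 is left out so that each fibre in the sum has finite measure. *)
have -> : f = (fun t => \sum_(x <- [seq x <- r | x != 0])
    (\1_(f @^-1` [set x]) t : R) *: x).
  apply/funext => t; rewrite big_filter big_mkcond (bigD1_seq (f t))//=.
  rewrite big1 ?addr0 => [|x xf]; last first.
    rewrite indicE memNset ?scale0r ?if_same// => /= /esym/eqP; exact/negP.
  rewrite indicE mem_set// scale1r.
  by case: eqP => // ->.
have : all (fun x => x != 0) [seq x <- r | x != 0] by exact: filter_all.
elim: [seq x <- r | x != 0] => [_|x s IH /= /andP[x0 s0]].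
  by under eq_fun do rewrite big_nil.
under eq_fun do rewrite big_cons.
have mf y : measurable (f @^-1` [set y]) by apply: finmeas_preimage; case: sf.
apply: PD.
- by apply: simple_indicZ => //; exact: simple_fiber.
- elim: s s0 {IH} => [_|y s IH /= /andP[y0 s0]].
    under eq_fun do rewrite big_nil; split; first exact: finmeas_cst.
    rewrite (_ : _ @^-1` _ = set0) ?measure0//.
    by apply/seteqP; split => // t /=.
  under eq_fun do rewrite big_cons; apply: simpleD; last exact: IH.
  by apply: simple_indicZ => //; exact: simple_fiber.
- by apply: PA => //; exact: simple_fiber.
- exact: IH.
Qed.

Lemma L1_dense f : L1 mu f -> forall e : R, 0 < e ->
  exists2 g, simple mu g & (N (fun t => f t - g t)%R < e%:E)%E.
Proof.
move=> /L1_approximates[s [ss _ sN]] e e0.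
by have [n _ /(_ n (leqnn n))] := cvge0_lt e0 sN; exists (s n).
Qed.

Lemma sint_scale (h : T -> R) (x : X) : simple mu h -> (forall t, 0 <= h t) ->
  sint mu (fun t => h t *: x) = fine (\int[mu]_t (h t)%:E)%E *: x.
Proof.
move=> sh h0; have [r [ur hr]] := finmeas_enum sh.1.
have hE : (\int[mu]_t (h t)%:E = \int[mu]_t (`|h t|)%:E)%E.
  by apply: eq_integral => t _; rewrite ger0_norm.
rewrite (sint_comp (h := h) (F := fun a : R => a *: x) (r := r))//; last 2 first.
- by case: sh.
- by apply: (simple_comp (F := fun a : R => a *: x) sh); rewrite scale0r.
have fin i : ((`|i|)%:E * mu (h @^-1` [set i]) \is a fin_num)%E.
  have [->|i0] := eqVneq i 0; first by rewrite normr0 mul0e.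
  by rewrite fin_numM// ge0_fin_numE//; exact: simple_fiber sh i0.
rewrite hE (integral_norm_simple mu sh.1 ur hr) -sum_fine// scaler_suml.
apply: eq_bigr => i _; rewrite scalerA; congr (_ *: _).
have [i0|i0] := leP 0 i.
  have [->|i1] := eqVneq i 0; first by rewrite normr0 mul0e mulr0.
  rewrite fineM//; first by rewrite /= ger0_norm// mulrC.
  by rewrite ge0_fin_numE//; exact: simple_fiber sh i1.
rewrite (_ : _ @^-1` _ = set0) ?measure0 ?mule0 ?mul0r//.
apply/seteqP; split => // t /= hi.
by have := h0 t; rewrite hi leNgt i0.
Qed.

(** The bridge from Bochner integrals to real ones. Increasing simple approximations of [g] are
    multiplied by the fixed vector [x]; the set [A] of finite measure makes them simple in the sense
    of finite support. *)
Lemma isint_scale (A : set T) (g : T -> R) (x : X) : measurable A ->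
  (mu A < +oo)%E -> measurable_fun setT g -> (forall t, 0 <= g t) ->
  (\int[mu]_t (g t * \1_A t)%:E < +oo)%E ->
  isint mu (fun t => (g t * \1_A t) *: x)
    (fine (\int[mu]_t (g t * \1_A t)%:E)%E *: x).
Proof.
move=> mA Aoo mg g0 goo.
have mgA : measurable_fun setT (fun t => g t * \1_A t).
  by apply: measurable_funM => //; exact: measurable_indic.
have gA0 t : 0 <= g t * \1_A t by rewrite mulr_ge0.
have mg' : measurable_fun setT (EFin \o g) by exact/measurable_EFinP.
have g0' t : setT t -> (0 <= (EFin \o g) t)%E by move=> _; rewrite lee_fin.
pose q n : {nnsfun T >-> R} := nnsfun_approx measurableT mg' n.
have qg t : q n t @[n --> \oo] --> g t.
  by have /fine_cvgP[] := cvg_nnsfun_approx measurableT mg' g0' (I : setT t).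
have qle n t : q n t <= g t.
  by rewrite -lee_fin /q nnsfun_approxE; exact: le_approx.
have sq n : simple mu (fun t => q n t * \1_A t).
  by apply: (@simpleM _ _ _ _ R^o) => //; exact: simple_indic.
have [||||| ig qN qI] := @dominated_convergence _ _ _ mu _ measurableT
  (fun n t => (q n t * \1_A t)%:E) (fun t => (g t * \1_A t)%:E)
  (fun t => (g t * \1_A t)%:E).
- move=> n; apply/measurable_EFinP; apply: measurable_funM.
    exact: measurable_funTS.
  exact: measurable_indic.
- exact/measurable_EFinP.
- apply: aeW => t _; apply: cvg_EFin; first exact: nearW.
  by apply: cvgM => //; exact: cvg_cst.
- apply/integrableP; split; first exact/measurable_EFinP.
  by under eq_integral => t _ do rewrite abse_EFin (ger0_norm (gA0 t)).
- apply: aeW => t n _; rewrite abse_EFin lee_fin ger0_norm ?mulr_ge0//.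
  by rewrite ler_wpM2r.
have goo' : (\int[mu]_t (g t * \1_A t)%:E)%E \is a fin_num.
  by rewrite ge0_fin_numE// integral_ge0// => t _; rewrite lee_fin.
exists (fun n t => (q n t * \1_A t) *: x).
  split=> [n||].
  - by apply: (simple_comp (F := fun a : R => a *: x) (sq n)); rewrite scale0r.
  - apply: aeW => t; apply: cvgZr_tmp; apply: cvgM => //; exact: cvg_cst.
  - rewrite [X in X @ _ --> _](_ : _ = fun n => ((`|x|)%:E *
      \int[mu]_t `|(q n t * \1_A t)%:E - (g t * \1_A t)%:E|)%E).
      by rewrite -(mule0 (`|x|)%:E); apply: cvgeZl.
    apply/funext => n; rewrite -ge0_integralZl//.
      apply: eq_integral => t _.
      by rewrite -scalerBl normrZ mulrC distrC EFinM.
    apply: measurableT_comp => //; apply: emeasurable_funB.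
      apply/measurable_EFinP; apply: measurable_funM; first exact: measurable_funTS.
      exact: measurable_indic.
    exact/measurable_EFinP.
have qA0 n t : 0 <= q n t * \1_A t by rewrite mulr_ge0.
under eq_fun => n do rewrite (sint_scale x (sq n) (qA0 n)).
apply: cvgZr_tmp.
by move: qI; rewrite -(fineK goo') => /fine_cvgP[].
Qed.

End density.

(** * Closedness of L^1 under controlled limits *)

Section closure.
Context d (T : measurableType d) (R : realType).
Variable mu : {measure set T -> \bar R}.
Local Notation N f := (\int[mu]_t (`|f t|)%:E)%E.

(** The sum of the [F n] has a finite integral, hence is finite almost everywhere, and the terms of
    a convergent series tend to 0. *)
Lemma ae_cvg0_geometric (F : nat -> T -> \bar R) :
  (forall n, measurable_fun setT (F n)) -> (forall n t, 0 <= F n t)%E ->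
  (forall n, \int[mu]_t F n t <= (1 / (2 ^ n.+1)%:R)%:E)%E ->
  \forall t \ae mu, F n t @[n --> \oo] --> 0%E.
Proof.
move=> mF F0 Fe; pose S t := (\sum_(0 <= n <oo) F n t)%E.
have S0 t : (0 <= S t)%E by apply: nneseries_ge0.
have iS : mu.-integrable setT S.
  apply/integrableP; split.
    have := @ge0_emeasurable_sum _ T R setT F xpredT.
    by apply.
  under eq_integral do rewrite gee0_abs//.
  rewrite integral_nneseries//.
  apply: (@le_lt_trans _ _ (\sum_(0 <= n <oo) (1 / (2 ^ n.+1)%:R)%:E)%E).
    by apply: lee_nneseries => [i _ _|i _]; [exact: integral_ge0|exact: Fe].
  by apply: le_lt_trans (epsilon_trick0 xpredT _) _; rewrite ?ltry.
have := integrable_ae measurableT iS; apply: filterS => t /(_ I) St.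
have /nneseries_tail_cvg h : (S t < +oo)%E by rewrite -ge0_fin_numE.
apply: (squeeze_cvge _ (cvg_cst _) (h _)) => //; apply: nearW => n.
rewrite F0/= (nneseries_split n 1)// addn1 big_nat1 leeDl//.
by apply: nneseries_ge0.
Qed.

(** This is how strong measurability of a limit is obtained. As [f] is not yet known to be strongly
    measurable, a small lower integral of the norm of [f - g] would control nothing; the measurable
    majorant [E] does. *)
Lemma L1_closure (X : normedModType R) (f : T -> X) :
  (forall e : R, 0 < e -> exists (g : T -> X) (E : T -> \bar R),
    [/\ L1 mu g, measurable_fun setT E, forall t, (0 <= E t)%E,
        \forall t \ae mu, ((`|f t - g t|)%:E <= E t)%E
      & (\int[mu]_t E t <= e%:E)%E]) -> L1 mu f.
Proof.
move=> h.
have : forall n : nat, exists sF : (T -> X) * (T -> \bar R),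
    [/\ simple mu sF.1, measurable_fun setT sF.2, forall t, (0 <= sF.2 t)%E,
        \forall t \ae mu, ((`|f t - sF.1 t|)%:E <= sF.2 t)%E
      & (\int[mu]_t sF.2 t <= (1 / (2 ^ n.+1)%:R)%:E)%E].
  (* Summable errors give a.e. convergence without passing to a subsequence. Half of each is spent
     on reaching [g], half on a simple function close to [g]. *)
  move=> n; pose e : R := 1 / (2 ^ n.+1)%:R.
  have e0 : 0 < e by rewrite divr_gt0// ltr0n expn_gt0.
  have e20 : 0 < e / 2 by rewrite divr_gt0.
  have [g [E [Lg mE E0 fgE Ee]]] := h _ e20.
  have [s ss gs] := L1_dense Lg e20.
  have [v gsv] : exists v, ae_version mu (fun t => g t - s t) v.
    by apply/smeas_version/smeasB; [case: Lg|exact: simple_smeas].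
  move: gs; rewrite (version_norm gsv); have [mv v0 {}gsv] := gsv => gs.
  have mv' : measurable_fun setT (fun t => (v t)%:E) by exact/measurable_EFinP.
  exists (s, fun t => (E t + (v t)%:E)%E); split => //=.
  - exact: emeasurable_funD.
  - by move=> t; rewrite adde_ge0// lee_fin.
  - apply: filterS2 fgE gsv => t fgE gsv.
    apply: le_trans (leeD fgE (lexx _)); rewrite -gsv -EFinD lee_fin.
    by rewrite -(subrKA (g t)) ler_normD.
  - rewrite ge0_integralD//; last by move=> t _; rewrite lee_fin.
    by rewrite -/e [e]splitr EFinD leeD// ltW.
move=> /choice[sF sFP].
have /ae_foralln fle : forall n, \forall t \ae mu,
    ((`|f t - (sF n).1 t|)%:E <= (sF n).2 t)%E by move=> n; have [] := sFP n.
have F0 : \forall t \ae mu, (sF n).2 t @[n --> \oo] --> 0%E.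
  apply: (ae_cvg0_geometric (F := fun n => (sF n).2)) => n; by have [] := sFP n.
have mf : smeas mu f.
  exists (fun n => (sF n).1); split; first by move=> n; have [] := sFP n.
  apply: filterS2 fle F0 => t fle F0.
  apply/cvgrPdist_lt => e e0; have := cvge0_lt e0 F0; apply: filterS => n.
  by rewrite -lte_fin; apply: le_lt_trans.
have [s0 mE E0 fE Ee] := sFP 0%N.
have ms0 := simple_smeas s0; split => //.
rewrite [ltLHS](_ : _ = N (fun t => (f t - (sF 0%N).1 t) + (sF 0%N).1 t)); last first.
  by apply: eq_integral => t _; rewrite subrK.
apply: le_lt_trans (normD (smeasB mf ms0) ms0) _; apply: lte_add_pinfty.
  apply: le_lt_trans (le_norm E0 fE) _.
  by apply: le_lt_trans Ee _; exact: ltry.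
exact: integral_norm_simple_lty.
Qed.

Lemma L1_ind (X : normedModType R) (P : (T -> X) -> Prop) :
  (forall f, simple mu f -> P f) ->
  (forall f, L1 mu f -> (forall e : R, 0 < e -> exists g,
     [/\ L1 mu g, P g & (N (fun t => f t - g t) < e%:E)%E]) -> P f) ->
  forall f, L1 mu f -> P f.
Proof.
move=> Ps Pc f Lf; apply: Pc => // e e0.
have [g sg fg] := L1_dense Lf e0; exists g; split => //; last exact: Ps.
exact: simple_L1.
Qed.

End closure.

(** * The Bochner integral over the whole space as a total function *)

Section bint.
Context d (T : measurableType d) (R : realType).
Variable mu : {measure set T -> \bar R}.
Context {X : completeNormedModType R}.
Implicit Types f g : T -> X.
Local Notation N f := (\int[mu]_t (`|f t|)%:E)%E.

Definition bint f : X := xget 0 (isint mu f).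

Lemma isint_bint f I : isint mu f I -> bint f = I.
Proof.
move=> fI; rewrite /bint; case: xgetP => [J _ fJ|/(_ I)//].
exact: isint_unique fJ fI.
Qed.

Lemma bintP f : L1 mu f -> isint mu f (bint f).
Proof. by move=> /L1_isint[I fI]; rewrite (isint_bint fI). Qed.

Lemma bint_out f : ~ L1 mu f -> bint f = 0.
Proof.
move=> Lf; rewrite /bint; case: xgetP => // I _ /isint_L1 //.
Qed.

Lemma bintZD (a : R) f g : L1 mu f -> L1 mu g ->
  bint (fun t => a *: f t + g t) = a *: bint f + bint g.
Proof. by move=> /bintP hf /bintP hg; apply: isint_bint; exact: isintZD. Qed.

Lemma ae_eq_bint f g : (\forall t \ae mu, f t = g t) -> bint f = bint g.
Proof.
move=> fg; have gf : \forall t \ae mu, g t = f t by apply: filterS fg.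
have [Lf|Lf] := pselect (L1 mu f).
  by apply/esym/isint_bint/(ae_eq_isint fg); exact: bintP.
by rewrite !bint_out// => /(ae_eq_L1 gf).
Qed.

Lemma bint_norm f : L1 mu f -> ((`|bint f|)%:E <= N f)%E.
Proof.
move=> /bintP hf.
have s0 : simple mu (fun=> 0 : X).
  split; first exact: finmeas_cst.
  rewrite (_ : _ @^-1` _ = set0) ?measure0//.
  by apply/seteqP; split => // t /=.
have /isint_bint b0 := simple_isint s0.
have := isint_dist hf (simple_isint s0).
rewrite (_ : sint _ _ = 0) ?subr0; last first.
  have := sintZ 0 s0; under eq_fun do rewrite scaler0.
  by move=> ->; rewrite scale0r.
by under eq_integral do rewrite subr0.
Qed.

Lemma bintZ (a : R) f : L1 mu f -> bint (fun t => a *: f t) = a *: bint f.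
Proof.
move=> Lf; have L0 : L1 mu (fun=> 0 : X).
  by have := L1Z 0 Lf; under eq_fun do rewrite scale0r.
have b0 : bint (fun=> 0) = 0.
  apply/eqP; rewrite -normr_le0 -lee_fin; apply: le_trans (bint_norm L0) _.
  by under eq_integral do rewrite normr0; rewrite integral0.
have := bintZD a Lf L0; rewrite b0 addr0 => <-.
by congr bint; apply/funext => t; rewrite addr0.
Qed.

Lemma bintD f g : L1 mu f -> L1 mu g ->
  bint (fun t => f t + g t) = bint f + bint g.
Proof.
move=> Lf Lg; have := bintZD 1 Lf Lg; rewrite scale1r => <-.
by congr bint; apply/funext => t; rewrite scale1r.
Qed.

Lemma bintB f g : L1 mu f -> L1 mu g ->
  bint (fun t => f t - g t) = bint f - bint g.
Proof.
move=> Lf Lg; have := bintD Lf (L1Z (-1) Lg); rewrite bintZ// scaleN1r => <-.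
by congr bint; apply/funext => t; rewrite scaleN1r.
Qed.

End bint.

(** * Restriction to a measurable set *)

Section restriction.
Context d (T : measurableType d) (R : realType).
Variable mu : {measure set T -> \bar R}.
Context {X : completeNormedModType R}.
Variable D : set T.
Hypothesis mD : measurable D.
Implicit Types f g : T -> X.
Local Notation N f := (\int[mu]_t (`|f t|)%:E)%E.

Lemma fimfun_of (h : T -> X) : finite_set (range h) ->
  exists s : {fimfun T >-> X}, (s : T -> X) = h.
Proof. by move=> /mem_set fh; exists (fimfun_Sub fh). Qed.

Definition cut f t : X := if t \in D then f t else 0.

Lemma cutE f t : cut f t = (\1_D t : R) *: f t.
Proof. by rewrite /cut indicE; case: (t \in D); rewrite ?scale1r ?scale0r. Qed.

Lemma cutB f g t : (cut f) t - (cut g) t = cut (fun t => f t - g t) t.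
Proof. by rewrite !cutE scalerBr. Qed.

Lemma simple_of_fibers f : finmeas f ->
  (forall x, x != 0 -> (mu (f @^-1` [set x]) < +oo)%E) -> simple mu f.
Proof.
move=> fm foo; split => //.
have mf x : measurable (f @^-1` [set x]) by exact: finmeas_preimage.
have -> : f @^-1` [set~ 0] =
    \bigcup_(x in range f `&` [set~ 0]) f @^-1` [set x].
  apply/seteqP; split => [t ft|t [x [_ x0] /= ->]//].
  by exists (f t) => //; split => //; exists t.
have fA : finite_set (range f `&` [set~ 0]) by apply: finite_setIl; case: fm.
rewrite measure_fin_bigcup//; last first.
  by move=> x y _ _ [t [/= <- <-]].
rewrite fsbig_finite// big_seq; apply: lte_sum_pinfty => x.
by rewrite in_fset_set// inE => -[_ /eqP]; exact: foo.
Qed.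

Lemma simple_cut f : simple mu f -> simple mu (cut f).
Proof.
move=> sf; rewrite (_ : cut f = fun t => (\1_D t : R) *: f t).
  by apply: simpleM => //; exact: finmeas_indic.
by apply/funext => t; exact: cutE.
Qed.

Lemma cut_preimage f x : x != 0 ->
  (cut f) @^-1` [set x] = D `&` f @^-1` [set x].
Proof.
move=> x0; apply/seteqP; split => t /=; rewrite /cut; last first.
  by move=> [Dt]; rewrite mem_set.
by case: ifP => [/set_mem//|_ h]; move: x0; rewrite -h eqxx.
Qed.

(** [simple_fun] says nothing about [s] off [D]. Cutting discards that part: the complement of [D]
    joins the fibre of 0, the only one allowed to have infinite measure. *)
Lemma simple_funE (s : {fimfun T >-> X}) :
  simple_fun mu D s <-> simple mu (cut s).
Proof.
split=> [hs|ss x].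
  apply: simple_of_fibers; first split.
  - apply: (sub_finite_set (B := range s `|` [set 0])).
      move=> _ [t _ <-]; rewrite /cut; case: ifP => _; last by right.
      by left; exists t.
    by rewrite finite_setU; split.
  - move=> x; have [->|x0] := eqVneq x 0; last first.
      by rewrite cut_preimage//; have [] := hs x.
    rewrite (_ : _ @^-1` _ = ~` D `|` (D `&` s @^-1` [set 0])).
      by apply: measurableU; [exact: measurableC|have [] := hs 0].
    apply/seteqP; split => t /=; rewrite /cut.
      case: ifP => [/set_mem Dt s0|/negbT]; first by right.
      by rewrite notin_setE => ?; left.
    move=> [Dt|[Dt s0]]; first by rewrite memNset.
    by rewrite mem_set.
  - by move=> x x0; rewrite cut_preimage//; have [_] := hs x; apply.
have [->|x0] := eqVneq x 0.
  split=> //.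
  rewrite (_ : _ `&` _ = D `&` (cut s) @^-1` [set 0]).
    by apply: measurableI => //; case: ss => -[].
  by apply/seteqP; split => t /= [Dt]; rewrite /cut mem_set.
rewrite -cut_preimage//; split; first by case: ss => -[].
by move=> _; exact: simple_fiber.
Qed.

Lemma simple_integralE (s : {fimfun T >-> X}) :
  simple_integral mu D s = sint mu (cut s).
Proof.
apply: eq_fsbigr => x _; have [->|x0] := eqVneq x 0; first by rewrite !scaler0.
by rewrite cut_preimage.
Qed.

Lemma integral_cutB f g :
  (\int[mu]_(t in D) (`|f t - g t|)%:E = N (fun t => ((cut f) t - (cut g) t)%R))%E.
Proof.
rewrite integral_mkcond; apply: eq_integral => t _.
rewrite patchE /cut; case: ifP => _ //.
by rewrite subrr normr0.
Qed.

Lemma strongly_measurableE f : strongly_measurable mu D f <-> smeas mu (cut f).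
Proof.
split=> [[s [ss sf]]|[s [ss sf]]].
  exists (fun n => cut (s n)); split.
    by move=> n; apply/simple_funE.
  apply: filterS sf => t sf; rewrite /cut.
  under eq_fun do rewrite /cut.
  by case: ifP => [/set_mem//|_]; exact: cvg_cst.
have /choice[u us] : forall n, exists u : {fimfun T >-> X}, (u : T -> X) = s n.
  by move=> n; apply: fimfun_of; case: (ss n) => -[].
exists u; split.
  by move=> n; apply/simple_funE; rewrite us; exact: simple_cut.
apply: filterS sf => t + Dt; rewrite /cut mem_set//.
by under eq_fun do rewrite -us.
Qed.

Lemma is_bochner_integralE f I :
  is_bochner_integral mu D f I <-> isint mu (cut f) I.
Proof.
split=> [[s [ss sf sN sI]]|hI].
  exists (fun n => cut (s n)); last first.
    by under eq_fun do rewrite -simple_integralE.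
  split.
  - by move=> n; apply/simple_funE.
  - apply: filterS sf => t sf; rewrite /cut.
    under eq_fun do rewrite /cut.
    by case: ifP => [/set_mem//|_]; exact: cvg_cst.
  - by under eq_fun do rewrite -integral_cutB.
have [s [ss sf sN]] := L1_approximates (isint_L1 hI).
(* The approximants of [cut f] may be nonzero off [D]. Cutting them does not increase the distance
   to [cut f] but may change their integrals, whose new limit is identified by uniqueness of the
   integral. *)
pose r n := cut (s n).
have rf : approximates mu r (cut f).
  split.
  - by move=> n; exact: simple_cut.
  - apply: filterS sf => t; rewrite /r /cut; case: ifP => // _ _.
    exact: cvg_cst.
  - apply: (squeeze_cvge _ (cvg_cst _) sN); apply: nearW => n.
    rewrite norm_ge0/=; apply: ae_le_lower_integral => //.
    apply: aeW => t; rewrite lee_fin /r /cut; case: ifP => // _.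
    by rewrite subrr normr0.
have /choice[u us] : forall n, exists u : {fimfun T >-> X}, (u : T -> X) = s n.
  by move=> n; apply: fimfun_of; case: (ss n) => -[].
exists u; split.
- by move=> n; apply/simple_funE; rewrite us; exact: simple_cut.
- apply: filterS sf => t + Dt; rewrite /cut mem_set//.
  by under eq_fun do rewrite -us.
- under eq_fun do rewrite integral_cutB us.
  by case: rf.
- under eq_fun do rewrite simple_integralE us.
  have [J [v vf vJ]] := L1_isint (isint_L1 hI).
  have [K rK] := approximates_sint rf.
  by rewrite (isint_unique hI (ex_intro2 _ _ r rf rK)).
Qed.

Lemma bochner_integrableE f : bochner_integrable mu D f <-> L1 mu (cut f).
Proof.
split=> [[I /is_bochner_integralE /isint_L1]//|/L1_isint[I hI]].
by exists I; apply/is_bochner_integralE.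
Qed.

Lemma bochner_integralE f : bochner_integral mu D f = bint mu (cut f).
Proof.
rewrite /bochner_integral /bint; congr (xget _ _).
by apply/funext => I; apply/propext; exact: is_bochner_integralE.
Qed.

Lemma Lp_normE f : Lp_norm mu D 1 f = N (cut f).
Proof.
rewrite /Lp_norm Lnorm1; apply: eq_integral => t _.
by rewrite patchE /cut; case: ifP => _; rewrite ?normr0 ?abse0// abse_EFin normr_id.
Qed.

Lemma Lp_spaceE f : Lp_space mu D 1 f <-> L1 mu (cut f).
Proof.
by rewrite /Lp_space/= Lp_normE; split=> -[/strongly_measurableE].
Qed.

End restriction.

(** * Bounded operators on L^1 *)

Section bounded_operators.
Context d (T : measurableType d) (R : realType).
Variable mu : {measure set T -> \bar R}.
Context {X : completeNormedModType R}.
Local Notation N f := (\int[mu]_t (`|f t|)%:E)%E.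
Local Notation L1 := (L1 mu).

(** Linearity is asked only almost everywhere: where the integral defining [A f t] does not exist,
    its default value 0 may break additivity. *)
Definition bounded_op (A : (T -> X) -> T -> X) := exists M : R,
  [/\ 0 <= M,
      forall f, L1 f -> L1 (A f) /\ (N (A f) <= M%:E * N f)%E
    & forall a f g, L1 f -> L1 g ->
        \forall t \ae mu, A (fun t => a *: f t + g t) t = a *: A f t + A g t].

Lemma bounded_op_L1 A f : bounded_op A -> L1 f -> L1 (A f).
Proof. by move=> [M [_ h _]] /h[]. Qed.

Lemma bounded_op_sub A f g : bounded_op A -> L1 f -> L1 g ->
  \forall t \ae mu, A (fun t => f t - g t) t = A f t - A g t.
Proof.
move=> [M [_ _ h]] Lf Lg; have := h (-1) g f Lg Lf; apply: filterS => t.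
rewrite scaleN1r addrC => <-; congr (A _ t).
by apply/funext => u; rewrite scaleN1r addrC.
Qed.

Lemma bounded_op_ae A f g : bounded_op A -> L1 f -> L1 g ->
  (\forall t \ae mu, f t = g t) -> \forall t \ae mu, A f t = A g t.
Proof.
move=> bA Lf Lg fg; have [M [M0 AM _]] := bA.
have [LA NA] := AM _ (L1B Lf Lg).
have N0 : N (fun t => f t - g t) = 0%E.
  rewrite (@ae_eq_norm _ _ _ mu _ _ (fun=> 0 : X)).
    by under eq_integral do rewrite normr0; rewrite integral0.
  by apply: filterS fg => t ->; rewrite subrr.
have : \forall t \ae mu, A (fun t => f t - g t) t = 0.
  apply: norm_eq0; first by case: LA.
  by apply/eqP; rewrite eq_le norm_ge0 andbT; move: NA; rewrite N0 mule0.
have := bounded_op_sub bA Lf Lg; apply: filterS2 => t -> /eqP.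
by rewrite subr_eq0 => /eqP.
Qed.

Lemma bounded_op_comp A B : bounded_op A -> bounded_op B -> bounded_op (A \o B).
Proof.
move=> bA bB; have [M [M0 AM lA]] := bA; have [M' [M'0 BM lB]] := bB.
exists (M * M'); split; first exact: mulr_ge0.
  move=> f Lf; have [LB NB] := BM f Lf; have [LA NA] := AM _ LB; split => //.
  by apply: le_trans NA _; rewrite EFinM -muleA lee_wpmul2l// lee_fin.
move=> a f g Lf Lg; have [LBf _] := BM f Lf; have [LBg _] := BM g Lg.
have Lfg : L1 (fun t => a *: f t + g t) by apply: L1D => //; exact: L1Z.
have LBfg : L1 (fun t => a *: B f t + B g t) by apply: L1D => //; exact: L1Z.
have := bounded_op_ae bA (BM _ Lfg).1 LBfg (lB a f g Lf Lg).
by have := lA a _ _ LBf LBg; apply: filterS2 => t /= <-.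
Qed.

Lemma bounded_opZ c A : bounded_op A -> bounded_op (fun f t => c *: A f t).
Proof.
move=> [M [M0 AM lA]]; exists (`|c| * M); split; first exact: mulr_ge0.
  move=> f Lf; have [LA NA] := AM f Lf; split; first exact: L1Z.
  rewrite normZ; last by case: LA.
  by rewrite EFinM -muleA lee_wpmul2l// lee_fin.
move=> a f g Lf Lg; have := lA a f g Lf Lg; apply: filterS => t ->.
by rewrite scalerDr !scalerA mulrC.
Qed.

Lemma bounded_op_id : bounded_op id.
Proof.
exists 1; split => [//|f Lf|a f g _ _]; first by rewrite mul1e.
by apply: aeW.
Qed.

(** If [A] and [B] agree at [g], then [A f - B f] is [A (f - g)] minus [B (f - g)], of norm at most
    M + M' times that of [f - g]; agreement thus passes from indicators to simple functions and then
    to L^1 by density. *)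
Lemma bounded_op_eq A B : bounded_op A -> bounded_op B ->
  (forall (E : set T) (x : X), measurable E -> (mu E < +oo)%E ->
     \forall t \ae mu,
       A (fun s => (\1_E s : R) *: x) t = B (fun s => (\1_E s : R) *: x) t) ->
  forall f, L1 f -> \forall t \ae mu, A f t = B f t.
Proof.
move=> bA bB AB; have [M [M0 AM lA]] := bA; have [M' [M'0 BM lB]] := bB.
apply: L1_ind.
  apply: simple_ind => [|//|f g sf sg Af Ag]; last first.
    have Lf := simple_L1 sf; have Lg := simple_L1 sg.
    have ABD : \forall t \ae mu, A f t + A g t = B f t + B g t.
      by apply: filterS2 Af Ag => t -> ->.
    have e : (fun t => f t + g t) = (fun t => 1 *: f t + g t).
      by apply/funext => u; rewrite scale1r.
    rewrite e; apply: filterS3 ABD (lA 1 f g Lf Lg) (lB 1 f g Lf Lg) => t.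
    by rewrite !scale1r => + -> ->.
  have := AB set0 0 measurable0; rewrite measure0 => /(_ (ltry _)).
  by have -> : (fun s => (\1_(@set0 T) s : R) *: (0 : X)) = (fun=> 0);
    [apply/funext => s; rewrite scaler0|].
move=> f Lf h.
suff N0 : N (fun t => A f t - B f t) = 0%E.
  have := norm_eq0 (smeasB (bounded_op_L1 bA Lf).1 (bounded_op_L1 bB Lf).1) N0.
  by apply: filterS => t /eqP; rewrite subr_eq0 => /eqP.
apply/eqP; rewrite eq_le norm_ge0 andbT; apply/lee_addgt0Pr => e e0.
rewrite add0e.
(* The added 1 keeps the divisor positive when both bounds are 0. *)
have MM : 0 < M + M' + 1 by rewrite ltr_wpDl// addr_ge0.
have [g [Lg ABg fg]] := h (e / (M + M' + 1)) (divr_gt0 e0 MM).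
have mAf := (bounded_op_L1 bA Lf).1; have mAg := (bounded_op_L1 bA Lg).1.
have mBf := (bounded_op_L1 bB Lf).1; have mBg := (bounded_op_L1 bB Lg).1.
apply: le_trans (normB_trans mAf mAg mBf) _.
rewrite (@ae_eq_norm _ _ _ mu _ (fun t => A g t - B f t) (fun t => B g t - B f t));
  last by apply: filterS ABg => t ->.
rewrite [X in (_ + X)%E]normBC.
rewrite -(ae_eq_norm (bounded_op_sub bA Lf Lg)) -(ae_eq_norm (bounded_op_sub bB Lf Lg)).
have [_ NA] := AM _ (L1B Lf Lg); have [_ NB] := BM _ (L1B Lf Lg).
apply: le_trans (leeD NA NB) _.
rewrite -ge0_muleDl ?lee_fin// -EFinD.
apply: (@le_trans _ _ ((M + M' + 1)%:E * (e / (M + M' + 1))%:E)%E).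
  apply: lee_pmul; rewrite ?lee_fin ?addr_ge0//; first exact: norm_ge0.
    by rewrite lerDl.
  exact: ltW.
by rewrite -EFinM mulrCA divff ?mulr1// gt_eqF.
Qed.

Definition bounded_functional (L : (T -> X) -> X) := exists M : R,
  [/\ 0 <= M,
      forall f, L1 f -> ((`|L f|)%:E <= M%:E * N f)%E
    & forall a f g, L1 f -> L1 g -> L (fun t => a *: f t + g t) = a *: L f + L g].

(** A functional that ignores null sets turns the a.e. linearity of [A] into exact linearity. *)
Lemma bounded_functional_comp L A : bounded_functional L ->
    (forall f g, L1 f -> L1 g -> (\forall t \ae mu, f t = g t) -> L f = L g) ->
  bounded_op A -> bounded_functional (L \o A).
Proof.
move=> [M [M0 LM lL]] Lae [M' [M'0 AM lA]]; exists (M * M'); split.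
- exact: mulr_ge0.
- move=> f Lf; have [LA NA] := AM f Lf; apply: le_trans (LM _ LA) _.
  by rewrite EFinM -muleA lee_wpmul2l// lee_fin.
- move=> a f g Lf Lg; have LAf := (AM f Lf).1; have LAg := (AM g Lg).1.
  rewrite /= -lL//; apply: Lae (lA a f g Lf Lg).
    by apply: (AM _ _).1; apply: L1D => //; exact: L1Z.
  by apply: L1D => //; exact: L1Z.
Qed.

Lemma bounded_functional_eq L K : bounded_functional L -> bounded_functional K ->
  (forall (E : set T) (x : X), measurable E -> (mu E < +oo)%E ->
     L (fun s => (\1_E s : R) *: x) = K (fun s => (\1_E s : R) *: x)) ->
  forall f, L1 f -> L f = K f.
Proof.
move=> [M [M0 LM lL]] [M' [M'0 KM lK]] LK.
apply: L1_ind.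
  apply: simple_ind => [|//|f g sf sg Lf Lg]; last first.
    have L1f := simple_L1 sf; have L1g := simple_L1 sg.
    have e : (fun t => f t + g t) = (fun t => 1 *: f t + g t).
      by apply/funext => u; rewrite scale1r.
    by rewrite e lL// lK// Lf Lg.
  have := LK set0 0 measurable0; rewrite measure0 => /(_ (ltry _)).
  by have -> : (fun s => (\1_(@set0 T) s : R) *: (0 : X)) = (fun=> 0);
    [apply/funext => s; rewrite scaler0|].
move=> f Lf h; apply/eqP; rewrite -subr_eq0 -normr_le0 -lee_fin.
apply/lee_addgt0Pr => e e0; rewrite add0e.
have MM : 0 < M + M' + 1 by rewrite ltr_wpDl// addr_ge0.
have [g [Lg LKg fg]] := h (e / (M + M' + 1)) (divr_gt0 e0 MM).
have sub (H : (T -> X) -> X) : (forall a f g, L1 f -> L1 g ->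
    H (fun t => a *: f t + g t) = a *: H f + H g) ->
    H f - H g = H (fun t => f t - g t).
  move=> lH; rewrite addrC -scaleN1r -lH//; congr H; apply/funext => t.
  by rewrite scaleN1r addrC.
rewrite (_ : L f - K f = (L f - L g) - (K f - K g)); last first.
  by rewrite LKg opprB addrA subrK.
rewrite (sub L)// (sub K)//.
apply: (@le_trans _ _ ((M + M' + 1)%:E * (e / (M + M' + 1))%:E)%E); last first.
  by rewrite -EFinM mulrCA divff ?mulr1// gt_eqF.
apply: (@le_trans _ _ ((M + M')%:E * N (fun t => f t - g t))%E).
  rewrite EFinD ge0_muleDl ?lee_fin//.
  apply: (@le_trans _ _ ((`|L (fun t => f t - g t)|)%:E +
    (`|K (fun t => f t - g t)|)%:E)%E).
    by rewrite -EFinD lee_fin ler_normB.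
  by apply: leeD; [apply: LM|apply: KM]; exact: L1B.
apply: lee_pmul; rewrite ?lee_fin ?addr_ge0//; first exact: norm_ge0.
  by rewrite lerDl.
exact: ltW.
Qed.

Lemma bounded_op_mul (k : T -> R) (B : R) : measurable_fun setT k ->
  (forall t, `|k t| <= B) -> bounded_op (fun f t => k t *: f t).
Proof.
move=> mk kB; have B0 : 0 <= B by exact: le_trans (normr_ge0 _) (kB point).
have NB (f : T -> X) : L1 f -> (N (fun t => (k t *: f t)%R) <= B%:E * N f)%E.
  move=> [mf _]; have [e fe] := smeas_version mf; rewrite (version_norm fe).
  have [me e0 {}fe] := fe; rewrite -ge0_integralZl//; last 2 first.
  - exact/measurable_EFinP.
  - by move=> t _; rewrite lee_fin.
  apply: le_norm => [t|]; first by rewrite -EFinM lee_fin mulr_ge0.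
  apply: filterS fe => t <-; rewrite -EFinM lee_fin normrZ.
  exact: ler_wpM2r.
exists B; split => // [f Lf|a f g _ _].
  split; last exact: NB.
  split; first by apply: smeasM; case: Lf.
  by apply: le_lt_trans (NB f Lf) _; rewrite lte_mul_pinfty//; case: Lf.
by apply: aeW => t; rewrite scalerDr !scalerA mulrC.
Qed.

Lemma bounded_functional_bint A : bounded_op A ->
  bounded_functional (fun f => bint mu (A f)).
Proof.
move=> bA.
have b1 : bounded_functional (bint mu (X := X)).
  exists 1; split; [exact: ler01|move=> f Lf|move=> a f g Lf Lg].
    by rewrite mul1e; exact: bint_norm.
  exact: (bintZD a Lf Lg).
exact: (bounded_functional_comp b1 (fun f g _ _ fg => ae_eq_bint fg) bA).
Qed.

End bounded_operators.

(** * Kernel operators *)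

Section kernel_operator.
Context d (T : measurableType d) (R : realType).
Variable mu : {sigma_finite_measure set T -> \bar R}.
Context {X : completeNormedModType R}.
Variable D : set T.
Hypotheses (mD : measurable D) (Doo : (mu D < +oo)%E).
Local Notation N f := (\int[mu]_t (`|f t|)%:E)%E.
Local Notation L1 := (L1 mu).

(** The last clause is the L^1 half of Schur's test: integrating in t first bounds the operator by
    [M]. Nonnegativity gives access to Tonelli. Vanishing off D x D, with [D] of finite measure,
    allows inserting 1_D and so makes a measurable real function times a vector strongly
    measurable. *)
Definition L1_kernel (k : T * T -> R) :=
  [/\ measurable_fun setT k, forall p, 0 <= k p,
      forall t s, ~ (D t /\ D s) -> k (t, s) = 0
    & exists2 M : R, 0 <= M &
        forall s, (\int[mu]_t (k (t, s))%:E <= M%:E)%E].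

Definition kop (k : T * T -> R) (f : T -> X) (t : T) : X :=
  bint mu (fun s => k (t, s) *: f s).

Section one_kernel.
Variable k : T * T -> R.
Hypothesis hk : L1_kernel k.

Let mk : measurable_fun setT k. Proof. by case: hk. Qed.
Let k0 p : 0 <= k p. Proof. by case: hk. Qed.

Lemma measurable_kernel_section t : measurable_fun setT (fun s => k (t, s)).
Proof. exact: measurableT_comp mk (pair1_measurable t). Qed.

Lemma measurable_kernel_section2 s : measurable_fun setT (fun t => k (t, s)).
Proof. exact: measurableT_comp mk (pair2_measurable s). Qed.

Lemma measurable_kernel_mul (e : T -> R) : measurable_fun setT e ->
  measurable_fun setT (fun p : T * T => (k p * e p.2)%:E).
Proof.
move=> me; apply/measurable_EFinP; apply: measurable_funM => //.
exact: measurableT_comp me measurable_snd.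
Qed.

Lemma kernel_tonelli (e : T -> R) : measurable_fun setT e -> (forall s, 0 <= e s) ->
  (\int[mu]_t \int[mu]_s (k (t, s) * e s)%:E =
   \int[mu]_s ((e s)%:E * \int[mu]_t (k (t, s))%:E))%E.
Proof.
move=> me e0.
rewrite (fubini_tonelli (fun p => (k p * e p.2)%:E)) /=; last 2 first.
- exact: measurable_kernel_mul.
- by move=> p; rewrite lee_fin mulr_ge0.
apply: eq_integral => s _; rewrite -ge0_integralZl//; last 3 first.
- by apply/measurable_EFinP; exact: measurable_kernel_section2.
- by move=> t _; rewrite lee_fin.
- by rewrite lee_fin.
by apply: eq_integral => t _; rewrite -EFinM mulrC.
Qed.

Lemma measurable_kernel_int (e : T -> R) : measurable_fun setT e ->
  (forall s, 0 <= e s) ->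
  measurable_fun setT (fun t => \int[mu]_s (k (t, s) * e s)%:E)%E.
Proof.
move=> me e0.
apply: (measurable_fun_fubini_tonelli_F (fun p => (k p * e p.2)%:E)) => [|p].
  exact: measurable_kernel_mul.
by rewrite lee_fin mulr_ge0.
Qed.

Lemma kernel_int_ge0 (e : T -> R) t : (forall s, 0 <= e s) ->
  (0 <= \int[mu]_s (k (t, s) * e s)%:E)%E.
Proof. by move=> e0; apply: integral_ge0 => s _; rewrite lee_fin mulr_ge0. Qed.

Lemma kernel_int_le (e : T -> R) (M : R) : measurable_fun setT e ->
    (forall s, 0 <= e s) -> 0 <= M ->
    (forall s, (\int[mu]_t (k (t, s))%:E <= M%:E)%E) ->
  (\int[mu]_t \int[mu]_s (k (t, s) * e s)%:E <= M%:E * \int[mu]_s (e s)%:E)%E.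
Proof.
move=> me e0 M0 kM; rewrite kernel_tonelli// -ge0_integralZl//; last 2 first.
- exact/measurable_EFinP.
- by move=> s _; rewrite lee_fin.
apply: ge0_le_integral => //.
- move=> s _; rewrite mule_ge0 ?lee_fin// integral_ge0// => t _.
  by rewrite lee_fin.
- apply: emeasurable_funM; first exact/measurable_EFinP.
  apply: (measurable_fun_fubini_tonelli_G (fun p => (k p)%:E)) => [|p].
    exact/measurable_EFinP.
  by rewrite lee_fin.
- by apply: emeasurable_funM => //; exact/measurable_EFinP.
- by move=> s _; rewrite muleC lee_wpmul2r// lee_fin.
Qed.

Lemma kernel_int_lty (e : T -> R) : measurable_fun setT e -> (forall s, 0 <= e s) ->
  (\int[mu]_s (e s)%:E < +oo)%E ->
  \forall t \ae mu, (\int[mu]_s (k (t, s) * e s)%:E < +oo)%E.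
Proof.
move=> me e0 eoo; have [_ _ _ [M M0 kM]] := hk.
have : mu.-integrable setT (fun t => \int[mu]_s (k (t, s) * e s)%:E)%E.
  apply/integrableP; split; first exact: measurable_kernel_int.
  under eq_integral => t _ do rewrite (gee0_abs (kernel_int_ge0 t e0)).
  apply: le_lt_trans (kernel_int_le me e0 M0 kM) _.
  by rewrite lte_mul_pinfty// lee_fin.
move=> /(integrable_ae measurableT); apply: filterS => t /(_ I).
by rewrite ge0_fin_numE// kernel_int_ge0.
Qed.

Lemma norm_kernel (f : T -> X) e t : ae_version mu f e ->
  N (fun s => k (t, s) *: f s) = (\int[mu]_s (k (t, s) * e s)%:E)%E.
Proof.
move=> [me e0 fe]; apply: ae_eq_lower_integral => // [s|].
  by rewrite lee_fin mulr_ge0.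
by apply: filterS fe => s <-; rewrite normrZ ger0_norm.
Qed.

Lemma kernel_L1 (f : T -> X) : L1 f -> \forall t \ae mu, L1 (fun s => k (t, s) *: f s).
Proof.
move=> [mf fo]; have [e fe] := smeas_version mf.
move: fo; rewrite (version_norm fe) => eo; have [me e0 _] := fe.
have := kernel_int_lty me e0 eo; apply: filterS => t kt; split.
  by apply: smeasM => //; exact: measurable_kernel_section.
by rewrite (norm_kernel _ fe).
Qed.

(** This holds at every t: where the integrand is not in L^1 the default value of the integral is
    0. *)
Lemma kop_norm (f : T -> X) e t : ae_version mu f e ->
  ((`|kop k f t|)%:E <= \int[mu]_s (k (t, s) * e s)%:E)%E.
Proof.
move=> fe; have [L|nL] := pselect (L1 (fun s => k (t, s) *: f s)).
  by rewrite -(norm_kernel _ fe); exact: bint_norm.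
rewrite /kop bint_out// normr0; have [_ e0 _] := fe.
exact: kernel_int_ge0.
Qed.

Lemma kopZD (a : R) (f g : T -> X) : L1 f -> L1 g -> \forall t \ae mu,
  kop k (fun s => a *: f s + g s) t = a *: kop k f t + kop k g t.
Proof.
move=> /kernel_L1 kf /kernel_L1 kg; apply: filterS2 kf kg => t kf kg.
rewrite /kop -(bintZD a kf kg); congr bint; apply/funext => s.
by rewrite scalerDr !scalerA mulrC.
Qed.

Lemma kop_scale (e : T -> R) (x : X) : measurable_fun setT e ->
  (forall s, 0 <= e s) -> (\int[mu]_s (e s)%:E < +oo)%E ->
  \forall t \ae mu, kop k (fun s => e s *: x) t =
    fine (\int[mu]_s (k (t, s) * e s)%:E)%E *: x.
Proof.
move=> me e0 eoo; have := kernel_int_lty me e0 eoo; apply: filterS => t kt.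
have [_ _ kD _] := hk.
have kE s : k (t, s) * e s = k (t, s) * e s * \1_D s.
  rewrite indicE; case: (boolP (s \in D)) => [_|]; first by rewrite mulr1.
  by rewrite notin_setE => Ds; rewrite kD ?mul0r// => -[].
have /isint_bint h : isint mu (fun s => (k (t, s) * e s * \1_D s) *: x)
    (fine (\int[mu]_s (k (t, s) * e s * \1_D s)%:E)%E *: x).
  apply: isint_scale => //.
  - apply: measurable_funM => //; exact: measurable_kernel_section.
  - by move=> s; rewrite mulr_ge0.
  - by under eq_integral do rewrite -kE.
rewrite /kop -[RHS](_ : fine (\int[mu]_s (k (t, s) * e s * \1_D s)%:E)%E *: x = _).
  by rewrite -h; congr bint; apply/funext => s; rewrite scalerA -kE.
by congr (fine _ *: _); apply: eq_integral => s _; rewrite -kE.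
Qed.

Lemma kernel_int_out (e : T -> R) t : ~ D t ->
  (\int[mu]_s (k (t, s) * e s)%:E)%E = 0%E.
Proof.
have [_ _ kD _] := hk => Dt; apply: integral0_eq => s _.
by rewrite kD ?mul0r// => -[].
Qed.

Lemma kop_bounded : bounded_op mu (kop k).
Proof.
have [_ _ kD [M M0 kM]] := hk.
have NA f : L1 f -> (N (kop k f) <= M%:E * N f)%E.
  move=> [mf fo]; have [e fe] := smeas_version mf; have [me e0 _] := fe.
  rewrite (version_norm fe); apply: le_trans (kernel_int_le me e0 M0 kM).
  by apply: le_norm => [t|]; [exact: kernel_int_ge0|apply: aeW => t; exact: kop_norm].
exists M; split => //; last exact: kopZD.
move=> f Lf; split; last exact: NA.
(* With the norm estimate known, what remains is mainly strong measurability, proved on indicators,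
   then for sums and for limits. *)
move: f Lf; apply: L1_ind.
  apply: simple_ind.
  - have -> : kop k (fun=> 0) = (fun=> 0).
      apply/funext => t; apply/eqP; rewrite -normr_le0 -lee_fin.
      have v0 : ae_version mu (fun=> 0 : X) (fun=> 0).
        by split=> //; apply: aeW => s; rewrite normr0.
      apply: le_trans (kop_norm t v0) _; under eq_integral do rewrite mulr0.
      by rewrite integral0.
    have := simple_L1 (simple_indicZ (0 : X) mD Doo).
    by under eq_fun do rewrite scaler0.
  - move=> A x mA Aoo; pose e := \1_A : T -> R.
    have me : measurable_fun setT e by exact: measurable_indic.
    have e0 s : 0 <= e s by [].
    have eoo : (\int[mu]_s (e s)%:E < +oo)%E by rewrite integral_indic// setIT.
    pose q t := fine (\int[mu]_s (k (t, s) * e s)%:E)%E.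
    have mq : measurable_fun setT q.
      apply: measurableT_comp (measurable_kernel_int me e0).
      exact: fine_measurable.
    (* The measurable factor [q] multiplies the simple function 1_D x; the indicator changes
       nothing, because [q] vanishes off [D]. *)
    apply: (@ae_eq_L1 _ _ _ mu _ (fun t => q t *: ((\1_D t : R) *: x))).
      have := kop_scale x me e0 eoo; apply: filterS => t ->.
      rewrite indicE; case: (boolP (t \in D)) => [_|]; first by rewrite scale1r.
      by rewrite notin_setE => Dt; rewrite /q kernel_int_out// !scale0r.
    apply: (@L1_le _ _ _ mu _ _ (fun t => (`|x|)%:E * \int[mu]_s (k (t, s) * e s)%:E)%E).
    + by apply: smeasM => //; apply/simple_smeas/simple_indicZ.
    + by move=> t; rewrite mule_ge0 ?lee_fin// kernel_int_ge0.
    + have := kernel_int_lty me e0 eoo; apply: filterS => t kt.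
      have kt0 := kernel_int_ge0 t e0.
      rewrite normrZ EFinM muleC; apply: lee_pmul; rewrite ?lee_fin//.
        by rewrite normrZ ger0_norm// ler_piMl.
      by rewrite /q ger0_norm ?fine_ge0// fineK// ge0_fin_numE.
    + rewrite ge0_integralZl//; last 2 first.
      * exact: measurable_kernel_int.
      * by move=> t _; exact: kernel_int_ge0.
      rewrite lte_mul_pinfty// ?lee_fin//.
      apply: le_lt_trans (kernel_int_le me e0 M0 kM) _.
      by rewrite lte_mul_pinfty// lee_fin.
  - move=> f g /simple_L1 Lf /simple_L1 Lg kf kg.
    apply: (ae_eq_L1 _ (L1D kf kg)); have := kopZD 1 Lf Lg; apply: filterS => t.
    rewrite scale1r => <-; congr (kop k _ t); apply/funext => s.
    by rewrite scale1r.
move=> f Lf h; apply: L1_closure => e e0.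
have M1 : 0 < M + 1 by rewrite ltr_wpDl.
have [g [Lg Lkg fg]] := h (e / (M + 1)) (divr_gt0 e0 M1).
have [v gv] := smeas_version (L1B Lf Lg).1; have [mv v0 _] := gv.
(* The majorant is the real kernel operator applied to a version [v] of the norm of [f - g]; it is
   measurable by Tonelli and its integral is at most M times that of [v]. *)
exists (kop k g), (fun t => \int[mu]_s (k (t, s) * v s)%:E)%E; split => //.
- exact: measurable_kernel_int.
- by move=> t; exact: kernel_int_ge0.
- have := kopZD (-1) Lg Lf; apply: filterS => t kE.
  rewrite (_ : kop k f t - kop k g t = kop k (fun s => f s - g s) t).
    exact: kop_norm.
  rewrite addrC -scaleN1r -kE; congr (kop k _ t); apply/funext => s.
  by rewrite scaleN1r addrC.
- apply: le_trans (kernel_int_le mv v0 M0 kM) _; rewrite -(version_norm gv).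
  apply: (@le_trans _ _ ((M + 1)%:E * (e / (M + 1))%:E)%E); last first.
    by rewrite -EFinM mulrCA divff ?mulr1// gt_eqF.
  apply: lee_pmul; rewrite ?lee_fin//; first exact: norm_ge0.
    by rewrite lerDl.
  exact: ltW.
Qed.

End one_kernel.

Lemma kop_comp (k1 k2 k3 : T * T -> R) (c : R) (f : T -> X) : 0 <= c ->
    L1_kernel k1 -> L1_kernel k2 -> L1_kernel k3 ->
    (forall t r, (\int[mu]_s (k1 (t, s) * k2 (s, r))%:E = (c * k3 (t, r))%:E)%E) ->
  L1 f -> \forall t \ae mu, kop k1 (kop k2 f) t = c *: kop k3 f t.
Proof.
move=> c0 hk1 hk2 hk3 k123.
have [b1 b2 b3] := And3 (kop_bounded hk1) (kop_bounded hk2) (kop_bounded hk3).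
apply: (bounded_op_eq (bounded_op_comp b1 b2) (bounded_opZ c b3)).
move=> E x mE Eoo; pose e := \1_E : T -> R.
have me : measurable_fun setT e by exact: measurable_indic.
have e0 s : 0 <= e s by [].
have eoo : (\int[mu]_s (e s)%:E < +oo)%E by rewrite integral_indic// setIT.
(* Up to a null set [kop k2] maps 1_E x to q x. Applying [kop k1] gives an iterated real integral,
   in which the inner variable s is integrated out by the hypothesis on the three kernels. *)
pose q t := fine (\int[mu]_s (k2 (t, s) * e s)%:E)%E.
have mq : measurable_fun setT q.
  apply: measurableT_comp (measurable_kernel_int hk2 me e0).
  exact: fine_measurable.
have q0 t : 0 <= q t by rewrite fine_ge0// kernel_int_ge0.
have qE : \forall t \ae mu, (q t)%:E = (\int[mu]_s (k2 (t, s) * e s)%:E)%E.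
  have := kernel_int_lty hk2 me e0 eoo; apply: filterS => t kt.
  by rewrite fineK// ge0_fin_numE// kernel_int_ge0.
have qoo : (\int[mu]_s (q s)%:E < +oo)%E.
  have [_ _ _ [M M0 kM]] := hk2.
  rewrite (@ae_eq_lower_integral _ _ _ mu _
    (fun t => \int[mu]_s (k2 (t, s) * e s)%:E)%E)//; last first.
    by move=> t; exact: (kernel_int_ge0 hk2).
  apply: le_lt_trans (kernel_int_le hk2 me e0 M0 kM) _.
  by rewrite lte_mul_pinfty// lee_fin.
have Le : L1 (fun s => e s *: x) by apply/simple_L1/simple_indicZ.
have k2q := kop_scale hk2 x me e0 eoo.
have Lq : L1 (fun s => q s *: x).
  exact: ae_eq_L1 k2q (bounded_op_L1 b2 Le).
have h1 := bounded_op_ae b1 (bounded_op_L1 b2 Le) Lq k2q.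
have h2 := kop_scale hk1 x mq q0 qoo.
have h3 := kop_scale hk3 x me e0 eoo.
have h12 : \forall t \ae mu, kop k1 (kop k2 (fun s => e s *: x)) t =
    fine (\int[mu]_s (k1 (t, s) * q s)%:E)%E *: x.
  by apply: filterS2 h1 h2 => t -> ->.
have k3oo := kernel_int_lty hk3 me e0 eoo.
apply: filterS3 h12 h3 k3oo => t /= -> -> k3oo; rewrite scalerA; congr (_ *: _).
have [mk1 k10 _ _] := hk1; have [mk2 k20 _ _] := hk2; have [mk3 k30 _ _] := hk3.
have -> : (\int[mu]_s (k1 (t, s) * q s)%:E =
    \int[mu]_s \int[mu]_r (k1 (t, s) * (k2 (s, r) * e r))%:E)%E.
  transitivity (\int[mu]_s ((k1 (t, s))%:E * \int[mu]_r (k2 (s, r) * e r)%:E))%E.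
    apply: ae_eq_lower_integral => [s|s|].
    - by rewrite lee_fin mulr_ge0.
    - by rewrite mule_ge0 ?lee_fin// (kernel_int_ge0 hk2).
    - by apply: filterS qE => s <-.
  apply: eq_integral => s _; rewrite -ge0_integralZl//.
  - apply/measurable_EFinP; apply: measurable_funM => //.
    exact: (measurable_kernel_section hk2).
  - by move=> r _; rewrite lee_fin mulr_ge0.
  - by rewrite lee_fin.
rewrite (fubini_tonelli (fun p => (k1 (t, p.1) * (k2 p * e p.2))%:E)) /=; last 2 first.
- apply/measurable_EFinP; apply: measurable_funM.
    exact: measurableT_comp (measurable_kernel_section hk1 t) measurable_fst.
  apply: measurable_funM => //; exact: measurableT_comp me measurable_snd.
- by move=> p; rewrite lee_fin !mulr_ge0.
transitivity (fine (\int[mu]_r ((c)%:E * (k3 (t, r) * e r)%:E))%E).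
  congr fine; apply: eq_integral => r _.
  transitivity (\int[mu]_s ((e r)%:E * (k1 (t, s) * k2 (s, r))%:E))%E.
    by apply: eq_integral => s _; rewrite -EFinM [in RHS]mulrC mulrA.
  rewrite ge0_integralZl//.
  - by rewrite k123 -!EFinM mulrC mulrA.
  - apply/measurable_EFinP; apply: measurable_funM.
      exact: (measurable_kernel_section hk1).
    exact: (measurable_kernel_section2 hk2).
  - by move=> s _; rewrite lee_fin mulr_ge0.
  - by rewrite lee_fin.
rewrite ge0_integralZl//; last 2 first.
- apply/measurable_EFinP; apply: measurable_funM => //.
  exact: (measurable_kernel_section hk3).
- by move=> s _; rewrite lee_fin mulr_ge0.
by rewrite fineM// ge0_fin_numE// (kernel_int_ge0 hk3).
Qed.

(* A sign condition on the multipliers lets Tonelli's theorem do all the work. *)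
Lemma kop_dual (k : T * T -> R) (psi rho : T -> R) (B : R) (f : T -> X) :
    L1_kernel k -> measurable_fun setT psi -> measurable_fun setT rho ->
    (forall t, 0 <= psi t <= B) -> (forall t, 0 <= rho t <= B) ->
    (forall s, (\int[mu]_t (psi t * k (t, s))%:E = (rho s)%:E)%E) ->
  L1 f -> bint mu (fun t => psi t *: kop k f t) = bint mu (fun s => rho s *: f s).
Proof.
move=> hk mpsi mrho psiB rhoB kpr; have [mk k0 kD [M M0 kM]] := hk.
have psi0 t : 0 <= psi t by have /andP[] := psiB t.
have rho0 t : 0 <= rho t by have /andP[] := rhoB t.
have psin t : `|psi t| <= B by rewrite ger0_norm//; have /andP[] := psiB t.
have rhon t : `|rho t| <= B by rewrite ger0_norm//; have /andP[] := rhoB t.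
have bkop := bounded_op_comp (bounded_op_mul mu mpsi psin) (kop_bounded hk).
apply: (bounded_functional_eq (bounded_functional_bint bkop)
  (bounded_functional_bint (bounded_op_mul mu mrho rhon))).
move=> E x mE Eoo /=; pose e := \1_E : T -> R.
have me : measurable_fun setT e by exact: measurable_indic.
have e0 s : 0 <= e s by [].
have eoo : (\int[mu]_s (e s)%:E < +oo)%E by rewrite integral_indic// setIT.
pose q t := fine (\int[mu]_s (k (t, s) * e s)%:E)%E.
have mq : measurable_fun setT q.
  apply: measurableT_comp (measurable_kernel_int hk me e0).
  exact: fine_measurable.
have q0 t : 0 <= q t by rewrite fine_ge0// (kernel_int_ge0 hk).
have qE : \forall t \ae mu, (q t)%:E = (\int[mu]_s (k (t, s) * e s)%:E)%E.
  have := kernel_int_lty hk me e0 eoo; apply: filterS => t kt.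
  by rewrite fineK// ge0_fin_numE// (kernel_int_ge0 hk).
have qD t : q t * \1_D t = q t.
  rewrite indicE; case: (boolP (t \in D)) => [_|]; first by rewrite mulr1.
  by rewrite notin_setE => Dt; rewrite /q (kernel_int_out hk)// mulr0.
have qint : (\int[mu]_t (psi t * q t)%:E = \int[mu]_s (rho s * e s)%:E)%E.
  transitivity (\int[mu]_t \int[mu]_s (psi t * (k (t, s) * e s))%:E)%E.
    apply: ae_eq_lower_integral => [t|t|].
    - by rewrite lee_fin mulr_ge0.
    - by apply: integral_ge0 => s _; rewrite lee_fin !mulr_ge0.
    apply: filterS qE => t; rewrite EFinM => ->; rewrite -ge0_integralZl//.
    - apply/measurable_EFinP; apply: measurable_funM => //.
      exact: (measurable_kernel_section hk).
    - by move=> s _; rewrite lee_fin mulr_ge0.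
    - by rewrite lee_fin.
  rewrite (fubini_tonelli (fun p => (psi p.1 * (k p * e p.2))%:E)) /=; last 2 first.
  - apply/measurable_EFinP; apply: measurable_funM.
      exact: measurableT_comp mpsi measurable_fst.
    by apply: measurable_funM => //; exact: measurableT_comp me measurable_snd.
  - by move=> p; rewrite lee_fin !mulr_ge0.
  apply: eq_integral => s _; rewrite EFinM -kpr muleC -ge0_integralZl//.
  - by apply: eq_integral => t _; rewrite -EFinM mulrA mulrC.
  - apply/measurable_EFinP; apply: measurable_funM => //.
    exact: (measurable_kernel_section2 hk).
  - by move=> t _; rewrite lee_fin mulr_ge0.
  - by rewrite lee_fin.
have rhooo : (\int[mu]_s (rho s * e s)%:E < +oo)%E.
  apply: (@le_lt_trans _ _ (\int[mu]_s (B%:E * (e s)%:E))%E); last first.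
    rewrite ge0_integralZl//; last 3 first.
    - exact/measurable_EFinP.
    - by move=> s _; rewrite lee_fin.
    - by rewrite lee_fin (le_trans (rho0 point))//; have /andP[] := rhoB point.
    rewrite lte_mul_pinfty// lee_fin (le_trans (rho0 point))//.
    by have /andP[] := rhoB point.
  apply: ge0_le_integral => //.
  - by move=> s _; rewrite lee_fin mulr_ge0.
  - by apply/measurable_EFinP; exact: measurable_funM.
  - by apply: emeasurable_funM => //; exact/measurable_EFinP.
  - by move=> s _; rewrite -EFinM lee_fin ler_wpM2r//; have /andP[] := rhoB s.
transitivity (bint mu (fun t => (psi t * q t * \1_D t) *: x)).
  apply: ae_eq_bint; have := kop_scale hk x me e0 eoo; apply: filterS => t ->.
  by rewrite scalerA -mulrA qD.
transitivity (fine (\int[mu]_s (rho s * e s)%:E)%E *: x); last first.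
  apply/esym; rewrite (_ : (fun s => _) = (fun s => (rho s * e s) *: x)).
    exact/isint_bint/isint_scale.
  by apply/funext => s; rewrite scalerA.
have iE : (\int[mu]_t (psi t * q t * \1_D t)%:E = \int[mu]_s (rho s * e s)%:E)%E.
  by rewrite -qint; apply: eq_integral => t _; rewrite -mulrA qD.
rewrite -iE; apply/isint_bint/isint_scale => //.
- exact: measurable_funM.
- by move=> t; rewrite mulr_ge0.
- by rewrite iE.
Qed.

End kernel_operator.

(** * Power kernels *)

Section affine.
Context {R : realType}.
Local Notation mu := (@lebesgue_measure R).

(** Under x -> (x - r) / h the preimage of an interval is h times as long, so by uniqueness of
    Lebesgue measure [mu] is 1/h times its own image measure. *)
Lemma ge0_integral_affine (f : R -> \bar R) (r h : R) : 0 < h ->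
  measurable_fun setT f -> (forall x, 0 <= f x)%E ->
  (\int[mu]_x f (((x : R) - r) / h)%R = h%:E * \int[mu]_x f x)%E.
Proof.
move=> h0 mf f0; pose phi (x : R) : measurableTypeR R := (x - r) / h.
have mphi : measurable_fun setT phi.
  by apply: measurable_funM => //; exact: measurable_funB.
have hi0 : 0 <= h^-1 by rewrite invr_ge0 ltW.
have nuE A : measurable A -> mu A = mscale (NngNum hi0) (pushforward mu phi) A.
  move=> mA; apply: lebesgue_measure_unique => //= _ [[a b]] _ <-.
  rewrite /mscale /= /pushforward.
  rewrite (_ : phi @^-1` `]a, b]%classic = `](a * h + r), (b * h + r)]%classic).
    rewrite !lebesgue_measure_itv/= !lte_fin ltrD2r ltr_pM2r//.
    case: ifPn => _; last by rewrite mule0.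
    rewrite -!EFinB -EFinM; congr EFin.
    by field; rewrite gt_eqF.
  apply/seteqP; split => x; rewrite /phi/= !in_itv/=.
    by rewrite ltr_pdivlMr// ler_pdivrMr// ltrBrDr lerBlDr.
  by rewrite ltr_pdivlMr// ler_pdivrMr// ltrBrDr lerBlDr.
transitivity (\int[pushforward mu phi]_x f x)%E.
  by rewrite ge0_integral_pushforward//; exact: in1W.
rewrite [in RHS](@eq_measure_integral _ _ _ _
    (mscale (NngNum hi0) (pushforward mu phi))); last by move=> A mA _; exact: nuE.
rewrite ge0_integral_mscale// muleA -EFinM divff ?mul1e//.
by rewrite gt_eqF.
Qed.

End affine.

(** * Truncated powers: integrability and composition *)

Section power_kernel.
Context {R : realType}.
Local Notation mu := (@lebesgue_measure R).
Variables t0 t1 : R.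
Hypothesis t01 : t0 < t1.
Local Notation D := (`]t0, t1[%classic : set R).

Definition power_kernel (c : R) (p : R * R) : R :=
  if [&& t0 < p.2, p.2 < p.1 & p.1 < t1] then (p.1 - p.2) `^ (c - 1) else 0.

Lemma measurable_power_kernel c : measurable_fun setT (power_kernel c).
Proof.
apply: measurable_fun_ifT.
- apply: measurable_and; first exact: measurable_fun_ltr.
  by apply: measurable_and; exact: measurable_fun_ltr.
- apply: (measurableT_comp (measurable_powR (c - 1))).
  exact: measurable_funB.
- exact: measurable_cst.
Qed.

Lemma power_kernel_ge0 c p : 0 <= power_kernel c p.
Proof. by rewrite /power_kernel; case: ifP => // _; exact: powR_ge0. Qed.

Lemma power_kernel_out c t s : ~ (D t /\ D s) -> power_kernel c (t, s) = 0.
Proof.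
move=> h; rewrite /power_kernel/=; case: ifP => // /and3P[t0s st tt1].
exfalso; apply: h; rewrite /= !in_itv/= t0s tt1 (lt_trans t0s st).
by rewrite (lt_trans st tt1).
Qed.

(** The profile of [power_kernel] on an interval rescaled to length 1. *)
Definition unit_power (c u : R) : R := if 0 < u < 1 then u `^ (c - 1) else 0.

Lemma measurable_unit_power c : measurable_fun setT (unit_power c).
Proof.
apply: measurable_fun_ifT.
- by apply: measurable_and; exact: measurable_fun_ltr.
- exact: measurable_powR.
- exact: measurable_cst.
Qed.

Lemma unit_power_ge0 c u : 0 <= unit_power c u.
Proof. by rewrite /unit_power; case: ifP => // _; exact: powR_ge0. Qed.

(** For c < 1 the integrand is unbounded at 0. On [1/(n+1), 1] the primitive u^c / c bounds the
    integral by 1/c, uniformly in n, and these intervals increase to the half-open unit interval. *)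
Lemma integral_unit_power_lty (c : R) : 0 < c -> (\int[mu]_u (unit_power c u)%:E < +oo)%E.
Proof.
move=> c0; pose F n : set R := `[n.+1%:R^-1, 1]%classic.
have F0 n x : F n x -> 0 < x.
  by rewrite /F/= in_itv/= => /andP[+ _]; apply: lt_le_trans; rewrite invr_gt0.
have FE n : (\int[mu]_(x in F n) (x `^ (c - 1))%:E <= (c^-1)%:E)%E.
  (* For n = 0 the interval is the single point 1, which the fundamental theorem of calculus
     excludes. *)
  have [->|n0] := eqVneq n 0%N.
    rewrite /F invr1 set_itv1 integral_set1.
    by rewrite lee_fin invr_ge0 ltW.
  have ab : n.+1%:R^-1 < 1 :> R by rewrite invf_lt1 ?ltr0n// ltr1n ltnS lt0n.
  have dF (x : R) : 0 < x ->
      is_derive x 1 (fun y : R => c^-1 * y `^ c) (x `^ (c - 1)).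
    move=> x0; have := is_deriveZ c^-1 (is_derive1_powR c x0).
    by rewrite /GRing.scale/= mulrA mulVf ?mul1r ?gt_eqF.
  have dF' (x : R) : 0 < x -> {for x, continuous (fun y : R => c^-1 * y `^ c)}.
    move=> x0; apply/differentiable_continuous/derivable1_diffP.
    exact: (@ex_derive _ _ _ _ _ _ _ (dF x x0)).
  rewrite (@continuous_FTC2 _ _ (fun x : R => c^-1 * x `^ c) _ _ ab).
  - rewrite -EFinB lee_fin powR1 mulr1 gerBl.
    by rewrite mulr_ge0 ?powR_ge0// invr_ge0 ltW.
  - apply: derivable_within_continuous => x /F0 x0.
    exact: (@ex_derive _ _ _ _ _ _ _ (is_derive1_powR (c - 1) x0)).
  - split.
    + move=> x; rewrite in_itv/= => /andP[nx _].
      have x0 : 0 < x by apply: lt_trans nx; rewrite invr_gt0.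
      exact: (@ex_derive _ _ _ _ _ _ _ (dF x x0)).
    + by apply: cvg_at_right_filter; apply: dF'; rewrite invr_gt0.
    + by apply: cvg_at_left_filter; apply: dF'.
  - move=> x; rewrite in_itv/= => /andP[nx _].
    have x0 : 0 < x by apply: lt_trans nx; rewrite invr_gt0.
    by rewrite derive1E; exact: (@derive_val _ _ _ _ _ _ _ (dF x x0)).
have mF n : measurable (F n) by exact: measurable_itv.
have nF : {homo F : n m / (n <= m)%N >-> (n <= m)%O}.
  move=> n m nm; apply/subsetPset => x; rewrite /F/= !in_itv/= => /andP[+ ->].
  by rewrite andbT; apply: le_trans; rewrite lef_pV2 ?posrE// ler_nat.
have mp n : measurable_fun (F n) (fun x : R => (x `^ (c - 1))%:E).
  by apply: measurable_funTS; apply/measurable_EFinP; exact: measurable_powR.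
have p0 n x : F n x -> (0 <= (x `^ (c - 1))%:E)%E by rewrite lee_fin powR_ge0.
have := ge0_nondecreasing_set_cvg_integral (mu := mu) nF mF mp p0.
move=> h.
have : (\int[mu]_(x in \bigcup_n F n) (x `^ (c - 1))%:E <= (c^-1)%:E)%E.
  rewrite -(cvg_lim _ h)//; apply: lime_le; last exact: nearW.
  by apply/cvg_ex; eexists; exact: h.
move=> /le_lt_trans h'; apply: le_lt_trans (h' _ (ltry _)).
rewrite [leRHS]integral_mkcond; apply: ge0_le_integral => //.
- by move=> u _; rewrite lee_fin unit_power_ge0.
- by apply/measurable_EFinP; exact: measurable_unit_power.
- apply/(measurable_restrictT _ _).1; first exact: bigcupT_measurable.
  by apply: measurable_funTS; apply/measurable_EFinP; exact: measurable_powR.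
- move=> u _; rewrite patchE /unit_power; case: ifPn => [/andP[u0 u1]|_].
    rewrite mem_set//; exists (Num.truncn u^-1) => //.
    rewrite /F/= in_itv/= (ltW u1) andbT invf_ple ?posrE//.
    by rewrite ltW// truncnS_gt.
  by case: ifP => //; rewrite lee_fin powR_ge0.
Qed.

Lemma power_kernel_L1 (c : R) : 0 < c -> L1_kernel mu D (power_kernel c).
Proof.
move=> c0; split.
- exact: measurable_power_kernel.
- exact: power_kernel_ge0.
- by move=> t s; exact: power_kernel_out.
have L0 : 0 < t1 - t0 by rewrite subr_gt0.
pose I := (\int[mu]_u (unit_power c u)%:E)%E.
have I0 : (0 <= I)%E by apply: integral_ge0 => u _; rewrite lee_fin unit_power_ge0.
have Ioo : (I < +oo)%E by exact: integral_unit_power_lty.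
(* With L = t1 - t0, the kernel is at most L^(c-1) times the unit profile at (t - s) / L;
   substituting brings out a further factor L, whatever s is. *)
exists ((t1 - t0) `^ (c - 1) * ((t1 - t0) * fine I)).
  by rewrite mulr_ge0 ?powR_ge0// mulr_ge0 ?fine_ge0// ltW.
move=> s; rewrite !EFinM fineK ?ge0_fin_numE//.
have mu0 : measurable_fun setT (EFin \o unit_power c).
  by apply/measurable_EFinP; exact: measurable_unit_power.
have mu1 : measurable_fun setT (fun t : R => (unit_power c ((t - s) / (t1 - t0)))%:E).
  apply: measurableT_comp mu0 _; apply: measurable_funM => //.
  exact: measurable_funB.
rewrite -(ge0_integral_affine s L0 mu0); last first.
  by move=> u; rewrite lee_fin unit_power_ge0.
rewrite -ge0_integralZl//; last 2 first.
- by move=> u _; rewrite lee_fin unit_power_ge0.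
- by rewrite lee_fin powR_ge0.
apply: ge0_le_integral => //.
- by move=> t _; rewrite lee_fin power_kernel_ge0.
- apply/measurable_EFinP.
  exact: measurableT_comp (measurable_power_kernel c) (pair2_measurable s).
- exact: measurable_funeM.
- move=> t _; rewrite -EFinM lee_fin /power_kernel /unit_power/=.
  case: ifPn => [/and3P[t0s st tt1]|_]; last first.
    by rewrite mulr_ge0 ?powR_ge0//; case: ifP => // _; exact: powR_ge0.
  rewrite divr_gt0 ?subr_gt0//= ltr_pdivrMr// mul1r.
  have -> : t - s < t1 - t0 by lra.
  have ts0 : 0 <= (t - s) / (t1 - t0) by rewrite divr_ge0 ?subr_ge0// ltW.
  by rewrite -(powRM _ (ltW L0) ts0) mulrC divfK// gt_eqF.
Qed.

Lemma ae_itv_ex (P : R -> Prop) (a b : R) : a < b ->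
  (\forall t \ae mu, P t) -> exists2 t, a < t < b & P t.
Proof.
move=> ab [A [mA A0 PA]]; apply: contrapT => h.
have : (mu `]a, b[%classic <= mu A)%E.
  apply: le_measure; rewrite ?inE//.
  move=> t /=; rewrite in_itv/= => tab; apply: PA => /= Pt; apply: h.
  by exists t.
by rewrite A0 lebesgue_measure_itv/= lte_fin ab -EFinB lee_fin subr_le0 leNgt ab.
Qed.

Lemma power_kernel_comp (b c : R) : 0 < b -> 0 < c -> exists2 K : R, 0 < K &
  forall t r, (\int[mu]_s (power_kernel b (t, s) * power_kernel c (s, r))%:E =
    (K * power_kernel (b + c) (t, r))%:E)%E.
Proof.
move=> b0 c0; pose beta u := unit_power b (1 - u) * unit_power c u.
have beta0 u : 0 <= beta u by rewrite mulr_ge0 ?unit_power_ge0.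
have mbeta : measurable_fun setT beta.
  apply: measurable_funM; last exact: measurable_unit_power.
  by apply: measurableT_comp (measurable_unit_power b) _; exact: measurable_funB.
pose B := (\int[mu]_u (beta u)%:E)%E.
have B0 : (0 <= B)%E by apply: integral_ge0 => u _; rewrite lee_fin.
have scale t r : t0 < r -> r < t -> t < t1 ->
    (\int[mu]_s (power_kernel b (t, s) * power_kernel c (s, r))%:E =
     (power_kernel (b + c) (t, r))%:E * B)%E.
  move=> t0r rt tt1; have h0 : 0 < t - r by rewrite subr_gt0.
  (* The exponent b + c - 1 splits into b - 1 and c - 1 from the two kernels and 1 from the change
     of variable. *)
  have hE : power_kernel (b + c) (t, r) =
      (t - r) `^ (b - 1) * (t - r) `^ (c - 1) * (t - r).
    rewrite /power_kernel/= t0r rt tt1/=.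
    have hn : t - r != 0 by rewrite gt_eqF.
    rewrite -[X in _ * X](powRr1 (ltW h0)) -!powRD ?hn ?implybT//.
    by congr (_ `^ _); ring.
  rewrite hE EFinM -muleA -(ge0_integral_affine r h0); last 2 first.
  - exact/measurable_EFinP.
  - by move=> u; rewrite lee_fin.
  rewrite -ge0_integralZl//; last 3 first.
  - apply/measurable_EFinP; apply: measurableT_comp mbeta _.
    by apply: measurable_funM => //; exact: measurable_funB.
  - by move=> u _; rewrite lee_fin.
  - by rewrite lee_fin mulr_ge0 ?powR_ge0.
  apply: eq_integral => s _; rewrite -EFinM; congr EFin.
  have [/andP[rs st]|nrst] := boolP (r < s < t).
    rewrite /power_kernel/= (lt_trans t0r rs) st tt1 t0r rs (lt_trans st tt1)/=.
    rewrite /beta /unit_power.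
    have -> : 1 - (s - r) / (t - r) = (t - s) / (t - r) by field; rewrite gt_eqF.
    rewrite !divr_gt0 ?subr_gt0//= !ltr_pdivrMr// !mul1r ltrD2l ltrN2 rs.
    have ts0 : 0 <= (t - s) / (t - r) by rewrite divr_ge0 ?subr_ge0// ltW.
    have sr0 : 0 <= (s - r) / (t - r) by rewrite divr_ge0 ?subr_ge0// ltW.
    rewrite ltrD2r st mulrACA -(powRM _ (ltW h0) ts0) -(powRM _ (ltW h0) sr0).
    by rewrite ![(t - r) * _]mulrC !divfK ?gt_eqF.
  rewrite /power_kernel/= /beta /unit_power.
  have -> : (0 < (s - r) / (t - r) < 1) = false.
    apply/negbTE; apply: contra nrst => /andP[].
    by rewrite pmulr_lgt0 ?invr_gt0// subr_gt0 => -> /=; rewrite ltr_pdivrMr// mul1r ltrD2r.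
  rewrite !mulr0; case: ifP => [/and3P[_ st _]|]; last by rewrite mul0r.
  case: ifP => [/and3P[_ rs _]|]; last by rewrite mulr0.
  by move: nrst; rewrite rs st.
(* Instead of estimating the Beta integral at both ends, apply the kernel of exponent b to the
   section of the other at the midpoint r, which is integrable: the result is finite for almost
   every t, hence for some t in ]r, t1[, and there it is a positive number times [B]. *)
have Boo : (B < +oo)%E.
  pose r := (t0 + t1) / 2.
  have [t0r rt1] : t0 < r /\ r < t1 by have := t01; rewrite /r; split; lra.
  have [_ _ _ [M _ kM]] := power_kernel_L1 c0.
  have me := measurable_kernel_section2 (power_kernel_L1 c0) r.
  have eoo := le_lt_trans (kM r) (ltry _).
  have := kernel_int_lty (power_kernel_L1 b0) me
    (fun s => power_kernel_ge0 c (s, r)) eoo.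
  move=> /(ae_itv_ex rt1)[t /andP[rt tt1]]; rewrite scale//.
  have kp : 0 < power_kernel (b + c) (t, r).
    by rewrite /power_kernel/= t0r rt tt1/= powR_gt0// subr_gt0.
  case: (B) B0 => [x _ _|_|//]; first exact: ltry.
  by rewrite gt0_muley ?lte_fin.
(* A zero integral would force [beta] to vanish almost everywhere, yet it is positive on all of ]0,
   1[. *)
have Bgt0 : (0 < B)%E.
  rewrite lt_neqAle B0 andbT; apply/negP => /eqP Bz.
  have : \forall u \ae mu, setT u -> (EFin \o beta) u = cst 0%E u.
    apply/(ae_eq_integral_abs mu measurableT); first exact/measurable_EFinP.
    rewrite [RHS]Bz; apply: eq_integral => u _.
    by rewrite /= ger0_norm.
  move=> /(ae_itv_ex ltr01)[u /andP[u0 u1] /(_ I)] /= /eqP.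
  rewrite eqe /beta /unit_power u0 u1 subr_gt0 u1 gtrBl u0/= mulf_eq0.
  by rewrite !powR_eq0 ?subr_eq0 (gt_eqF u0) (gt_eqF u1).
exists (fine B) => [|t r]; first by rewrite fine_gt0// Bgt0.
have [/and3P[t0r rt tt1]|nrt] := boolP [&& t0 < r, r < t & t < t1].
  by rewrite scale// EFinM fineK ?ge0_fin_numE// muleC.
rewrite {3}/power_kernel/= (negbTE nrt) mulr0; apply: integral0_eq => s _.
rewrite /power_kernel/=; case: ifP => [/and3P[t0s st tt1]|]; last by rewrite mul0r.
case: ifP => [/and3P[t0r rs _]|]; last by rewrite mulr0.
by move: nrt; rewrite t0r tt1 (lt_trans rs st).
Qed.

End power_kernel.

(** * Test functions *)

Section test_functions.
Context {R : realType}.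
Local Notation mu := (@lebesgue_measure R).
Variables t0 t1 : R.
Implicit Types phi : R -> R.

Lemma test_function_derivable phi t : test_function t0 t1 phi -> derivable phi t 1.
Proof. by move=> [/(_ 0%N)]. Qed.

Lemma test_function_continuous phi : test_function t0 t1 phi -> continuous phi.
Proof.
move=> tf t; apply/differentiable_continuous/derivable1_diffP.
exact: test_function_derivable.
Qed.

Lemma test_function_measurable phi : test_function t0 t1 phi -> measurable_fun setT phi.
Proof. by move=> /test_function_continuous; exact: continuous_measurable_fun. Qed.

Lemma test_function_out phi t : test_function t0 t1 phi -> ~ (t0 < t < t1) -> phi t = 0.
Proof.
move=> [_ [a [b [t0a bt1 phi0]]]] nt; apply: phi0; apply/negP.
rewrite in_itv/= => /andP[ta tb].
by apply: nt; rewrite (lt_le_trans t0a ta) (le_lt_trans tb bt1).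
Qed.

Lemma test_function_bounded phi : test_function t0 t1 phi ->
  exists2 B : R, 0 <= B & forall t, `|phi t| <= B.
Proof.
move=> tf; have cphi := test_function_continuous tf.
have [_ [a [b [_ _ phi0]]]] := tf.
have [ab|ba] := leP a b; last first.
  exists 0 => // t; rewrite phi0 ?normr0// in_itv/= negb_and -!ltNge.
  by case: ltP => //= at_; rewrite (lt_le_trans ba at_).
have [c _ cmax] : exists2 c, c \in `[a, b] &
    forall t, t \in `[a, b] -> (fun t => `|phi t|) t <= (fun t => `|phi t|) c.
  apply: EVT_max => //; apply: continuous_subspaceT => t.
  apply: continuous_comp; [exact: cphi|exact: norm_continuous].
exists `|phi c| => // t.
have [tab|tab] := boolP (t \in `[a, b]); first exact: cmax.
by rewrite phi0// normr0.
Qed.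

Lemma test_function_derive1 phi : test_function t0 t1 phi ->
  test_function t0 t1 (derive1 phi).
Proof.
move=> [dphi [a [b [t0a bt1 phi0]]]]; split.
  by move=> n t; have := dphi n.+1 t; rewrite derive1Sn.
exists a, b; split=> // t tab.
have near0 : \forall s \near t, phi s = (cst 0 : R -> R) s.
  move: tab; rewrite in_itv/= negb_and -!ltNge => /orP[ta|bt].
    have : \forall s \near t, s < a by exact: lt_nbhsl.
    apply: filterS => s sa; rewrite phi0// in_itv/= negb_and -!ltNge.
    by rewrite sa.
  have : \forall s \near t, b < s by exact: lt_nbhsr.
  apply: filterS => s bs; rewrite phi0// in_itv/= negb_and -!ltNge.
  by rewrite bs orbT.
by rewrite derive1E (near_eq_derive _ near0) -derive1E derive1_cst.
Qed.

Lemma test_function0 : t0 < t1 -> test_function t0 t1 (cst 0).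
Proof.
move=> t01; have d0 n : derive1n n (cst 0 : R -> R) = cst 0.
  elim: n => [//|n IH]; rewrite derive1nS IH.
  by apply/funext => t; rewrite derive1_cst.
split; first by move=> n t; rewrite d0; exact: derivable_cst.
by exists ((t0 + t1) / 2), ((t0 + t1) / 2); split=> //; lra.
Qed.

Lemma test_function_derive1n n phi : test_function t0 t1 phi ->
  test_function t0 t1 (derive1n n phi).
Proof.
elim: n phi => [//|n IH] phi tf.
by rewrite derive1Sn; apply: IH; exact: test_function_derive1.
Qed.

Hypothesis t01 : t0 < t1.
Local Notation D := (`]t0, t1[%classic : set R).
Context {X : completeNormedModType R}.

Let mD : measurable D. Proof. exact: measurable_itv. Qed.

Let Doo : (mu D < +oo)%E.
Proof. by rewrite lebesgue_measure_itv/= lte_fin t01 -EFinB ltry. Qed.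

Lemma kop_power_bounded (c : R) : 0 < c ->
  bounded_op mu (kop (X := X) mu (power_kernel t0 t1 c)).
Proof.
by move=> c0; exact: (@kop_bounded _ _ R mu X D mD Doo _ (power_kernel_L1 t01 c0)).
Qed.

(** The fundamental theorem for phi(t) + B t on ]s, t1[, with phi(t1) = 0. The shift by [B] makes
    the multiplier nonnegative, as [kop_dual] requires. *)
Lemma integral_derive1_test phi (B : R) s : test_function t0 t1 phi ->
  (forall t, `|derive1 phi t| <= B) -> t0 < s -> s < t1 ->
  (\int[mu]_t ((derive1 phi t + B) * power_kernel t0 t1 1 (t, s))%:E =
   (- phi s + B * (t1 - s))%:E)%E.
Proof.
move=> tf dB t0s st1.
have tf' := test_function_derive1 tf.
transitivity (\int[mu]_(t in `]s, t1[) (derive1 phi t + B)%:E)%E.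
  rewrite [RHS]integral_mkcond; apply: eq_integral => t _.
  rewrite patchE /power_kernel/= t0s subrr powRr0.
  case: ifPn => [st|nst]; first by rewrite mem_set ?mulr1//= in_itv.
  by rewrite memNset ?mulr0//= in_itv/=; exact/negP.
have dF (x : R) : is_derive x 1 (fun t : R => phi t + B * t) (derive1 phi x + B).
  have h1 : is_derive x 1 phi (derive1 phi x).
    by rewrite derive1E; apply: derivableP; exact: test_function_derivable tf.
  have h2 := is_deriveZ B (is_derive_id x 1).
  have := is_deriveD h1 h2.
  by rewrite /GRing.scale/= mulr1.
have cF x : {for x, continuous (fun t : R => phi t + B * t)}.
  apply/differentiable_continuous/derivable1_diffP.
  exact: (@ex_derive _ _ _ _ _ _ _ (dF x)).
have cf : continuous (fun t => derive1 phi t + B).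
  by move=> t; apply: cvgD; [exact: test_function_continuous tf' _|exact: cvg_cst].
rewrite -(@integral_itv_bndoo _ s t1 _ true false); last first.
  apply/measurable_EFinP; apply: measurable_funTS.
  exact: continuous_measurable_fun.
rewrite (@continuous_FTC2 _ _ (fun t : R => phi t + B * t) _ _ st1).
- rewrite -EFinB (test_function_out (t := t1) tf) ?ltxx ?andbF//.
  by congr EFin; ring.
- exact: continuous_subspaceT.
- split.
  + by move=> x _; exact: (@ex_derive _ _ _ _ _ _ _ (dF x)).
  + by apply: cvg_at_right_filter; apply: cF.
  + by apply: cvg_at_left_filter; apply: cF.
- by move=> x _; rewrite derive1E; exact: (@derive_val _ _ _ _ _ _ _ (dF x)).
Qed.

(** The derivative of [phi] changes sign, so duality is applied to the nonnegative multipliers phi'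
    + B and B and the two results are subtracted. *)
Lemma bint_derive1_kop phi (f : R -> X) : test_function t0 t1 phi -> L1 mu f ->
  bint mu (fun t => derive1 phi t *: kop mu (power_kernel t0 t1 1) f t) =
  - bint mu (fun t => phi t *: f t).
Proof.
move=> tf Lf; have tf' := test_function_derive1 tf.
have [B B0 dB] := test_function_bounded tf'.
have [C C0 phiC] := test_function_bounded tf.
have hk : L1_kernel mu D (power_kernel t0 t1 1) by exact: power_kernel_L1.
(* [rho1] and [rho2] are what the transposed kernel makes of phi' + B and of B. *)
pose rho1 s := (- phi s + B * (t1 - s)) * \1_D s.
pose rho2 s := B * (t1 - s) * \1_D s.
(* One bound for all four multipliers: phi' + B is at most 2B, and [rho1] at most C + B (t1 -
   t0). *)
pose M := 2 * B + C + B * (t1 - t0).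
have BL : 0 <= B * (t1 - t0) by rewrite mulr_ge0// subr_ge0 ltW.
have Lk := bounded_op_L1 (kop_power_bounded ltr01) Lf.
have m1 : measurable_fun setT (fun s : R => B * (t1 - s)).
  by apply: measurable_funM => //; exact: measurable_funB.
have mphi := test_function_measurable tf.
have mphi' := test_function_measurable tf'.
have rho10 s : 0 <= rho1 s.
  rewrite /rho1 indicE; case: (boolP (s \in D)) => [|_]; last by rewrite mulr0.
  rewrite inE/= in_itv/= => /andP[t0s st1]; rewrite mulr1 -lee_fin.
  rewrite -(integral_derive1_test tf dB t0s st1); apply: integral_ge0 => t _.
  rewrite lee_fin mulr_ge0 ?power_kernel_ge0//.
  by have := dB t; rewrite ler_norml => /andP[+ _]; lra.
have DB s : s \in D -> 0 <= B * (t1 - s) <= B * (t1 - t0).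
  rewrite inE/= in_itv/= => /andP[t0s st1]; apply/andP; split.
    by rewrite mulr_ge0// subr_ge0 ltW.
  by rewrite ler_wpM2l// lerB// ltW.
have h1 : bint mu (fun t => (derive1 phi t + B) *: kop mu (power_kernel t0 t1 1) f t)
    = bint mu (fun s => rho1 s *: f s).
  apply: (@kop_dual _ _ R mu X D mD Doo _ _ _ M _ hk) => //.
  - by apply: measurable_funD.
  - apply: measurable_funM; last exact: measurable_indic.
    by apply: measurable_funD => //; exact: measurableT_comp.
  - move=> t; have := dB t; rewrite ler_norml /M => /andP[h1 h2].
    by apply/andP; split; lra.
  - move=> s; rewrite rho10/= /rho1 indicE; case: (boolP (s \in D)) => [/DB|_].
      rewrite mulr1 => /andP[_ h]; have := phiC s; rewrite ler_norml /M => /andP[h1 h2].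
      by lra.
    by rewrite mulr0 /M !addr_ge0// mulr_ge0.
  - move=> s; rewrite /rho1 indicE; case: (boolP (s \in D)) => [|sD].
      rewrite inE/= in_itv/= => /andP[t0s st1].
      by rewrite mulr1; exact: integral_derive1_test.
    rewrite mulr0; apply: integral0_eq => t _.
    have k0 : power_kernel t0 t1 1 (t, s) = 0.
      by apply: power_kernel_out => -[_ /mem_set]; exact/negP.
    by rewrite k0 mulr0.
have h2 : bint mu (fun t => B *: kop mu (power_kernel t0 t1 1) f t)
    = bint mu (fun s => rho2 s *: f s).
  apply: (@kop_dual _ _ R mu X D mD Doo _ (fun=> B) rho2 M f hk); last exact: Lf.
  - exact: measurable_cst.
  - by apply: measurable_funM => //; exact: measurable_indic.
  - by move=> t; rewrite B0 /M; lra.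
  - move=> s; rewrite /rho2 indicE; case: (boolP (s \in D)) => [/DB|_].
      by rewrite mulr1 => /andP[-> h]; rewrite /M/=; lra.
    by rewrite mulr0; apply/andP; split; [exact: lexx|rewrite /M; lra].
  - move=> s; rewrite /rho2 indicE; case: (boolP (s \in D)) => [|sD].
      rewrite inE/= in_itv/= => /andP[t0s st1]; rewrite mulr1.
      (* The constant multiplier [B] is the previous computation for the test function 0. *)
      have d0 t : derive1 (cst 0 : R -> R) t = 0 by rewrite derive1_cst.
      have dB0 t : `|derive1 (cst 0 : R -> R) t| <= B by rewrite d0 normr0.
      have := integral_derive1_test (test_function0 t01) dB0 t0s st1.
      rewrite oppr0 add0r => <-; apply: eq_integral => t _.
      by rewrite d0 add0r.
    rewrite mulr0; apply: integral0_eq => t _.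
    have k0 : power_kernel t0 t1 1 (t, s) = 0.
      by apply: power_kernel_out => -[_ /mem_set]; exact/negP.
    by rewrite k0 mulr0.
have LB := L1Z B Lk.
have Lphi' : L1 mu (fun t => derive1 phi t *: kop mu (power_kernel t0 t1 1) f t).
  exact: bounded_op_L1 (bounded_op_mul mu mphi' dB) Lk.
have Lphi : L1 mu (fun t => phi t *: f t).
  exact: bounded_op_L1 (bounded_op_mul mu mphi phiC) Lf.
have Lrho2 : L1 mu (fun t => rho2 t *: f t).
  apply: (bounded_op_L1 (bounded_op_mul (B := B * (t1 - t0)) mu _ _) Lf).
    by apply: measurable_funM => //; exact: measurable_indic.
  move=> s; rewrite /rho2 indicE; case: (boolP (s \in D)) => [/DB|_].
    by rewrite mulr1 => /andP[h0 h]; rewrite ger0_norm.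
  by rewrite mulr0 normr0.
apply/(@addIr _ (bint mu (fun s => rho2 s *: f s))).
rewrite -{1}h2 -(bintD Lphi' LB).
rewrite (_ : (fun t => _) = fun t =>
    (derive1 phi t + B) *: kop mu (power_kernel t0 t1 1) f t); last first.
  by apply/funext => t; rewrite scalerDl.
rewrite h1 addrC -(bintB Lrho2 Lphi); congr bint; apply/funext => s.
rewrite -scalerBl; congr (_ *: _); rewrite /rho1 /rho2 indicE.
case: (boolP (s \in D)) => [_|sD]; first by rewrite !mulr1 addrC.
have phis0 : phi s = 0.
  apply: (test_function_out tf) => st.
  by move/negP: sD; apply; apply/mem_set; rewrite /= in_itv.
by rewrite !mulr0 phis0 subr0.
Qed.

End test_functions.

(** * Smooth bumps built from exp(-1/x) *)

Section bump.
Context {R : realType}.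

(** The classical flat function exp(-1/x), with powers of 1/x in front so that the linear span of
    the family is stable under differentiation. *)
Definition exp_inv (k : nat) (x : R) : R :=
  if 0 < x then x^-1 ^+ k * expR (- x^-1) else 0.

(** Raise y/m <= exp(y/m) to the power m. *)
Lemma exprn_le_expR (m : nat) (y : R) : (0 < m)%N -> 0 <= y ->
  y ^+ m <= m%:R ^+ m * expR y.
Proof.
move=> m0 y0; have m0' : 0 < m%:R :> R by rewrite ltr0n.
have {2}-> : y = m%:R * (y / m%:R) by rewrite mulrCA divff ?mulr1// gt_eqF.
rewrite expRM_natl -exprMn lerXn2r ?nnegrE ?mulr_ge0 ?expR_ge0//.
rewrite mulrC -ler_pdivrMr//; apply: le_trans (expR_ge1Dx _).
by rewrite lerDr.
Qed.

(** Comparing exp(1/x) with the power k + 2 of 1/x, two more than the k to be absorbed, leaves x^2;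
    this quadratic bound gives the derivative 0 at the origin. *)
Lemma exp_inv_le (k : nat) (x : R) : `|exp_inv k x| <= k.+2%:R ^+ k.+2 * x ^+ 2.
Proof.
rewrite /exp_inv; case: ifPn => [x0|_]; last first.
  by rewrite normr0 mulr_ge0// ?sqr_ge0// exprn_ge0.
have xi0 : 0 <= x^-1 by rewrite invr_ge0 ltW.
rewrite ger0_norm ?mulr_ge0 ?exprn_ge0 ?expR_ge0//.
have := @exprn_le_expR k.+2 _ isT xi0; set M := k.+2%:R ^+ k.+2 => h.
rewrite expRN ler_pdivrMr ?expR_gt0// mulrAC -ler_pdivrMr ?exprn_gt0//.
by rewrite -exprVn -exprD addn2.
Qed.

Lemma is_derive_exp_inv (k : nat) (x : R) :
  is_derive x 1 (exp_inv k) (exp_inv k.+2 x - k%:R * exp_inv k.+1 x).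
Proof.
have [x0|x0|<-] := ltgtP 0 x.
- have xn : x != 0 by rewrite gt_eqF.
  have h1 : is_derive x 1 (fun y : R => y^-1) (- x ^- 2).
    by have := is_deriveV xn (is_derive_id x (1 : R)); rewrite /GRing.scale/= mulr1.
  have h2 : is_derive x 1 (fun y : R => y^-1 ^+ k) ((k%:R * x^-1 ^+ k.-1) * - x ^- 2).
    have := is_deriveX k h1; congr is_derive.
    by apply/funext => y; rewrite exprfctE.
  have h3 : is_derive x 1 (fun y : R => expR (- y^-1)) (expR (- x^-1) * x ^- 2).
    have h : is_derive x 1 (fun y : R => - y^-1) (x ^- 2).
      by have := is_deriveN h1; rewrite opprK.
    exact: (@is_derive1_comp _ expR (fun y : R => - y^-1) x _ _
      (is_derive_expR (- x^-1)) h).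
  have h4 : is_derive x 1 (fun y : R => y^-1 ^+ k * expR (- y^-1)) _ :=
    is_deriveM h2 h3.
  have near_x : \near x, (fun y : R => y^-1 ^+ k * expR (- y^-1)) x = exp_inv k x.
    have : \forall y \near x, 0 < y by exact: lt_nbhsr.
    by apply: filterS => y y0; rewrite /exp_inv y0.
  apply: DeriveDef.
    apply: near_eq_derivable near_x _.
    exact: (@ex_derive _ _ _ _ _ _ _ h4).
  rewrite -(near_eq_derive _ near_x) (@derive_val _ _ _ _ _ _ _ h4).
  rewrite /exp_inv x0 /GRing.scale/= -exprVn.
  by case: k {h2 h4 near_x} => [|k]; rewrite ?expr0 /= ?exprS; ring.
- have near_x : \near x, (cst 0 : R -> R) x = exp_inv k x.
    have : \forall y \near x, y < 0 by exact: lt_nbhsl.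
    by apply: filterS => y y0; rewrite /exp_inv ltNge ltW.
  apply: DeriveDef.
    by apply: near_eq_derivable near_x _; exact: derivable_cst.
  rewrite -(near_eq_derive _ near_x) derive_cst /exp_inv.
  by rewrite ltNge ltW//= mulr0 subrr.
- rewrite /exp_inv ltxx mulr0 subrr -/(exp_inv k).
  have lim0 : h^-1 *: ((exp_inv k \o shift 0) (h *: 1) - exp_inv k 0) @[h --> 0^'] --> (0 : R).
    have [M kM] : exists M : R, forall h, `|exp_inv k h| <= M * h ^+ 2.
      by eexists => h; exact: exp_inv_le.
    apply: (@cvg_to_0_linear _ _ M 1 ltr01) => h /andP[h0 _].
    rewrite /= /GRing.scale/= mulr1 addr0 {2}/exp_inv ltxx subr0.
    rewrite normrM normfV mulrC ler_pdivrMr//.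
    apply: le_trans (kM h) _.
    by rewrite -mulrA -normrM -expr2 ger0_norm ?sqr_ge0.
  apply: DeriveDef; first by apply/cvg_ex; exists 0.
  exact: cvg_lim lim0.
Qed.

(** A class containing the bumps and closed under differentiation: smoothness of all orders follows
    by induction, with no formula for higher derivatives. *)
Inductive smooth_class : (R -> R) -> Prop :=
| smooth_exp_inv k a b : smooth_class (fun x => exp_inv k (a * x + b))
| smoothD f g : smooth_class f -> smooth_class g -> smooth_class (fun x => f x + g x)
| smoothM f g : smooth_class f -> smooth_class g -> smooth_class (fun x => f x * g x)
| smoothZ c f : smooth_class f -> smooth_class (fun x => c * f x).

Lemma smooth_class_derive f : smooth_class f ->
  exists2 g, smooth_class g & forall x : R, is_derive x 1 f (g x).
Proof.
elim=> {f} [k a b|f g sf [f' sf' df] sg [g' sg' dg]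
           |f g sf [f' sf' df] sg [g' sg' dg]|c f sf [f' sf' df]].
- exists (fun x => a * (exp_inv k.+2 (a * x + b) + (- k%:R) * exp_inv k.+1 (a * x + b))).
    apply: smoothZ; apply: smoothD; first exact: smooth_exp_inv.
    by apply: smoothZ; exact: smooth_exp_inv.
  move=> x; have h1 : is_derive x 1 (fun x : R => a * x + b) a.
    have := is_deriveD (is_deriveZ a (is_derive_id x 1)) (is_derive_cst b x 1).
    by rewrite /GRing.scale/= mulr1 addr0.
  have := @is_derive1_comp _ (exp_inv k) (fun x : R => a * x + b) x _ _
    (is_derive_exp_inv k (a * x + b)) h1.
  by rewrite mulNr [_ * a]mulrC.
- exists (fun x => f' x + g' x); first exact: smoothD.
  by move=> x; exact: is_deriveD.
- exists (fun x => f x * g' x + g x * f' x).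
    by apply: smoothD; exact: smoothM.
  by move=> x; exact: is_deriveM.
- exists (fun x => c * f' x); first exact: smoothZ.
  by move=> x; have := is_deriveZ c (df x).
Qed.

Lemma smooth_class_derive1n f n : smooth_class f -> smooth_class (derive1n n f).
Proof.
elim: n f => [//|n IH] f sf; rewrite derive1Sn; apply: IH.
have [g sg dg] := smooth_class_derive sf.
rewrite (_ : derive1 f = g)//; apply/funext => x.
by rewrite derive1E; exact: (@derive_val _ _ _ _ _ _ _ (dg x)).
Qed.

Lemma smooth_class_derivable f n x : smooth_class f -> derivable (derive1n n f) x 1.
Proof.
move=> /(smooth_class_derive1n n)/smooth_class_derive[g _ dg].
exact: (@ex_derive _ _ _ _ _ _ _ (dg x)).
Qed.

(** The dilation by [m.+1] sends both exponents to 0 inside ]c, d[, hence the value to 1, while the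
    support stays in [c, d]. *)
Definition bump (c d : R) (m : nat) (x : R) : R :=
  exp_inv 0 (m.+1%:R * x + - (m.+1%:R * c)) *
  exp_inv 0 (- m.+1%:R * x + m.+1%:R * d).

Lemma bumpE c d m x : bump c d m x =
  if c < x < d then expR (- (m.+1%:R * (x - c))^-1) * expR (- (m.+1%:R * (d - x))^-1)
  else 0.
Proof.
have e1 : m.+1%:R * x + - (m.+1%:R * c) = m.+1%:R * (x - c) by ring.
have e2 : - m.+1%:R * x + m.+1%:R * d = m.+1%:R * (d - x) by ring.
rewrite /bump e1 e2 /exp_inv !expr0 !mul1r !pmulr_rgt0 ?ltr0n// !subr_gt0.
by case: (c < x); case: (x < d); rewrite ?mul0r ?mulr0.
Qed.

Lemma bump_test_function t0 t1 c d m : t0 < c -> d < t1 ->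
  test_function t0 t1 (bump c d m).
Proof.
move=> t0c dt1; split.
  move=> n t; apply: smooth_class_derivable.
  by apply: smoothM; exact: smooth_exp_inv.
exists c, d; split => // t tcd; rewrite bumpE; case: ifP => // /andP[ct td].
by move: tcd; rewrite in_itv/= !ltW.
Qed.

Lemma bump_ge0 c d m x : 0 <= bump c d m x.
Proof. by rewrite bumpE; case: ifP => // _; rewrite mulr_ge0 ?expR_ge0. Qed.

Lemma bump_le1 c d m x : bump c d m x <= 1.
Proof.
rewrite bumpE; case: ifP => [/andP[cx xd]|//].
by rewrite mulr_ile1 ?expR_ge0// -expR0 ler_expR oppr_le0 invr_ge0 mulr_ge0// subr_ge0 ltW.
Qed.

Lemma bump_cvg c d x : bump c d m x @[m --> \oo] --> (\1_`]c, d[%classic x : R).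
Proof.
rewrite indicE; have [h|h] := boolP (c < x < d); last first.
  rewrite memNset; last by rewrite /= in_itv/=; exact/negP.
  by under eq_fun do rewrite bumpE (negbTE h); exact: cvg_cst.
rewrite mem_set; last by rewrite /= in_itv.
have /andP[cx xd] := h.
have lim (y : R) : 0 < y -> expR (- (m.+1%:R * y)^-1) @[m --> \oo] --> (1 : R).
  move=> y0; rewrite -[X in _ --> X]expR0.
  apply: continuous_cvg; first exact: continuous_expR.
  rewrite -[X in _ --> X]oppr0; apply: cvgN.
  rewrite (_ : (fun m : nat => _) = (fun m : nat => y^-1 * m.+1%:R^-1)); last first.
    by apply/funext => m; rewrite invfM mulrC.
  rewrite -[X in _ --> X](mulr0 y^-1); apply: cvgMl_tmp; exact: cvg_harmonic.
have : expR (- (m.+1%:R * (x - c))^-1) * expR (- (m.+1%:R * (d - x))^-1)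
    @[m --> \oo] --> (1 * 1 : R).
  by apply: cvgM; apply: lim; rewrite subr_gt0.
by rewrite mulr1; under [X in _ -> X @ _ --> _]eq_fun do rewrite bumpE h.
Qed.

End bump.

(** * Functions with vanishing integrals *)

Section vanishing.
Context d (T : measurableType d) (R : realType).
Variable mu : {measure set T -> \bar R}.
Context {X : completeNormedModType R}.
Local Notation N f := (\int[mu]_t (`|f t|)%:E)%E.
Implicit Types g : T -> X.

Lemma L1_mul (k : T -> R) (B : R) g : measurable_fun setT k ->
  (forall t, `|k t| <= B) -> L1 mu g -> L1 mu (fun t => k t *: g t).
Proof. by move=> mk kB; exact: bounded_op_L1 (bounded_op_mul mu mk kB). Qed.

Lemma L1_indic (A : set T) g : measurable A -> L1 mu g ->
  L1 mu (fun t => (\1_A t : R) *: g t).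
Proof.
move=> mA; apply: (@L1_mul _ 1); first exact: measurable_indic.
by move=> t; rewrite indicE; case: (t \in A); rewrite ?normr1 ?normr0.
Qed.

(** Dominated convergence for multipliers, with majorant 2e for a version [e] of the norm of [g]. It
    serves both for bumps tending to an indicator and for increasing unions of sets. *)
Lemma bint_dct0 (phi : nat -> T -> R) (psi : T -> R) g :
    (forall n, measurable_fun setT (phi n)) -> measurable_fun setT psi ->
    (forall n t, 0 <= phi n t <= 1) -> (forall t, 0 <= psi t <= 1) ->
    (forall t, phi n t @[n --> \oo] --> psi t) -> L1 mu g ->
    (forall n, bint mu (fun t => phi n t *: g t) = 0) ->
  bint mu (fun t => psi t *: g t) = 0.
Proof.
move=> mphi mpsi phi01 psi01 phipsi Lg phi0.
have phin n t : `|phi n t| <= 1.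
  by have /andP[h0 h1] := phi01 n t; rewrite ger0_norm.
have psin t : `|psi t| <= 1 by have /andP[h0 h1] := psi01 t; rewrite ger0_norm.
have [e ge] := smeas_version Lg.1; have [me e0 _] := ge.
have eoo : (\int[mu]_t (e t)%:E < +oo)%E by rewrite -(version_norm ge); case: Lg.
have [|||||_ eN _] := @dominated_convergence _ _ _ mu _ measurableT
  (fun n t => ((phi n t - psi t) * e t)%:E) (cst 0%E) (fun t => (2 * e t)%:E).
- move=> n; apply/measurable_EFinP; apply: measurable_funM => //.
  exact: measurable_funB.
- exact: measurable_cst.
- apply: aeW => t _; apply: cvg_EFin; first exact: nearW.
  have h : (phi n t - psi t) * e t @[n --> \oo] --> (psi t - psi t) * e t.
    by apply: cvgMr_tmp; apply: cvgB => //; exact: cvg_cst.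
  by rewrite subrr mul0r in h.
- apply/integrableP; split; first by apply/measurable_EFinP; exact: measurable_funM.
  under eq_integral => t _ do rewrite abse_EFin (ger0_norm (mulr_ge0 _ (e0 t)))// EFinM.
  rewrite ge0_integralZl//; last 2 first.
  - exact/measurable_EFinP.
  - by move=> t _; rewrite lee_fin.
  by rewrite lte_mul_pinfty.
- apply: aeW => t n _; rewrite abse_EFin lee_fin normrM (ger0_norm (e0 t)).
  rewrite ler_wpM2r// (le_trans (ler_normB _ _))//.
  by rewrite (_ : 2 = 1 + 1)// lerD.
have bound n : ((`|bint mu (fun t => psi t *: g t)|)%:E <=
    \int[mu]_t `|((phi n t - psi t) * e t)%:E - cst 0 t|)%E.
  rewrite -normrN -[X in `|X|]add0r -(phi0 n) -bintB; last 2 first.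
  - exact: (L1_mul (mphi n) (phin n)).
  - exact: (L1_mul mpsi psin).
  apply: le_trans (bint_norm _) _.
    by apply: L1B; [exact: (L1_mul (mphi n) (phin n))|exact: (L1_mul mpsi psin)].
  apply: le_norm => [t|]; first exact: abse_ge0.
  have [_ _ gE] := ge; apply: filterS gE => t gE.
  by rewrite /cst sube0 abse_EFin lee_fin -scalerBl normrZ normrM (ger0_norm (e0 t)) gE.
apply/eqP; rewrite -normr_le0 -lee_fin.
rewrite [leRHS](_ : _ = limn (fun n =>
    \int[mu]_t `|((phi n t - psi t) * e t)%:E - cst 0 t|)%E); last first.
  by apply/esym; exact: cvg_lim eN.
apply: lime_ge; first by apply/cvg_ex; eexists; exact: eN.
by apply: nearW => n; exact: bound.
Qed.

(* On each fibre of a simple approximation [s] of [g], the integral of [s] is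
   that of [s - g], whose norm is small. *)
Lemma bint_indic0_ae g : L1 mu g ->
    (forall A, measurable A -> bint mu (fun t => (\1_A t : R) *: g t) = 0) ->
  \forall t \ae mu, g t = 0.
Proof.
move=> Lg g0; apply: norm_eq0; first by case: Lg.
apply/eqP; rewrite eq_le norm_ge0 andbT; apply/lee_addgt0Pr => e e0; rewrite add0e.
have e20 : 0 < e / 2 by rewrite divr_gt0.
have [s ss gs] := L1_dense Lg e20.
have ms := simple_smeas ss.
have [r [ur sr]] := finmeas_enum ss.1.
have [v gsv] := smeas_version (smeasB Lg.1 ms).
move: gs; rewrite (version_norm gsv) => gs; have [mv v0 gvE] := gsv.
have mA x : measurable (s @^-1` [set x]) by apply: finmeas_preimage; case: ss.
have Ns : (N s <= \int[mu]_t (v t)%:E)%E.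
  rewrite (integral_norm_simple mu ss.1 ur sr).
  have -> : (\int[mu]_t (v t)%:E =
      \sum_(x <- r) \int[mu]_t (\1_(s @^-1` [set x]) t * v t)%:E)%E.
    have mAv x : measurable_fun setT (fun t => (\1_(s @^-1` [set x]) t * v t)%:E).
      by apply/measurable_EFinP; exact: measurable_funM.
    have Av0 x t : setT t -> (0 <= (\1_(s @^-1` [set x]) t * v t)%:E)%E.
      by move=> _; rewrite lee_fin mulr_ge0.
    rewrite -(ge0_integral_sum mu measurableT mAv Av0).
    apply: eq_integral => t _; rewrite sumEFin (bigD1_seq (s t))//= big1 ?addr0.
      by rewrite indicE mem_set// mul1r.
    by move=> x xs; rewrite indicE memNset ?mul0r// => /= /esym/eqP; exact/negP.
  apply: lee_sum => x _.
  have [->|x0] := eqVneq x 0.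
    by rewrite normr0 mul0e integral_ge0// => t _; rewrite lee_fin mulr_ge0.
  have moo := simple_fiber ss x0.
  set A := s @^-1` [set x] in moo *.
  have sA t : (\1_A t : R) *: s t = (\1_A t : R) *: x.
    rewrite indicE; case: (boolP (t \in A)) => [/set_mem <-//|_].
    by rewrite !scale0r.
  have bA : bint mu (fun t => (\1_A t : R) *: s t) = fine (mu A) *: x.
    under eq_fun do rewrite sA.
    rewrite (isint_bint (simple_isint (simple_indicZ x (mA x) moo))).
    rewrite (sint_scale x (simple_indic (mA x) moo))// integral_indic ?setIT//.
  have LAg := L1_indic (mA x : measurable A) Lg.
  have LAs := L1_indic (mA x : measurable A) (simple_L1 ss).
  have : ((`|fine (mu A) *: x|)%:E <=
      \int[mu]_t (\1_A t * v t)%:E)%E.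
    rewrite -bA -normrN -[X in `|X|]add0r -(g0 A (mA x)) -(bintB LAg LAs).
    apply: le_trans (bint_norm (L1B LAg LAs)) _.
    apply: le_norm => [t|]; first by rewrite lee_fin mulr_ge0.
    apply: filterS gvE => t gvE; rewrite lee_fin -scalerBr normrZ gvE.
    by rewrite ger0_norm.
  apply: le_trans; rewrite normrZ EFinM ger0_norm ?fine_ge0//.
  by rewrite fineK ?ge0_fin_numE// muleC.
have := normD (smeasB Lg.1 ms) ms; under eq_integral do rewrite subrK.
move=> /le_trans; apply; rewrite (version_norm gsv) [e]splitr EFinD.
apply: leeD; first exact: ltW.
by apply: le_trans Ns _; exact: ltW.
Qed.

End vanishing.

(** * From open intervals to all measurable sets *)

Section lebesgue_vanishing.
Context {R : realType} {X : completeNormedModType R}.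
Local Notation mu := (@lebesgue_measure R).
Implicit Types g : R -> X.

Lemma bint_itv0_ae g : L1 mu g ->
    (forall c d : R, bint mu (fun t => (\1_(`]c, d[%classic) t : R) *: g t) = 0) ->
  \forall t \ae mu, g t = 0.
Proof.
move=> Lg g0; apply: bint_indic0_ae => // A mA.
have ind01 (B : set R) t : 0 <= (\1_B t : R) <= 1.
  by rewrite indicE; case: (t \in B); rewrite ?ler01 ?lexx.
pose P (B : set R) := bint mu (fun t => (\1_B t : R) *: g t) = 0.
have PU (F : (set R)^nat) : (forall n, measurable (F n)) -> nondecreasing_seq F ->
    (forall n, P (F n)) -> P (\bigcup_n F n).
  move=> mF nF PF.
  rewrite /P; apply: (@bint_dct0 _ _ _ mu X (fun n => \1_(F n)) (\1_(\bigcup_n F n))) => //.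
  - by move=> n; apply: measurable_indic; exact: mF.
  - by apply: measurable_indic; apply: bigcupT_measurable; exact: mF.
  - move=> t; have [[n _ Fnt]|nF'] := pselect ((\bigcup_n F n) t).
      rewrite [X in _ --> X]indicE mem_set; last by exists n.
      apply: cvg_near_cst; near=> m; rewrite indicE mem_set//.
      have nm : (n <= m)%N by near: m; exact: nbhs_infty_ge.
      by move: t Fnt; apply/subsetPset; exact: nF.
    rewrite [X in _ --> X]indicE memNset//; apply: cvg_near_cst; near=> m.
    by rewrite indicE memNset// => Fmt; apply: nF'; exists m.
have LI (B : set R) : measurable B -> L1 mu (fun t => (\1_B t : R) *: g t).
  by move=> mB; exact: (@L1_indic _ _ _ mu X B g mB Lg).
have P0 : P set0.
  rewrite /P -[RHS](g0 0 0); congr bint; apply/funext => t.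
  rewrite !indicE in_set0 memNset// => /=.
  by rewrite in_itv/= => /andP[/lt_trans/[apply]]; rewrite ltxx.
have PT : P setT.
  (* The whole line is an increasing union of open intervals; complements are then handled by
     subtraction. *)
  rewrite (_ : setT = \bigcup_n (`]- n%:R, n%:R[%classic : set R)).
    apply: PU => [n|n m nm|n]; [exact: measurable_itv| |exact: g0].
    apply/subsetPset => x; rewrite /= !in_itv/= => /andP[h1 h2].
    have nm' : n%:R <= m%:R :> R by rewrite ler_nat.
    by apply/andP; split; [apply: le_lt_trans h1; rewrite lerN2|exact: lt_le_trans nm'].
  apply/seteqP; split => // x _; exists (Num.truncn `|x|).+1 => //=.
  by rewrite in_itv/= -ltr_norml truncnS_gt.
have PC B : measurable B -> P B -> P (~` B).
  move=> mB PB; rewrite /P.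
  have := bintB (LI _ measurableT) (LI _ mB).
  rewrite PB PT subrr => <-; congr bint; apply/funext => t.
  rewrite -scalerBl; congr (_ *: _); rewrite !indicE in_setT in_setC.
  by case: (t \in B); rewrite ?subrr ?subr0.
have PD B C : measurable B -> measurable C -> B `&` C = set0 -> P B -> P C ->
    P (B `|` C).
  move=> mB mC BC PB PC'; rewrite /P.
  have := bintD (LI _ mB) (LI _ mC).
  rewrite PB PC' addr0 => <-; congr bint; apply/funext => t.
  rewrite -scalerDl; congr (_ *: _); rewrite !indicE in_setU.
  have /seteqP[/(_ t) + _] := BC.
  case: (boolP (t \in B)) => [/set_mem tB|_]; case: (boolP (t \in C)) => [/set_mem tC|_] //.
  - by move=> /(_ (conj tB tC)).
  - by rewrite addr0.
  - by rewrite add0r.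
  - by rewrite addr0.
apply: (@dynkin_induction _ (measurableTypeR R) (@ocitv R) P).
- by [].
- exact: ocitvI.
- exact: PT.
(* The generating pi-system consists of the intervals ]c, d], which differ from the open ones by the
   null set {d}. *)
- move=> _ [[c d] _ <-] /=; rewrite /P -(g0 c d); apply: ae_eq_bint.
  exists [set d]; split => //; first exact: lebesgue_measure_set1.
  move=> t /= h; apply: contrapT => td; apply: h; congr (_ *: _).
  rewrite !indicE (_ : (t \in `]c, d]%classic) = (t \in `]c, d[%classic))//.
  apply/idP/idP; rewrite !inE/= !in_itv/=.
    move=> /andP[-> /=]; rewrite le_eqVlt => /orP[/eqP//|->//].
  by move=> /andP[-> /ltW].
- exact: PC.
(* A disjoint union is the increasing union of its finite partial unions, which are treated by
   additivity. *)
- move=> F mF tF PF; rewrite -bigcup_bigsetU_bigcup; apply: PU.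
  + by move=> n; apply: bigsetU_measurable => i _; exact: mF.
  + by move=> n m nm; apply/subsetPset; apply: subset_bigsetU; rewrite ltnS.
  + elim=> [|n IH]; first by rewrite big_ord_recl big_ord0 setU0; exact: PF.
    rewrite big_ord_recr; apply: PD; [|exact: mF| |exact: IH|exact: PF].
      by apply: bigsetU_measurable => i _; exact: mF.
    apply/seteqP; split => // t.
    rewrite -bigcup_mkord => -[[i /= iltn Fit] Fnt].
    have E : i = n.+1 by apply: tF => //; exists t.
    by move: iltn; rewrite E ltnn.
- exact: mA.
Unshelve. all: by end_near.
Qed.

End lebesgue_vanishing.

(** * Weak derivatives *)

Lemma cut_in d (T : measurableType d) (R : realType) (X : completeNormedModType R)
  (D : set T) (f : T -> X) t : D t -> cut D f t = f t.
Proof. by move=> Dt; rewrite /cut mem_set. Qed.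

Lemma cut_out d (T : measurableType d) (R : realType) (X : completeNormedModType R)
  (D : set T) (f : T -> X) t : ~ D t -> cut D f t = 0.
Proof. by move=> Dt; rewrite /cut memNset. Qed.

Section weak_derivative_uniqueness.
Context {R : realType} {X : completeNormedModType R} (t0 t1 : R).
Local Notation mu := (@lebesgue_measure R).
Local Notation D := (`]t0, t1[%classic : set R).
Implicit Types u v w : R -> X.

Lemma L1_test_mul phi v : test_function t0 t1 phi ->
  Defs.locally_integrable t0 t1 v -> L1 mu (fun t => phi t *: v t).
Proof.
move=> tphi lv; have [_ [a [b [t0a bt1 phi0]]]] := tphi.
have [B _ phiB] := test_function_bounded tphi.
have -> : (fun t => phi t *: v t) = (fun t => phi t *: cut (`[a, b]%classic : set R) v t).
  apply/funext => t; have [tab|tab] := pselect (`[a, b]%classic t); first by rewrite cut_in.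
  by rewrite phi0 ?scale0r//; exact/negP.
apply: (@L1_mul _ _ _ mu X phi B) => //; first exact: test_function_measurable tphi.
exact: ((@bochner_integrableE _ _ _ mu X _ (measurable_itv `[a, b]) v).1 (lv a b t0a bt1)).
Qed.

Lemma bochner_integral_test phi v : test_function t0 t1 phi ->
  bochner_integral mu D (fun t => phi t *: v t) = bint mu (fun t => phi t *: v t).
Proof.
move=> tphi; rewrite (@bochner_integralE _ _ _ mu X _ (measurable_itv `]t0, t1[)).
congr (bint mu _); apply/funext => t; have [tD|tD] := pselect (D t); first by rewrite cut_in.
by rewrite cut_out// (test_function_out tphi) ?scale0r.
Qed.

(** As [v - w] is only locally integrable, the criterion for L^1 is applied on each ]a, b[ with t0 <
    a and b < t1; countably many of these exhaust the interval. *)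
Lemma is_weak_derivative_unique k u v w : is_weak_derivative t0 t1 k u v ->
  is_weak_derivative t0 t1 k u w -> \forall t \ae mu, D t -> v t = w t.
Proof.
move=> [_ lv uv] [_ lw uw]; pose z t := v t - w t.
have Lz a b : t0 < a -> b < t1 -> L1 mu (cut (`[a, b]%classic : set R) z).
  move=> t0a bt1; have E := @bochner_integrableE _ _ _ mu X _ (measurable_itv `[a, b]).
  have := L1B ((E _).1 (lv a b t0a bt1)) ((E _).1 (lw a b t0a bt1)).
  by congr (L1 mu _); apply/funext => t; rewrite cutB.
have test0 phi : test_function t0 t1 phi -> bint mu (fun t => phi t *: z t) = 0.
  move=> tphi; have := uv _ tphi; rewrite (uw _ tphi).
  rewrite (bochner_integral_test v tphi) (bochner_integral_test w tphi).
  have s0 : (- 1) ^+ k != 0 :> R by rewrite signr_eq0.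
  move=> /(scalerI s0) E.
  rewrite (_ : (fun t => _) = fun t => phi t *: v t - phi t *: w t).
    rewrite (bintB (L1_test_mul tphi lv) (L1_test_mul tphi lw)).
    by rewrite E subrr.
  by apply/funext => t; rewrite scalerBr.
have loc a b : t0 < a -> b < t1 -> \forall t \ae mu, cut (`]a, b[%classic : set R) z t = 0.
  move=> t0a bt1.
  have Lc : L1 mu (cut (`]a, b[%classic : set R) z).
    have -> : cut (`]a, b[%classic : set R) z = fun t =>
        (\1_(`]a, b[%classic : set R) t : R) *: cut (`[a, b]%classic : set R) z t.
      apply/funext => t; rewrite -cutE; have [tab|tab] := pselect (`]a, b[%classic t).
        rewrite !cut_in//; move: tab; rewrite /= !in_itv/= => /andP[at_ tb].
        by rewrite !ltW.
      by rewrite !(cut_out _ tab).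
    by apply: (@L1_indic _ _ _ mu X) => //; exact: Lz.
  apply: (@bint_itv0_ae R X) => // c d.
  pose c' := Num.max a c; pose d' := Num.min b d.
  have -> : (fun t => (\1_(`]c, d[%classic) t : R) *: cut (`]a, b[%classic : set R) z t) =
     (fun t => (\1_(`]c', d'[%classic : set R) t : R) *: cut (`]a, b[%classic : set R) z t).
    apply/funext => t; rewrite !cutE !scalerA !indicE; congr (_ *: _).
    rewrite !mem_setE !in_itv/= /c' /d' gt_max lt_min.
    by do 4 case: (_ < _); rewrite ?mulr0 ?mul0r.
  apply: (@bint_dct0 _ _ _ mu X (bump c' d')) => //.
  - move=> n; apply: (@test_function_measurable _ t0 t1); apply: bump_test_function.
      by rewrite lt_max t0a.
    by rewrite gt_min bt1.
  - move=> n t; rewrite bump_ge0 bump_le1//.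
  - by move=> t; rewrite indicE; case: (_ \in _); rewrite ?lexx ?ler01.
  - by move=> t; exact: bump_cvg.
  - move=> n; rewrite -[RHS](test0 (bump c' d' n)); last first.
      apply: bump_test_function; first by rewrite lt_max t0a.
      by rewrite gt_min bt1.
    congr (bint mu _); apply/funext => t; rewrite bumpE; case: ifPn; last by rewrite !scale0r.
    rewrite /c' /d' gt_max lt_min => /andP[/andP[at_ _] /andP[tb _]].
    by rewrite cut_in//= in_itv/= at_ tb.
have /ae_foralln : forall n : nat, \forall t \ae mu,
    cut (`]t0 + n.+1%:R^-1, t1 - n.+1%:R^-1[%classic : set R) z t = 0.
  move=> n; apply: loc; first by rewrite ltrDl invr_gt0 ltr0n.
  by rewrite ltrBlDr ltrDl invr_gt0 ltr0n.
apply: filterS => t zt; rewrite /= in_itv/= => /andP[t0t tt1].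
have m0 : 0 < Num.min (t - t0) (t1 - t) by rewrite lt_min !subr_gt0 t0t.
pose n := Num.truncn (Num.min (t - t0) (t1 - t))^-1.
have nlt : n.+1%:R^-1 < Num.min (t - t0) (t1 - t).
  by rewrite invf_plt ?posrE ?ltr0n// truncnS_gt.
have := zt n; rewrite cut_in.
  by move=> /eqP; rewrite subr_eq0 => /eqP.
move: nlt; rewrite lt_min/= in_itv/= => /andP[n1 n2].
by rewrite -ltrBrDl n1 ltrBrDr -ltrBrDl n2.
Qed.

End weak_derivative_uniqueness.

(** * Riemann-Liouville integrals *)

Lemma bint0 d (T : measurableType d) (R : realType)
  (mu : {measure set T -> \bar R}) (X : completeNormedModType R) :
  bint mu (fun=> 0 : X) = 0.
Proof.
have [L0|nL0] := pselect (L1 mu (fun=> 0 : X)); last exact: bint_out.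
rewrite -[RHS](scale0r (bint mu (fun=> 0 : X))) -(bintZ 0 L0).
by congr (bint mu _); apply/funext => t; rewrite scale0r.
Qed.

Lemma ae_sym d (T : measurableType d) (R : realType)
    (mu : {measure set T -> \bar R}) Y (f g : T -> Y) :
  (\forall t \ae mu, f t = g t) -> \forall t \ae mu, g t = f t.
Proof. by apply: filterS => t ->. Qed.

Lemma ae_eq_bint_scale d (T : measurableType d) (R : realType)
    (mu : {measure set T -> \bar R}) (X : completeNormedModType R)
    (k : T -> R) (f g : T -> X) : (\forall t \ae mu, f t = g t) ->
  bint mu (fun t => k t *: f t) = bint mu (fun t => k t *: g t).
Proof. by move=> fg; apply: ae_eq_bint; apply: filterS fg => t ->. Qed.

Lemma cutZ d (T : measurableType d) (R : realType) (X : completeNormedModType R)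
  (D : set T) (k : T -> R) (f : T -> X) :
  cut D (fun t => k t *: f t) = fun t => k t *: cut D f t.
Proof. by apply/funext => t; rewrite !cutE !scalerA mulrC. Qed.

Lemma ae_eq_cut d (T : measurableType d) (R : realType)
    (mu : {measure set T -> \bar R}) (X : completeNormedModType R)
    (D : set T) (f g : T -> X) : (\forall t \ae mu, D t -> f t = g t) ->
  \forall t \ae mu, cut D f t = cut D g t.
Proof.
apply: filterS => t fg; have [Dt|Dt] := pselect (D t); last by rewrite !cut_out.
by rewrite !cut_in// fg.
Qed.

(** * Iterates of bounded operators *)

Section bounded_operators_iter.
Context d (T : measurableType d) (R : realType).
Variable mu : {measure set T -> \bar R}.
Context {X : completeNormedModType R}.
Implicit Types (A : (T -> X) -> T -> X) (f : T -> X).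

Lemma bounded_op_scale A (a : R) f : bounded_op mu A -> L1 mu f ->
  \forall t \ae mu, A (fun s => a *: f s) t = a *: A f t.
Proof.
(* Linearity is available for a f + g; writing a f as (a - 1) f + f avoids a detour through A 0. *)
move=> [M [_ _ AL]] Lf; have := AL (a - 1) f f Lf Lf.
rewrite (_ : (fun s => (a - 1) *: f s + f s) = fun s => a *: f s); last first.
  by apply/funext => s; rewrite scalerBl scale1r subrK.
by apply: filterS => t ->; rewrite scalerBl scale1r subrK.
Qed.

Lemma bounded_op_iter A j : bounded_op mu A -> bounded_op mu (iter j A).
Proof.
move=> bA; elim: j => [|j IH]; first exact: bounded_op_id.
exact: (bounded_op_comp bA IH).
Qed.

Lemma bounded_op_semigroup_iter (G : R -> (T -> X) -> T -> X) j (c : R) :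
    (forall b, 0 < b -> bounded_op mu (G b)) ->
    (forall b b', 0 < b -> 0 < b' -> exists2 K : R, 0 < K &
      forall f, L1 mu f -> \forall t \ae mu, G b (G b' f) t = K *: G (b + b') f t) ->
    0 < c ->
  exists2 K : R, 0 < K &
    forall f, L1 mu f -> \forall t \ae mu, iter j (G 1) (G c f) t = K *: G (c + j%:R) f t.
Proof.
move=> bG GG c0; elim: j => [|j [K K0 IH]].
  by exists 1 => // f Lf; apply: aeW => t; rewrite addr0 scale1r.
have cj0 : 0 < c + j%:R by rewrite ltr_wpDr.
have [K' K'0 H] := GG _ _ ltr01 cj0.
exists (K * K'); first exact: mulr_gt0.
move=> f Lf; have Lj := bounded_op_L1 (bG _ cj0) Lf.
have Lij := bounded_op_L1 (bounded_op_iter j (bG _ ltr01)) (bounded_op_L1 (bG _ c0) Lf).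
have E1 := bounded_op_ae (bG _ ltr01) Lij (L1Z K Lj) (IH f Lf).
have E2 := bounded_op_scale K (bG _ ltr01) Lj.
apply: filterS3 E1 E2 (H f Lf) => t e1 e2 e3.
by rewrite iterS e1 e2 e3 scalerA addrCA nat1r.
Qed.

End bounded_operators_iter.

(** Gamma(c) times J^c inside ]t0, t1[, and 0 elsewhere; unlike [RL_integral] it has no special case
    at c = 0. *)
Definition RL_op {R : realType} {X : completeNormedModType R} (t0 t1 c : R)
    (f : R -> X) : R -> X :=
  kop (@lebesgue_measure R) (power_kernel t0 t1 c) f.

Section riemann_liouville_operators.
Context {R : realType} {X : completeNormedModType R} (t0 t1 : R).
Hypothesis t01 : t0 < t1.
Local Notation mu := (@lebesgue_measure R).
Local Notation D := (`]t0, t1[%classic : set R).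
Local Notation G := (RL_op t0 t1).
Implicit Types f u v w : R -> X.

Lemma cut_RL_kernel c f t : D t ->
  cut (`]t0, t[%classic : set R) (RL_kernel c f t) =
  fun s => power_kernel t0 t1 c (t, s) *: cut D f s.
Proof.
rewrite /= in_itv/= => /andP[t0t tt1]; apply/funext => s.
have [|ns] := pselect (`]t0, t[%classic s).
  rewrite /= in_itv/= => /andP[t0s st].
  rewrite !cut_in//= ?in_itv/= ?t0s ?st ?(lt_trans st)//.
  by rewrite /power_kernel /= t0s st tt1.
rewrite cut_out// /power_kernel /= tt1 andbT ifF ?scale0r//.
by apply/negP => s01; apply: ns; rewrite /= in_itv.
Qed.

Lemma RL_op_out c f t : ~ D t -> RL_op t0 t1 c f t = 0.
Proof.
move=> tD; rewrite /RL_op /kop (_ : (fun _ => _) = fun=> 0); first exact: bint0.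
by apply/funext => s; rewrite power_kernel_out ?scale0r// => -[].
Qed.

Lemma cut_RL_integral c f : c != 0 ->
  cut D (RL_integral t0 c f) = fun t => (Gamma c)^-1 *: G c (cut D f) t.
Proof.
move=> c0; apply/funext => t; rewrite /RL_integral (negbTE c0).
have [tD|tD] := pselect (D t).
  rewrite cut_in// (@bochner_integralE _ _ _ mu X _ (measurable_itv `]t0, t[)).
  have E := cut_RL_kernel c f tD.
  by rewrite /RL_op /kop; congr (_ *: bint mu _); exact: E.
by rewrite cut_out// RL_op_out// scaler0.
Qed.

Lemma RL_kernel_integrable c f : 0 < c -> L1 mu (cut D f) ->
  \forall t \ae mu, D t -> bochner_integrable mu `]t0, t[ (RL_kernel c f t).
Proof.
move=> c0 Lf; have := @kernel_L1 _ _ R mu X _ _ (power_kernel_L1 t01 c0) _ Lf.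
apply: filterS => t Lt tD.
apply/(@bochner_integrableE _ _ _ mu X _ (measurable_itv `]t0, t[)).
have := cut_RL_kernel c f tD => E; by rewrite [X in L1 _ X]E.
Qed.

Lemma RL_op_bounded c : 0 < c -> bounded_op mu (RL_op (X := X) t0 t1 c).
Proof. exact: kop_power_bounded. Qed.

Lemma RL_op_comp b c : 0 < b -> 0 < c -> exists2 K : R, 0 < K &
  forall f, L1 mu f -> \forall t \ae mu, G b (G c f) t = K *: G (b + c) f t.
Proof.
move=> b0 c0; have [K K0 HK] := power_kernel_comp t01 b0 c0.
have Doo : (mu D < +oo)%E by rewrite lebesgue_measure_itv/= lte_fin t01 -EFinB ltry.
exists K => // f Lf.
exact: (@kop_comp _ _ R mu X D (measurable_itv `]t0, t1[) Doo _ _ _ K f (ltW K0)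
  (power_kernel_L1 t01 b0) (power_kernel_L1 t01 c0)
  (power_kernel_L1 t01 (addr_gt0 b0 c0)) HK Lf).
Qed.

Lemma iter_RL_op j c : 0 < c -> exists2 K : R, 0 < K &
  forall f, L1 mu f -> \forall t \ae mu, iter j (G 1) (G c f) t = K *: G (c + j%:R) f t.
Proof. exact: bounded_op_semigroup_iter RL_op_bounded RL_op_comp. Qed.

(** Each integration by parts removes the outermost primitive and one derivative of [phi], at the
    price of a sign. *)
Lemma bint_derive1n_iter j phi w : test_function t0 t1 phi -> L1 mu w ->
  bint mu (fun t => derive1n j phi t *: iter j (G 1) w t) =
  (- 1) ^+ j *: bint mu (fun t => phi t *: w t).
Proof.
move=> tphi Lw; elim: j => [|j IH]; first by rewrite expr0 scale1r.
have b1 := RL_op_bounded ltr01.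
rewrite derive1nS iterS (bint_derive1_kop t01 (test_function_derive1n j tphi)).
  by rewrite IH exprS mulN1r scaleNr.
exact: (bounded_op_L1 (bounded_op_iter j b1) Lw).
Qed.

Lemma locally_integrable_L1 u : L1 mu (cut D u) -> Defs.locally_integrable t0 t1 u.
Proof.
move=> Lu a b t0a bt1.
apply/(@bochner_integrableE _ _ _ mu X _ (measurable_itv `[a, b])).
have E : cut (`[a, b]%classic : set R) u =
    fun t => (\1_(`[a, b]%classic : set R) t : R) *: cut D u t.
  apply/funext => t; rewrite -cutE; have [tab|tab] := pselect (`[a, b]%classic t).
    rewrite !cut_in//; move: tab; rewrite /= !in_itv/= => /andP[at_ tb].
    by rewrite (lt_le_trans t0a at_) (le_lt_trans tb bt1).
  by rewrite !(cut_out _ tab).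
rewrite [X in L1 _ X]E; exact: (@L1_indic _ _ _ mu X _ _ (measurable_itv `[a, b]) Lu).
Qed.

Lemma iter_is_weak_derivative k u v w : L1 mu w ->
    (\forall t \ae mu, cut D u t = iter k (G 1) w t) ->
    (\forall t \ae mu, cut D v t = w t) ->
  is_weak_derivative t0 t1 k u v.
Proof.
move=> Lw uw vw.
have b1 := RL_op_bounded ltr01.
have Lu : L1 mu (cut D u).
  exact: ae_eq_L1 (ae_sym uw) (bounded_op_L1 (bounded_op_iter k b1) Lw).
have Lv : L1 mu (cut D v) := ae_eq_L1 (ae_sym vw) Lw.
split; [exact: locally_integrable_L1|exact: locally_integrable_L1|].
move=> phi tphi; rewrite !(@bochner_integralE _ _ _ mu X _ (measurable_itv `]t0, t1[)).
have := bint_derive1n_iter k tphi Lw; rewrite !cutZ.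
rewrite -(@ae_eq_bint_scale _ _ R mu X (derive1n k phi) _ _ uw) => ->.
by rewrite (@ae_eq_bint_scale _ _ R mu X phi _ _ vw).
Qed.

(** By uniqueness, the representative chosen by [xget] inherits integrability and norm from any
    explicit weak derivative. *)
Lemma weak_derivative_Lp k u v : (0 < k)%N -> is_weak_derivative t0 t1 k u v ->
    Lp_space mu D 1 v ->
  [/\ weakly_derivable t0 t1 k u, Lp_space mu D 1 (weak_derivative t0 t1 k u)
    & Lp_norm mu D 1 (weak_derivative t0 t1 k u) = Lp_norm mu D 1 v].
Proof.
case: k => // k _ uv Lv.
have wu : weakly_derivable t0 t1 k.+1 u by exists v.
have uw : is_weak_derivative t0 t1 k.+1 u (weak_derivative t0 t1 k.+1 u).
  by rewrite /weak_derivative; exact: xgetPex.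
have E : \forall t \ae mu, cut D v t = cut D (weak_derivative t0 t1 k.+1 u) t.
  exact: ae_eq_cut (is_weak_derivative_unique uv uw).
split => //.
  apply/(@Lp_spaceE _ _ _ mu X _ (measurable_itv `]t0, t1[)).
  by apply: (ae_eq_L1 E); exact/(@Lp_spaceE _ _ _ mu X _ (measurable_itv `]t0, t1[)).
by rewrite !Lp_normE (ae_eq_norm E).
Qed.

End riemann_liouville_operators.

Lemma natceil_itv (R : realType) (a : R) : 0 < a ->
  (0 < natceil a)%N /\ (natceil a).-1%:R < a <= (natceil a)%:R.
Proof.
move=> a0; have c0 : 0 < Num.ceil a by rewrite ceil_gt0.
have E : (natceil a)%:R = (Num.ceil a)%:~R :> R by rewrite natr_absz gtr0_norm.
have n0 : (0 < natceil a)%N by rewrite absz_gt0 gt_eqF.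
split=> //; rewrite E ceil_ge andbT -[ltLHS](addrK 1) natr1 prednK// E.
by have := ceilB1_lt a; rewrite rmorphB.
Qed.

Section ae_lemmas.
Context d (T : measurableType d) (R : realType).
Variable mu : {measure set T -> \bar R}.
Context {X : completeNormedModType R}.
Implicit Types f g h : T -> X.

Lemma ae_trans f g h : (\forall t \ae mu, f t = g t) ->
  (\forall t \ae mu, g t = h t) -> \forall t \ae mu, f t = h t.
Proof. by move=> fg gh; apply: filterS2 fg gh => t -> ->. Qed.

Lemma ae_scale_comp (a K : R) f g h : (\forall t \ae mu, f t = a *: g t) ->
  (\forall t \ae mu, g t = K *: h t) -> \forall t \ae mu, f t = (a * K) *: h t.
Proof. by move=> fg gh; apply: filterS2 fg gh => t -> ->; rewrite scalerA. Qed.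

Lemma cut_ae_eq D f g : (\forall t \ae mu, cut D f t = cut D g t) -> ae_eq mu D f g.
Proof. by apply: filterS => t fg Dt; move: fg; rewrite !cut_in. Qed.

End ae_lemmas.

(** * Weak derivatives of J^alpha f and the resulting norm bounds *)

Section riemann_liouville_bounded.
Context {R : realType} {X : completeNormedModType R} (t0 t1 : R).
Hypothesis t01 : t0 < t1.
Local Notation mu := (@lebesgue_measure R).
Local Notation D := (`]t0, t1[%classic : set R).
Local Notation G := (RL_op t0 t1).
Local Notation mD := (measurable_itv `]t0, t1[).
Implicit Types (f g : R -> X) (A B : (R -> X) -> R -> X).

Lemma RL_integral_weak_derivative j (c : R) : 0 < c ->
  exists a : R, forall f, L1 mu (cut D f) ->
    is_weak_derivative t0 t1 j (RL_integral t0 (c + j%:R) f)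
      (fun t => a *: G c (cut D f) t).
Proof.
move=> c0; have [K K0 HK] := @iter_RL_op R X t0 t1 t01 j c c0.
have cj0 : c + j%:R != 0 by rewrite gt_eqF// ltr_wpDr.
(* J^(c+j) carries the factor 1/Gamma(c+j), and j primitives of [G c] produce [K] times [G (c + j)],
   whence the division by [K]. *)
exists ((Gamma (c + j%:R))^-1 / K) => f Lf.
have LG := bounded_op_L1 (RL_op_bounded t01 c0) Lf.
apply: (iter_is_weak_derivative t01 (L1Z _ LG)).
  rewrite cut_RL_integral//.
  have S := bounded_op_scale ((Gamma (c + j%:R))^-1 / K)
    (bounded_op_iter j (RL_op_bounded t01 ltr01)) LG.
  have := ae_scale_comp S (HK _ Lf); rewrite divfK ?gt_eqF//; exact: ae_sym.
rewrite cutZ; apply: aeW => t; congr (_ *: _).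
have [Dt|Dt] := pselect (D t); first by rewrite cut_in.
by rewrite cut_out ?RL_op_out.
Qed.

Lemma RL_integral0 f : RL_integral t0 0 f = f.
Proof. by rewrite /RL_integral eqxx. Qed.

Lemma RL_integral_RL_integral (b c : R) : 0 <= b -> 0 < c ->
  exists a : R, forall f, L1 mu (cut D f) ->
    \forall t \ae mu, cut D (RL_integral t0 b (RL_integral t0 c f)) t =
      a *: G (b + c) (cut D f) t.
Proof.
move=> b0 c0; have cn0 : c != 0 by rewrite gt_eqF.
(* [RL_integral] of order 0 is the identity; this is the case of an integer alpha. *)
have [->|bn0] := eqVneq b 0.
  exists (Gamma c)^-1 => f Lf; apply: aeW => t.
  by rewrite add0r RL_integral0 cut_RL_integral.
have b1 : 0 < b by rewrite lt_neqAle eq_sym bn0.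
have [K K0 HK] := @RL_op_comp R X t0 t1 t01 b c b1 c0.
exists ((Gamma b)^-1 * ((Gamma c)^-1 * K)) => f Lf.
have LG := bounded_op_L1 (RL_op_bounded t01 c0) Lf.
rewrite !cut_RL_integral//.
have S := bounded_op_scale (Gamma c)^-1 (RL_op_bounded t01 b1) LG.
apply: ae_scale_comp (ae_scale_comp S (HK _ Lf)).
exact: aeW.
Qed.

Lemma RL_derivative_RL_integral n (b c : R) : (0 < n)%N -> 0 <= b -> 0 < c ->
    b + c = n%:R ->
  exists a : R, forall f, L1 mu (cut D f) ->
    is_weak_derivative t0 t1 n (RL_integral t0 b (RL_integral t0 c f))
      (fun t => a *: f t).
Proof.
case: n => // n _ b0 c0 bc; have [a Ha] := RL_integral_RL_integral b0 c0.
(* The order in [iter_RL_op] must be positive, so of the n + 1 primitives the innermost is taken as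
   the kernel of exponent 1 and only n are iterated. *)
have [K K0 HK] := @iter_RL_op R X t0 t1 t01 n 1 ltr01.
exists (a / K) => f Lf; apply: (iter_is_weak_derivative t01 (L1Z (a / K) Lf)).
  have S := bounded_op_scale (a / K) (bounded_op_iter n.+1 (RL_op_bounded t01 ltr01)) Lf.
  rewrite (iterSr n (G 1) (cut D f)) in S.
  have := ae_scale_comp S (HK _ Lf); rewrite divfK ?gt_eqF// nat1r -bc => S'.
  exact: ae_trans (Ha f Lf) (ae_sym S').
by rewrite cutZ; exact: aeW.
Qed.

Definition Lp_bounded A := exists2 C : R, 0 <= C & forall f, Lp_space mu D 1 f ->
  Lp_space mu D 1 (A f) /\ (Lp_norm mu D 1 (A f) <= C%:E * Lp_norm mu D 1 f)%E.

Lemma bounded_op_Lp A B : bounded_op mu A ->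
  (forall f, cut D (B f) = A (cut D f)) -> Lp_bounded B.
Proof.
move=> [M [M0 AM _]] BA; exists M => // f /(@Lp_spaceE _ _ _ mu X _ mD) Lf.
have [LA NA] := AM _ Lf; rewrite -BA in LA; rewrite -BA in NA.
by split; [exact/(@Lp_spaceE _ _ _ mu X _ mD)|rewrite !Lp_normE].
Qed.

Lemma weak_derivative_bounded k A B : (0 < k)%N -> Lp_bounded B ->
    (forall f, Lp_space mu D 1 f -> is_weak_derivative t0 t1 k (A f) (B f)) ->
  (forall f, Lp_space mu D 1 f -> weakly_derivable t0 t1 k (A f)) /\
  Lp_bounded (fun f => weak_derivative t0 t1 k (A f)).
Proof.
move=> k0 [C C0 HB] AB; split => [f Lf|]; first by exists (B f); exact: AB.
exists C => // f Lf; have [LB NB] := HB f Lf.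
by have [_ LW ->] := weak_derivative_Lp k0 (AB f Lf) LB.
Qed.

Lemma sobolev_bounded m A : Lp_bounded A ->
    (forall j, (0 < j <= m)%N ->
      (forall f, Lp_space mu D 1 f -> weakly_derivable t0 t1 j (A f)) /\
      Lp_bounded (fun f => weak_derivative t0 t1 j (A f))) ->
  exists2 C : R, 0 <= C & forall f, Lp_space mu D 1 f ->
    sobolev_space t0 t1 m 1 (A f) /\
    (sobolev_norm t0 t1 m 1 (A f) <= C%:E * Lp_norm mu D 1 f)%E.
Proof.
move=> bA bW; have bW' j : (j <= m)%N -> Lp_bounded (fun f => weak_derivative t0 t1 j (A f)).
  by case: j => // j jm; have [] := bW j.+1 jm.
suff [C C0 HC] : exists2 C : R, 0 <= C & forall f, Lp_space mu D 1 f ->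
    (sobolev_norm t0 t1 m 1 (A f) <= C%:E * Lp_norm mu D 1 f)%E.
  exists C => // f Lf; split; last exact: HC.
  split; first by have [? _ /(_ f Lf)[]] := bA.
  by move=> j jm; have [wj [? _ /(_ f Lf)[]]] := bW j jm; split; [exact: wj|].
rewrite /sobolev_norm; elim: m bW' {bA bW} => [|m IH] bW.
  have [C C0 HC] := bW 0%N isT; exists C => // f Lf.
  by rewrite big_nat1; have [] := HC f Lf.
have [j jm|C C0 HC] := IH; first by apply: bW; exact: leqW.
have [C' C'0 HC'] := bW m.+1 (leqnn _).
exists (C + C'); first exact: addr_ge0.
move=> f Lf; rewrite big_nat_recr//= EFinD ge0_muleDl ?lee_fin//.
by apply: leeD; [exact: HC|have [] := HC' f Lf].
Qed.

End riemann_liouville_bounded.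

Lemma cutZD d (T : measurableType d) (R : realType) (X : completeNormedModType R)
  (D : set T) (a : R) (f g : T -> X) :
  cut D (fun t => a *: f t + g t) = fun t => a *: cut D f t + cut D g t.
Proof. by apply/funext => t; rewrite !cutE scalerDr !scalerA mulrC. Qed.

Section bounded_operators_ae.
Context d (T : measurableType d) (R : realType).
Variable mu : {measure set T -> \bar R}.
Context {X : completeNormedModType R}.
Variables (D : set T) (A B : (T -> X) -> T -> X).
Hypothesis bA : bounded_op mu A.
Hypothesis BA : forall f, cut D (B f) = A (cut D f).

Lemma bounded_op_ae_eq f g : L1 mu (cut D f) -> L1 mu (cut D g) ->
  ae_eq mu D f g -> ae_eq mu D (B f) (B g).
Proof.
move=> Lf Lg fg; apply: cut_ae_eq; rewrite !BA.
exact: bounded_op_ae bA Lf Lg (ae_eq_cut fg).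
Qed.

Lemma bounded_op_ae_linear (a : R) f g : L1 mu (cut D f) -> L1 mu (cut D g) ->
  ae_eq mu D (B (fun t => a *: f t + g t)) (fun t => a *: B f t + B g t).
Proof.
move=> Lf Lg; have [_ [_ _ lA]] := bA.
by apply: cut_ae_eq; rewrite cutZD !BA cutZD; exact: lA.
Qed.

End bounded_operators_ae.

(** The first clause guards against the default value 0 of [bochner_integral]: for almost every t
    the integral that defines J^alpha f(t) does exist. *)
Theorem theorem10 (R : realType) (X : completeNormedModType R)
    (t0 t1 alpha : R) (t0t1 : t0 < t1) (alpha_ge1 : 1 <= alpha) :
  (forall f : R -> X, Lp_space lebesgue_measure `]t0, t1[ 1 f ->
     \forall t \ae (@lebesgue_measure R), `]t0, t1[%classic t ->
       bochner_integrable lebesgue_measure `]t0, t[ (RL_kernel alpha f t)) /\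
  bounded_linear_operator t0 t1
    (Lp_space lebesgue_measure `]t0, t1[ 1)
    (RL_space (X := X) t0 t1 alpha 1)
    (Lp_norm lebesgue_measure `]t0, t1[ 1)
    (RL_norm t0 t1 alpha 1)
    (RL_integral t0 alpha).
Proof.
have alpha0 : 0 < alpha := lt_le_trans ltr01 alpha_ge1.
have alphan0 : alpha != 0 by rewrite gt_eqF.
have LpE f := @Lp_spaceE _ _ _ (@lebesgue_measure R) X _ (measurable_itv `]t0, t1[) f.
split=> [f /LpE Lf|]; first exact: RL_kernel_integrable.
have bG : bounded_op (@lebesgue_measure R)
    (fun (f : R -> X) t => (Gamma alpha)^-1 *: RL_op t0 t1 alpha f t).
  exact: bounded_opZ (RL_op_bounded t0t1 alpha0).
have cutG (f : R -> X) := cut_RL_integral t0 t1 f alphan0.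
have bJ : Lp_bounded t0 t1 (RL_integral (X := X) t0 alpha) := bounded_op_Lp bG cutG.
have [n0 /andP[ltn len]] := natceil_itv alpha0.
set n := natceil alpha in n0 ltn len.
have bZ (a : R) : Lp_bounded t0 t1 (fun (f : R -> X) t => a *: f t).
  by apply: bounded_op_Lp (bounded_opZ a (bounded_op_id _)) _ => f; rewrite cutZ.
have bW j : (0 < j <= n.-1)%N ->
    (forall f : R -> X, Lp_space lebesgue_measure `]t0, t1[ 1 f ->
       weakly_derivable t0 t1 j (RL_integral t0 alpha f)) /\
    Lp_bounded t0 t1 (fun f : R -> X => weak_derivative t0 t1 j (RL_integral t0 alpha f)).
  (* For j <= n - 1 < alpha the j-th weak derivative is a multiple of a kernel operator of positive
     order alpha - j. *)
  move=> /andP[j0 jn]; have c0 : 0 < alpha - j%:R.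
    by rewrite subr_gt0 (le_lt_trans _ ltn)// ler_nat.
  have [a] := @RL_integral_weak_derivative R X t0 t1 t0t1 j (alpha - j%:R) c0.
  rewrite subrK => Ha; apply: (weak_derivative_bounded (B := fun f t =>
    a *: RL_op t0 t1 (alpha - j%:R) (cut `]t0, t1[%classic f) t)) => //; last first.
    by move=> f /LpE; exact: Ha.
  apply: bounded_op_Lp (bounded_opZ a (RL_op_bounded t0t1 c0)) _ => f.
  rewrite cutZ; apply/funext => t; congr (_ *: _).
  have [Dt|Dt] := pselect (`]t0, t1[%classic t); first by rewrite cut_in.
  by rewrite cut_out ?RL_op_out.
have [C C0 HC] := sobolev_bounded bJ bW.
have nalpha : 0 <= n%:R - alpha by rewrite subr_ge0.
(* Since (n - alpha) + alpha = n, the fractional derivative of J^alpha f is just a scalar multiple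
   of [f], up to a null set. *)
have [a Ha] := @RL_derivative_RL_integral R X t0 t1 t0t1 n _ _ n0 nalpha alpha0 (subrK _ _).
have [wD [C' C'0 HC']] := weak_derivative_bounded n0 (bZ a) (fun f Lf => Ha f ((LpE f).1 Lf)).
split.
- move=> f Lf; have [SA _] := HC f Lf; have [LD _] := HC' f Lf.
  by split; [|exact: wD|].
- by move=> f g /LpE Lf /LpE Lg; exact: (@bounded_op_ae_eq _ _ R _ X _ _ _ bG cutG f g Lf Lg).
- move=> k f g /LpE Lf /LpE Lg.
  exact: (@bounded_op_ae_linear _ _ R _ X _ _ _ bG cutG k f g Lf Lg).
- exists (C + C') => f Lf; have [_ NA] := HC f Lf; have [_ ND] := HC' f Lf.
  have N0 : (0 <= Lp_norm lebesgue_measure `]t0, t1[ 1 f)%E.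
    by rewrite Lp_normE; exact: norm_ge0.
  by rewrite EFinD ge0_muleDl ?lee_fin//; exact: leeD.
Qed.
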